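(* Let $G$ be a countably infinite cograph such that $G$ is connected and its complement $G^c$ is connected. Then there are $2^{\aleph_0}$ pairwise non-isomorphic graphs $G'$ that are equimorphic to $G$ and such that $G'$ and its complement are both connected.
   Context: Graphs are undirected and loopless; a cograph is a graph with no induced subgraph isomorphic to the path $P_4$ on four vertices. $G$ embeds into $G'$ if $G$ is isomorphic to an induced subgraph of $G'$; $G,G'$ are equimorphic if each embeds into the other. *)

(* Defs.v *)
From Stdlib Require Import Relations.

Definition is_graph {V : Type} (E : V -> V -> Prop) : Prop :=
  (forall x y, E x y -> E y x) /\ (forall x, ~ E x x).

Definition complement {V : Type} (E : V -> V -> Prop) : V -> V -> Prop :=
  fun x y => x <> y /\ ~ E x y.

Definition connected {V : Type} (E : V -> V -> Prop) : Prop :=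
  (exists v : V, True) /\ forall x y, clos_refl_trans V E x y.

Definition embeds {V1 V2 : Type} (E1 : V1 -> V1 -> Prop) (E2 : V2 -> V2 -> Prop) : Prop :=
  exists f : V1 -> V2, (forall x y, f x = f y -> x = y) /\
    (forall x y, E1 x y <-> E2 (f x) (f y)).

Definition equimorphic {V1 V2 : Type} (E1 : V1 -> V1 -> Prop) (E2 : V2 -> V2 -> Prop) : Prop :=
  embeds E1 E2 /\ embeds E2 E1.

Definition isomorphic {V1 V2 : Type} (E1 : V1 -> V1 -> Prop) (E2 : V2 -> V2 -> Prop) : Prop :=
  exists (f : V1 -> V2) (g : V2 -> V1),
    (forall x, g (f x) = x) /\ (forall y, f (g y) = y) /\
    (forall x y, E1 x y <-> E2 (f x) (f y)).

Inductive p4v : Type := p0 | p1 | p2 | p3.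
Definition P4 (x y : p4v) : Prop :=
  match x, y with
  | p0, p1 | p1, p0 | p1, p2 | p2, p1 | p2, p3 | p3, p2 => True
  | _, _ => False
  end.

Definition cograph {V : Type} (E : V -> V -> Prop) : Prop := ~ embeds P4 E.

Definition countably_infinite (V : Type) : Prop :=
  exists (f : nat -> V) (g : V -> nat), (forall n, g (f n) = n) /\ (forall v, f (g v) = v).

(* Main.v *)
Require Import Defs.
From Stdlib Require Import Arith Lia List Classical ClassicalEpsilon
  FunctionalExtensionality PropExtensionality Wellfounded Relations Cantor.

(* Fix a vertex x. Since G has no induced P4, the other vertices are linearly preordered, the classes
   being modules, so that the larger of two inequivalent vertices is adjacent to the smaller one
   exactly when it is adjacent to x. Labelled chains of this kind are described by well-founded
   codes built from sums, omega-sums, reversed omega-sums and shuffles; a minimal bad array argument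
   (Nash-Williams) shows that codes are well-quasi-ordered by realisation. A set is tame if some code
   realised by it forces a copy of it.

   If some module is not tame, take one with as few realised codes as possible. It embeds into each
   of its non-tame submodules, and two of these are disjoint, so a gadget encoding a subset s of the
   naturals may be glued to it without leaving the equimorphy class. If all modules are tame, the
   chain of x has no largest class. Either it contains an infinite run of consecutive classes, among
   which new classes encoding s are inserted, or it contains an interval without extremal jumps
   that embeds into two disjoint subintervals of itself, and the new classes are put on top of it.

   In each case s is determined by the new graph with two marked vertices. So each isomorphism type
   arises from countably many s, and a diagonal argument extracts continuum many types. *)

(** Every enlarged graph contains the old one as an induced subgraph, so only the embedding back
    costs work: some part of the graph must embed into itself and leave room for the new vertices.
    Such self-similarity comes from descent. The codes realised in a shrinking part form a
    decreasing family of downward closed sets, and in a well-quasi-order such a family is eventually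
    constant; a part realising as few codes as possible therefore has copies inside its smaller
    parts. Well-quasi-ordering does not pass through infinitary constructors such as omega-sums and
    shuffles, since a bad sequence of them need not yield one of components. Hence the induction
    runs on arrays indexed by infinite sets, where a component is chosen by looking at a code and
    its successor. Codes are compared only by what they force in the given graph, never by shape.
    Countability enters through recursions that always treat the least vertex not yet placed. Two
    vertices are marked because one serves as base point of the order read off from the edges and
    the other fixes where reading starts. *)

Ltac splits := lazymatch goal with |- _ /\ _ => split; [splits|splits] | _ => idtac end.

(** * Minimal bad arrays *)

Definition set := nat -> Prop.
Definition subset (A B : set) : Prop := forall n, A n -> B n.
Definition infinite (X : set) : Prop := forall n, exists m, n <= m /\ X m.
Definition agree (k : nat) (A B : set) : Prop := forall i, i < k -> (A i <-> B i).
(** An infinite set stands for its increasing enumeration; dropping the least element is then the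
    shift. *)
Definition tail (B : set) : set := fun n => B n /\ exists m, m < n /\ B m.
Definition cut (k : nat) (A B : set) : set := fun i => (i < k /\ A i) \/ (k <= i /\ B i).

Lemma set_ext (A B : set) : (forall n, A n <-> B n) -> A = B.
Proof.
  intros H; apply functional_extensionality; intros n.
  apply propositional_extensionality; auto.
Qed.

Lemma least_exists (A : set) :
  (exists n, A n) -> exists m, A m /\ forall i, A i -> m <= i.
Proof.
  intros [n Hn].
  apply NNPP; intros H.
  assert (forall k, forall i, i <= k -> ~ A i) as C.
  { induction k as [|k IH]; intros i Hi Ai.
    - apply H. exists i; split; auto. intros j _; lia.
    - destruct (classic (i <= k)) as [L|L]; [exact (IH i L Ai)|].
      apply H. exists i; split; auto. intros j Aj.
      destruct (classic (j <= k)) as [L'|L']; [exfalso; exact (IH j L' Aj)|lia]. }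
  exact (C n n (le_n n) Hn).
Qed.

Lemma subset_refl A : subset A A.
Proof. firstorder. Qed.
Lemma subset_trans A B C : subset A B -> subset B C -> subset A C.
Proof. firstorder. Qed.
Lemma agree_refl k A : agree k A A.
Proof. firstorder. Qed.
Lemma agree_sym k A B : agree k A B -> agree k B A.
Proof. firstorder. Qed.
Lemma agree_trans k A B C : agree k A B -> agree k B C -> agree k A C.
Proof. unfold agree; intros H1 H2 i Hi; rewrite (H1 i Hi); auto. Qed.
Lemma agree_le k l A B : l <= k -> agree k A B -> agree l A B.
Proof. unfold agree; intros H H1 i Hi; apply H1; lia. Qed.

Lemma tail_subset B : subset (tail B) B.
Proof. firstorder. Qed.
Lemma tail_infinite B : infinite B -> infinite (tail B).
Proof.
  intros H n. destruct (H 0) as [m [_ Bm]]. destruct (H (S (n + m))) as [p [Lp Bp]].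
  exists p; split; [lia|split; [auto|exists m; split; auto; lia]].
Qed.
Lemma tail_agree k A B : agree k A B -> agree k (tail A) (tail B).
Proof.
  intros H i Hi; unfold tail; rewrite (H i Hi).
  split; intros [H1 [m [Lm Am]]]; split; auto; exists m; split; auto; apply H; auto; lia.
Qed.
Lemma cut_infinite k A B : infinite B -> infinite (cut k A B).
Proof.
  intros H n. destruct (H (n + k)) as [m [Lm Bm]]. exists m; split; [lia|].
  right; split; auto; lia.
Qed.
Lemma cut_agree k A B : agree k (cut k A B) A.
Proof. intros i Hi; unfold cut; split; [intros [[_ H]|[H _]]; auto; lia | auto]. Qed.
Lemma cut_subset k A B : subset B A -> subset (cut k A B) A.
Proof. intros H i [[_ Hi]|[_ Hi]]; auto. Qed.

(** With finitely many stems below a bound, a requirement on all of them is met by finitely many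
    successive refinements. *)
Lemma patterns (k : nat) : exists ts : list set, forall t, exists t', In t' ts /\ agree k t t'.
Proof.
  induction k as [|k [ts IH]].
  - exists ((fun _ => False) :: nil). intros t. exists (fun _ => False).
    split; [left; auto|]. intros i Hi; lia.
  - exists (map (fun t i => i < k /\ t i) ts ++ map (fun t i => i = k \/ (i < k /\ t i)) ts).
    intros t. destruct (IH t) as [t' [I A]].
    destruct (classic (t k)) as [Hk|Hk].
    + exists (fun i => i = k \/ (i < k /\ t' i)). split.
      * apply in_or_app; right. apply in_map_iff. exists t'; auto.
      * intros i Hi. destruct (Nat.eq_dec i k) as [->|N]; [tauto|].
        rewrite (A i) by lia. split; [intros; right; split; auto; lia | intros [?|[_ ?]]; [lia|auto]].
    + exists (fun i => i < k /\ t' i). split.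
      * apply in_or_app; left. apply in_map_iff. exists t'; auto.
      * intros i Hi. destruct (Nat.eq_dec i k) as [->|N].
        { split; [tauto|intros [? _]; lia]. }
        rewrite (A i) by lia. split; [intros; split; auto; lia | tauto].
Qed.

(** * Fusion of decreasing sequences of infinite sets *)

Section Fusion.
Variables (T : Type) (car : T -> set) (le : T -> T -> Prop) (Good : nat -> T -> Prop).
Hypothesis le_refl : forall s, le s s.
Hypothesis le_trans : forall s t u, le s t -> le t u -> le s u.
Hypothesis le_car : forall s t, le s t -> subset (car s) (car t).
Hypothesis car_inf : forall s, infinite (car s).
Hypothesis step : forall s k, exists s', le s' s /\ agree k (car s') (car s) /\ Good k s'.

(** The next bound is the successor of the first element of the new carrier beyond the old bound, so
    that element is frozen from then on. Every successor of an element of [X] thus occurs as a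
    bound, and [Good] has been arranged at each initial segment of the limit. *)
Lemma fusion (s0 : T) : exists (sq : nat -> T) (kq : nat -> nat) (X : set),
  infinite X /\ kq 0 = 0 /\ sq 0 = s0 /\
  (forall n m, n <= m -> le (sq m) (sq n)) /\
  (forall n, Good (kq n) (sq (S n))) /\
  (forall n m, n <= m -> kq n <= kq m) /\
  (forall n, n <= kq n) /\
  (forall n, agree (kq n) (car (sq (S n))) (car (sq n))) /\
  (forall n, subset X (car (sq n))) /\
  (forall n, agree (kq n) X (car (sq n))) /\
  (forall x, X x -> exists n, kq n = S x).
Proof.
  assert (forall p : T * nat, exists q : T * nat,
    le (fst q) (fst p) /\ agree (snd p) (car (fst q)) (car (fst p)) /\ Good (snd p) (fst q) /\
    exists x, snd q = S x /\ snd p <= x /\ car (fst q) x /\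
      forall y, snd p <= y -> car (fst q) y -> x <= y) as H.
  { intros [s k]. destruct (step s k) as [s' [H1 [H2 H3]]].
    destruct (least_exists (fun y => k <= y /\ car s' y)) as [x [[Lx Cx] Mx]].
    { destruct (car_inf s' k) as [m Hm]. exists m; auto. }
    exists (s', S x); simpl; splits; auto.
    exists x; splits; auto. }
  set (nx := fun p => proj1_sig (constructive_indefinite_description _ (H p))).
  assert (Hn : forall p, le (fst (nx p)) (fst p) /\ agree (snd p) (car (fst (nx p))) (car (fst p)) /\
    Good (snd p) (fst (nx p)) /\
    exists x, snd (nx p) = S x /\ snd p <= x /\ car (fst (nx p)) x /\
      forall y, snd p <= y -> car (fst (nx p)) y -> x <= y).
  { intros p; unfold nx; apply (proj2_sig (constructive_indefinite_description _ (H p))). }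
  clearbody nx; clear H.
  set (pq := fix pq n := match n with 0 => (s0, 0) | S n => nx (pq n) end).
  set (sq := fun n => fst (pq n)). set (kq := fun n => snd (pq n)).
  assert (N1 : forall n, le (sq (S n)) (sq n)) by (intros n; apply (Hn (pq n))).
  assert (N2 : forall n, agree (kq n) (car (sq (S n))) (car (sq n))) by (intros n; apply (Hn (pq n))).
  assert (N3 : forall n, Good (kq n) (sq (S n))) by (intros n; apply (Hn (pq n))).
  assert (N4 : forall n, exists x, kq (S n) = S x /\ kq n <= x /\ car (sq (S n)) x /\
      forall y, kq n <= y -> car (sq (S n)) y -> x <= y) by (intros n; apply (Hn (pq n))).
  assert (M1 : forall n m, n <= m -> le (sq m) (sq n)).
  { intros n m L; induction L; eauto. }
  assert (M2 : forall n m, n <= m -> kq n <= kq m).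
  { intros n m L; induction L; auto. destruct (N4 m) as [x [E [L' _]]]. lia. }
  assert (M3 : forall n, n <= kq n).
  { induction n; [lia|]. destruct (N4 n) as [x [E [L' _]]]. lia. }
  assert (M4 : forall n m, n <= m -> agree (kq n) (car (sq m)) (car (sq n))).
  { intros n m L; induction L; [apply agree_refl|].
    eapply agree_trans; [|eassumption]. eapply agree_le; [apply (M2 n m L)|apply N2]. }
  set (X := fun i => forall n, car (sq n) i).
  assert (XA : forall n, agree (kq n) X (car (sq n))).
  { intros n i Hi; split; [intros HX; apply HX|]. intros C m.
    destruct (le_ge_dec n m) as [L|L].
    - apply (M4 n m L); auto.
    - apply (le_car _ _ (M1 m n L)); auto. }
  exists sq, kq, X. splits; auto.
  - intros n. destruct (N4 n) as [x [E [L [C _]]]].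
    exists x. split; [specialize (M3 n); lia|]. apply (XA (S n)); auto. lia.
  - intros n i Hi; apply Hi.
  - intros x Xx.
    destruct (least_exists (fun n => x < kq n)) as [n [Ln Mn]].
    { exists (S x). specialize (M3 (S x)). lia. }
    destruct n as [|n]; [unfold kq in Ln; simpl in Ln; lia|].
    exists (S n). destruct (N4 n) as [y [E [L [C M]]]].
    assert (kq n <= x) by (destruct (le_gt_dec (kq n) x); auto; specialize (Mn n g); lia).
    specialize (M x H (Xx (S n))). lia.
Qed.
End Fusion.

(** * Open families of infinite sets are Ramsey *)

Section Decide.
Variable R : nat -> set -> set -> Prop.
Hypothesis R_hered : forall k t Y Y',
  (forall i, k <= i -> Y' i -> Y i) -> infinite Y' -> R k t Y -> R k t Y'.
Hypothesis R_ext : forall k t t' Y, agree k t t' -> R k t Y -> R k t' Y.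

(** As in Mathias forcing, [t] below [k] is a stem and [Y] a reservoir. Whenever a smaller reservoir
    has the property one shrinks to it; doing this for the finitely many stems at each bound and
    fusing gives a set that decides all its stems. *)
Lemma decide_patterns (X : set) : infinite X -> exists X', infinite X' /\ subset X' X /\
  forall k, (k = 0 \/ exists x, X' x /\ k = S x) -> forall t,
    (exists Y, subset Y X' /\ infinite Y /\ R k t Y) -> R k t X'.
Proof.
  intros IX.
  set (T := {Z : set | infinite Z}).
  set (car := fun s : T => proj1_sig s).
  set (le := fun s s' : T => subset (car s) (car s')).
  set (Good := fun k (s : T) => forall t,
    (exists Y, subset Y (car s) /\ infinite Y /\ R k t Y) -> R k t (car s)).
  assert (CI : forall s, infinite (car s)) by (intros [Z IZ]; auto).
  assert (ST : forall s k, exists s', le s' s /\ agree k (car s') (car s) /\ Good k s').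
  { intros s k. destruct (patterns k) as [ts Hts].
    assert (exists s', le s' s /\ agree k (car s') (car s) /\ forall t, In t ts ->
      (exists Y, subset Y (car s') /\ infinite Y /\ R k t Y) -> R k t (car s')) as [s' [H1 [H2 H3]]].
    { clear Hts; induction ts as [|t ts [s' [H1 [H2 H3]]]].
      - exists s. splits; [apply subset_refl|apply agree_refl|simpl; tauto].
      - destruct (classic (exists Y, subset Y (car s') /\ infinite Y /\ R k t Y)) as [[Y [Y1 [Y2 Y3]]]|N].
        + exists (exist _ (cut k (car s') Y) (cut_infinite k (car s') Y Y2)).
          assert (S1 : subset (cut k (car s') Y) (car s')) by (apply cut_subset; auto).
          unfold le; simpl. splits.
          * eapply subset_trans; eauto.
          * eapply agree_trans; [apply cut_agree|exact H2].
          * intros t' [<-|I] [Z [Z1 [Z2 Z3]]].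
            { apply R_hered with Y; auto; [|apply cut_infinite; auto].
              intros i Li [[? _]|[_ ?]]; auto; lia. }
            { apply R_hered with (car s'); auto; [apply cut_infinite; auto|].
              apply H3; auto. exists Z; splits; auto. eapply subset_trans; eauto. }
        + exists s'; splits; auto.
          intros t' [<-|I] E; [contradiction|auto]. }
    exists s'; splits; auto.
    intros t [Y [Y1 [Y2 Y3]]]. destruct (Hts t) as [t' [I A]].
    apply R_ext with t'; [apply agree_sym; auto|].
    apply H3; auto. exists Y; splits; auto. apply R_ext with t; auto. }
  destruct (fusion T car le Good) with (s0 := exist _ X IX : T)
    as [sq [kq [X' [IX' [K0 [S0 [L [G [KM [KN [AG [SX [XA XK]]]]]]]]]]]]]; auto.
  { intros s; apply subset_refl. }
  { intros s t u; apply subset_trans. }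
  exists X'; splits; auto.
  { generalize (SX 0); rewrite S0; auto. }
  intros k Hk t [Y [Y1 [Y2 Y3]]].
  assert (exists n, kq n = k) as [n E].
  { destruct Hk as [->|[x [Hx ->]]]; eauto. }
  apply R_hered with (car (sq (S n))); auto.
  { intros i _; apply SX. }
  rewrite <- E. apply G. rewrite E. exists Y; splits; auto.
  eapply subset_trans; eauto.
Qed.
End Decide.

Lemma last_below (B : set) (k : nat) :
  exists k', k' <= k /\ (k' = 0 \/ exists x, B x /\ k' = S x) /\ forall i, k' <= i -> i < k -> ~ B i.
Proof.
  induction k as [|k [k' [L [H N]]]].
  - exists 0; splits; auto; intros; lia.
  - destruct (classic (B k)) as [Bk|Bk].
    + exists (S k); splits; auto; [right; eauto|]. intros; lia.
    + exists k'; splits; auto. intros i Hi Li.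
      destruct (Nat.eq_dec i k) as [->|Ne]; auto. apply N; lia.
Qed.

(** Nash-Williams's accept and reject argument: [acc] says that a stem forces membership in [O]. A
    stem that is not accepted has infinitely many one-point extensions that are not accepted, and
    [X2] is thinned so that only these remain. By openness a set with no accepted stem is outside
    [O]. *)
Lemma open_ramsey (X : set) (O : set -> Prop) :
  infinite X ->
  (forall B, infinite B -> subset B X -> O B ->
     exists k, forall B', infinite B' -> subset B' X -> agree k B B' -> O B') ->
  exists Y, infinite Y /\ subset Y X /\
    ((forall B, infinite B -> subset B Y -> O B) \/ (forall B, infinite B -> subset B Y -> ~ O B)).
Proof.
  intros IX OP.
  set (acc := fun k (t Y : set) => forall B, infinite B -> subset B X -> agree k B t ->
    (forall i, k <= i -> B i -> Y i) -> O B).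
  destruct (decide_patterns acc) with (X := X) as [X1 [I1 [S1 D1]]]; auto.
  { intros k t Y Y' H IY H' B HB HX HA Hi; apply H'; auto. }
  { intros k t t' Y A H B HB HX HA Hi; apply H; auto.
    eapply agree_trans; eauto. apply agree_sym; auto. }
  destruct (classic (acc 0 (fun _ => False) X1)) as [Ac|NA].
  { exists X1; splits; auto. left. intros B HB HS; apply Ac; auto.
    - eapply subset_trans; eauto.
    - intros i Hi; lia. }
  set (add := fun (k : nat) (t : set) (x i : nat) => (i < k /\ t i) \/ i = x).
  set (R2 := fun k (t Y : set) => forall x, k <= x -> Y x -> ~ acc (S x) (add k t x) X1).
  destruct (decide_patterns R2) with (X := X1) as [X2 [I2 [S2 D2]]]; auto.
  { intros k t Y Y' H IY H' x Lx Yx; apply H'; auto. }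
  { intros k t t' Y A H x Lx Yx Ac. apply (H x Lx Yx).
    intros B HB HX HA Hi. apply Ac; auto.
    eapply agree_trans; eauto. intros i Li; unfold add.
    split; (intros [[L T]|E]; [left; split; auto; apply A; auto|auto]). }
  exists X2; splits; auto. { eapply subset_trans; eauto. }
  right.
  assert (rej : forall k, (k = 0 \/ exists x, X2 x /\ k = S x) -> forall t, ~ acc k t X1 -> R2 k t X2).
  { intros k Hk t N. apply D2; auto.
    destruct (classic (infinite (fun x => X2 x /\ k <= x /\ ~ acc (S x) (add k t x) X1))) as [F|F].
    - eexists; split; [|split; [exact F|]].
      + intros x [H _]; auto.
      + intros x Lx [_ [_ H]]; auto.
    (* If only finitely many extensions are rejected, the accepted ones form an infinite reservoir
       that accepts the stem itself, and then so does [X1]. *)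
    - exfalso. apply N. apply D1.
      { destruct Hk as [|[x [? ?]]]; [auto|right; exists x; split; auto]. }
      exists (fun x => X2 x /\ k <= x /\ acc (S x) (add k t x) X1). split; [|split].
      + intros x [H _]; auto.
      + apply not_all_ex_not in F. destruct F as [n0 F].
        intros n. destruct (I2 (n + n0 + k)) as [m [Lm Xm]].
        exists m; splits; auto; try lia. apply NNPP; intros C.
        apply F; exists m; splits; auto; lia.
      + intros B HB HX HA Hi.
        destruct (least_exists (fun y => k <= y /\ B y)) as [x [[Lx Bx] Mx]].
        { destruct (HB k) as [m Hm]; exists m; auto. }
        destruct (Hi x Lx Bx) as [_ [_ Ac]]. apply Ac; auto.
        * intros i Li. unfold add. destruct (le_gt_dec k i) as [L|L].
          { split.
            - intros Bi. right. specialize (Mx i (conj L Bi)). lia.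
            - intros [[? _]|E]; [lia|subst; auto]. }
          { rewrite (HA i L). split; auto. intros [[_ ?]|?]; auto; lia. }
        * intros i Li Bi. apply S2. apply (Hi i); auto; lia. }
  intros B HB SB OB.
  (* Each stem of [B] extends the previous one by an element of [X2], so rejection propagates from
     the empty stem. *)
  assert (NB : forall k, (k = 0 \/ exists x, B x /\ k = S x) -> ~ acc k B X1).
  { induction k as [k IH] using (well_founded_induction lt_wf). intros [->|[x [Bx ->]]].
    - intros Ac. apply NA. intros B' H1 H2 _ H4. apply Ac; auto. intros i Hi; lia.
    - destruct (last_below B x) as [k' [L [H N]]].
      assert (R2 k' B X2) as HR.
      { apply rej; [destruct H as [|[z [? ?]]]; [auto|right; exists z; split; auto]|].
        apply IH; auto; lia. }
      intros Ac. apply (HR x L (SB x Bx)).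
      intros B' H1 H2 H3 H4. apply Ac; auto.
      eapply agree_trans; eauto. intros i Li; unfold add. split.
      + intros [[_ ?]|E]; [auto|subst; auto].
      + intros Bi. destruct (Nat.eq_dec i x) as [->|Ne]; auto.
        left; split; auto. destruct (le_gt_dec k' i); auto.
        exfalso; apply (N i); auto; lia. }
  destruct (OP B) as [k Hk]; auto.
  { repeat (eapply subset_trans; eauto). }
  destruct (HB k) as [x [Lx Bx]].
  apply (NB (S x)); [right; eauto|].
  intros B' H1 H2 H3 H4. apply Hk; auto. apply agree_sym. eapply agree_le; [|exact H3]. lia.
Qed.

Lemma open_ramsey_list (X : set) (ps : list (set -> Prop)) :
  infinite X ->
  (forall p, In p ps -> forall B, infinite B -> subset B X -> p B ->
     exists k, forall B', infinite B' -> subset B' X -> agree k B B' -> p B') ->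
  (forall B, infinite B -> subset B X -> exists p, In p ps /\ p B) ->
  exists Y p, infinite Y /\ subset Y X /\ In p ps /\ (forall B, infinite B -> subset B Y -> p B).
Proof.
  revert X; induction ps as [|p ps IH]; intros X IX OP CV.
  - destruct (CV X IX (subset_refl X)) as [p [[] _]].
  - destruct (open_ramsey X p IX) as [Y [IY [SY [H|H]]]].
    { intros B; apply OP; left; auto. }
    + exists Y, p; splits; auto; left; auto.
    + destruct (IH Y IY) as [Z [q [IZ [SZ [Iq Hq]]]]].
      * intros q Iq B HB SB qB.
        destruct (OP q (or_intror Iq) B HB (subset_trans _ _ _ SB SY) qB) as [k Hk].
        exists k. intros B' H1 H2 H3; apply Hk; auto. eapply subset_trans; eauto.
      * intros B HB SB. destruct (CV B HB (subset_trans _ _ _ SB SY)) as [q [[<-|Iq] Hq]]; eauto.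
        exfalso; exact (H B HB SB Hq).
      * exists Z, q; splits; auto; [eapply subset_trans; eauto|right; auto].
Qed.

(** Continuity into a discrete space; such arrays take the place of maps on barriers. *)
Definition continuous_on {Q : Type} (f : set -> Q) (X : set) : Prop :=
  forall B, infinite B -> subset B X ->
    exists k, forall B', infinite B' -> subset B' X -> agree k B B' -> f B' = f B.
Definition bad_on {Q : Type} (le : Q -> Q -> Prop) (f : set -> Q) (X : set) : Prop :=
  forall B, infinite B -> subset B X -> ~ le (f B) (f (tail B)).

Section MinimalBadArray.
Variables (Q : Type) (le lt : Q -> Q -> Prop).
Hypothesis lt_wf : well_founded lt.
Hypothesis lt_trans : forall a b c, lt a b -> lt b c -> lt a c.
Hypothesis le_lt : forall y p x, le y p -> lt p x -> le y x.

Definition leq (a b : Q) : Prop := a = b \/ lt a b.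
Definition improves (g : set -> Q) (Y : set) (f : set -> Q) (X : set) : Prop :=
  subset Y X /\ forall B, infinite B -> subset B Y -> leq (g B) (f B).

Lemma wf_minimal (P : Q -> Prop) : (exists q, P q) -> exists q, P q /\ forall r, P r -> ~ lt r q.
Proof.
  intros [q Hq]. revert Hq. induction q as [q IH] using (well_founded_induction lt_wf). intros Hq.
  destruct (classic (exists r, P r /\ lt r q)) as [[r [Pr Lr]]|N].
  - exact (IH r Lr Pr).
  - exists q; split; auto. intros r Pr Lr; apply N; eauto.
Qed.

Lemma leq_trans a b c : leq a b -> leq b c -> leq a c.
Proof.
  unfold leq; intros [->|H1] [->|H2]; auto. right; eapply lt_trans; eauto.
Qed.
Lemma leq_lt a b c : lt a b -> leq b c -> lt a c.
Proof. intros H [->|H2]; auto. eapply lt_trans; eauto. Qed.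

Lemma leq_chain_stable (a : nat -> Q) :
  (forall n, leq (a (S n)) (a n)) -> exists v N, forall n, N <= n -> a n = v.
Proof.
  intros H.
  destruct (wf_minimal (fun q => exists n, a n = q)) as [v [[N E] M]]; [exists (a 0), 0; auto|].
  exists v, N. intros n L; induction L as [|n L IH]; auto.
  destruct (H n) as [E'|Lt]; [congruence|].
  rewrite IH in Lt. exfalso; apply (M (a (S n))); eauto.
Qed.

Record array := { fn : set -> Q; dom : set;
  dom_inf : infinite dom; fn_cont : continuous_on fn dom; fn_bad : bad_on le fn dom }.

Definition imp (s s' : array) : Prop := improves (fn s) (dom s) (fn s') (dom s').

Lemma imp_refl s : imp s s.
Proof. split; [apply subset_refl|]. intros; left; auto. Qed.
Lemma imp_trans s t u : imp s t -> imp t u -> imp s u.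
Proof.
  intros [H1 H2] [H3 H4]; split; [eapply subset_trans; eauto|].
  intros B HB SB. eapply leq_trans; [apply H2; auto|apply H4; auto].
  eapply subset_trans; eauto.
Qed.

Definition const_on (s : array) (k : nat) (t : set) (w : Q) : Prop :=
  forall B, infinite B -> subset B (dom s) -> agree k B t -> fn s B = w.

(** Nash-Williams's minimal choice, made at one stem. Constancy is demanded because values can be
    compared only where the array no longer depends on how the stem is continued. *)
Definition settled (k : nat) (t : set) (s : array) : Prop :=
  forall s' w, imp s' s -> agree k (dom s') (dom s) -> const_on s' k t w ->
    exists v, const_on s k t v /\ ~ lt w v.

Lemma settle (k : nat) (t : set) (s : array) :
  exists s', imp s' s /\ agree k (dom s') (dom s) /\ settled k t s'.
Proof.
  destruct (classic (exists w s', imp s' s /\ agree k (dom s') (dom s) /\ const_on s' k t w)) as [H|N].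
  - destruct (wf_minimal _ H) as [w [[s' [H1 [H2 H3]]] M]].
    exists s'; splits; auto. intros s'' w' G1 G2 G3.
    exists w; split; auto. apply M. exists s''; splits; auto.
    + eapply imp_trans; eauto.
    + eapply agree_trans; eauto.
  - exists s; splits; [apply imp_refl|apply agree_refl|].
    intros s' w H1 H2 H3. exfalso; apply N; eauto.
Qed.

(** Settling one stem may destroy constancy at another, so for all stems at once one can only keep
    an improvement of a settled array. This suffices, because a further improvement still improves
    that settled array. *)
Definition good (k : nat) (s : array) : Prop :=
  forall t, exists s', imp s s' /\ agree k (dom s) (dom s') /\ settled k t s'.

Lemma good_step (s : array) (k : nat) : exists s', imp s' s /\ agree k (dom s') (dom s) /\ good k s'.
Proof.
  destruct (patterns k) as [ts Hts].
  assert (exists s', imp s' s /\ agree k (dom s') (dom s) /\ forall t, In t ts ->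
    exists s'', imp s' s'' /\ agree k (dom s') (dom s'') /\ settled k t s'') as [s' [H1 [H2 H3]]].
  { clear Hts; induction ts as [|t ts [s1 [H1 [H2 H3]]]].
    - exists s; splits; [apply imp_refl|apply agree_refl|simpl; tauto].
    - destruct (settle k t s1) as [s2 [G1 [G2 G3]]].
      exists s2; splits; [eapply imp_trans; eauto|eapply agree_trans; eauto|].
      intros t' [<-|I].
      + exists s2; splits; [apply imp_refl|apply agree_refl|auto].
      + destruct (H3 t' I) as [s3 [F1 [F2 F3]]].
        exists s3; splits; auto; [eapply imp_trans; eauto|eapply agree_trans; eauto]. }
  exists s'; splits; auto. intros t. destruct (Hts t) as [t' [I A]].
  destruct (H3 t' I) as [s3 [F1 [F2 F3]]]. exists s3; splits; auto.
  intros s4 w E1 E2 E3. destruct (F3 s4 w E1 E2) as [v [V1 V2]].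
  - intros B HB SB AB; apply E3; auto. eapply agree_trans; eauto. apply agree_sym; auto.
  - exists v; split; auto. intros B HB SB AB; apply V1; auto. eapply agree_trans; eauto.
Qed.

Lemma continuous_bound (f : set -> Q) (X B : set) (k0 : nat) :
  continuous_on f X -> infinite B -> subset B X ->
  exists x, B x /\ k0 <= S x /\ forall B', infinite B' -> subset B' X -> agree (S x) B B' -> f B' = f B.
Proof.
  intros C HB SB. destruct (C B HB SB) as [k Hk].
  destruct (HB (k + k0)) as [x [Lx Bx]]. exists x; splits; auto; [lia|].
  intros B' H1 H2 H3. apply Hk; auto. eapply agree_le; [|exact H3]; lia.
Qed.

(* The pointwise limit of the fused arrays is again bad, and the choice made at the
   bounds [kq n] leaves no room for a strict improvement of it. *)
Theorem minimal_bad_array (s0 : array) : exists s, imp s s0 /\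
  forall s', subset (dom s') (dom s) ->
    ~ (forall B, infinite B -> subset B (dom s') -> lt (fn s' B) (fn s B)).
Proof.
  apply NNPP; intros NM.
  assert (IMP : forall s, imp s s0 -> exists s', subset (dom s') (dom s) /\
    forall B, infinite B -> subset B (dom s') -> lt (fn s' B) (fn s B)).
  { intros s Hs. apply NNPP; intros N. apply NM. exists s; split; auto.
    intros s' H1 H2. apply N. eauto. }
  destruct (fusion array dom imp good imp_refl imp_trans) with (s0 := s0)
    as [sq [kq [X [IX [K0 [S0 [L [G [KM [KN [AG [SX [XA XK]]]]]]]]]]]]].
  { intros s t H; apply H. }
  { apply dom_inf. }
  { apply good_step. }
  assert (ST : forall B, infinite B -> subset B X -> exists v N, forall n, N <= n -> fn (sq n) B = v).
  { intros B HB SB. apply leq_chain_stable with (a := fun n => fn (sq n) B). intros n.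
    apply (L n (S n)); auto. eapply subset_trans; eauto. }
  (* Values at a fixed [B] descend in a well-founded order, so they stabilise. The limit may lose
     continuity, which a Ramsey argument restores on a smaller set. *)
  set (fw := fun B => epsilon (inhabits (fn s0 B)) (fun v => exists N, forall n, N <= n -> fn (sq n) B = v)).
  assert (FW : forall B, infinite B -> subset B X -> exists N, forall n, N <= n -> fn (sq n) B = fw B).
  { intros B HB SB. unfold fw. apply epsilon_spec. apply ST; auto. }
  assert (FL : forall B n, infinite B -> subset B X -> leq (fw B) (fn (sq n) B)).
  { intros B n HB SB. destruct (FW B HB SB) as [N HN].
    rewrite <- (HN (N + n)) by lia. apply (L n (N + n)); auto; [lia|]. eapply subset_trans; eauto. }
  assert (FB : bad_on le fw X).
  { intros B HB SB HL.
    assert (subset (tail B) X) as ST' by (eapply subset_trans; [apply tail_subset|auto]).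
    destruct (FW B HB SB) as [N1 H1].
    destruct (FW (tail B) (tail_infinite _ HB) ST') as [N2 H2].
    apply (fn_bad (sq (N1 + N2)) B HB); [eapply subset_trans; eauto|].
    rewrite H1, H2 by lia. auto. }
  set (R := fun k (t Y : set) => exists v, forall B, infinite B -> subset B X -> agree k B t ->
    (forall i, k <= i -> B i -> Y i) -> fw B = v).
  destruct (decide_patterns R) with (X := X) as [X1 [I1 [S1 D1]]]; auto.
  { intros k t Y Y' H IY [v Hv]; exists v. intros B HB SB HA HI; apply Hv; auto. }
  { intros k t t' Y A [v Hv]; exists v. intros B HB SB HA HI; apply Hv; auto.
    eapply agree_trans; eauto. apply agree_sym; auto. }
  set (O := fun B : set => exists k, (k = 0 \/ exists x, X1 x /\ k = S x) /\ R k B X1).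
  destruct (open_ramsey X1 O I1) as [Y [IY [SY HY]]].
  { intros B HB SB [k [Hk [v Hv]]]. exists k. intros B' HB' SB' A. exists k; split; auto.
    exists v. intros B'' F1 F2 F3 F4; apply Hv; auto. eapply agree_trans; eauto. apply agree_sym; auto. }
  assert (SYX : subset Y X) by (eapply subset_trans; eauto).
  assert (OY : forall B, infinite B -> subset B Y -> O B).
  (* If the limit were constant on no stem of [Y], take a minimal [v] that some [sq n] has on a
     whole stem. Later arrays can only lower the values there, which minimality forbids, so the
     limit is [v] on that stem. *)
  { destruct HY as [HY|HY]; auto. exfalso.
    set (P := fun v => exists n x B, infinite B /\ subset B Y /\ Y x /\
      forall B', infinite B' -> subset B' Y -> agree (S x) B' B -> fn (sq n) B' = v).
    assert (PC : forall n B, infinite B -> subset B Y -> P (fn (sq n) B)).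
    { intros n B HB SB.
      destruct (continuous_bound (fn (sq n)) (dom (sq n)) B 0) as [x [Bx [_ Hx]]]; auto.
      { apply fn_cont. }
      { eapply subset_trans; [|apply SX]. eapply subset_trans; eauto. }
      exists n, x, B; splits; auto. intros B' F1 F2 F3; apply Hx; auto.
      - eapply subset_trans; [|apply SX]. eapply subset_trans; eauto.
      - apply agree_sym; auto. }
    destruct (wf_minimal P) as [v [[n [x [B [HB [SB [Yx HV]]]]]] M]].
    { exists (fn (sq 0) Y); apply PC; auto. apply subset_refl. }
    apply (HY B HB SB). exists (S x). split; [right; exists x; split; auto|].
    apply D1; [right; exists x; split; auto|].
    exists Y; splits; auto. exists v. intros B' F1 F2 F3 F4.
    assert (subset B' Y) as F5.
    { intros i Bi. destruct (le_gt_dec (S x) i) as [Le|Gt]; auto. apply SB, F3; auto. }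
    assert (forall m, n <= m -> fn (sq m) B' = v) as F6.
    { intros m Lm.
      destruct (L n m Lm) as [_ Hm]. destruct (Hm B' F1 (subset_trans _ _ _ F2 (SX m))) as [E|Lt].
      - rewrite E. apply HV; auto.
      - rewrite (HV B' F1 F5 F3) in Lt. exfalso. apply (M _ (PC m B' F1 F5) Lt). }
    destruct (FW B' F1 F2) as [N HN]. rewrite <- (HN (N + n)) by lia. apply F6; lia. }
  assert (FC : continuous_on fw Y).
  { intros B HB SB. destruct (OY B HB SB) as [k [Hk [v Hv]]]. exists k.
    intros B' HB' SB' A.
    rewrite (Hv B); auto; [| eapply subset_trans; eauto | apply agree_refl].
    apply Hv; auto; [eapply subset_trans; eauto | apply agree_sym; auto]. }
  set (sw := Build_array fw Y IY FC (fun B HB SB => FB B HB (subset_trans _ _ _ SB SYX))).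
  destruct (IMP sw) as [h [SH LH]].
  { split; simpl.
    - rewrite <- S0. eapply subset_trans; eauto.
    - intros B HB SB. rewrite <- S0. apply FL; auto. eapply subset_trans; eauto. }
  simpl in SH, LH.
  set (Z := dom h). assert (IZ : infinite Z) by apply dom_inf.
  assert (SZX : subset Z X) by (eapply subset_trans; eauto).
  destruct (continuous_bound (fn h) Z Z 0) as [x [Zx [_ Hx]]]; auto.
  { apply fn_cont. } { apply subset_refl. }
  destruct (XK x (SZX x Zx)) as [n En].
  destruct (G n Z) as [s' [G1 [G2 G3]]].
  set (k := kq n) in *.
  assert (SXs : subset X (dom s')) by (eapply subset_trans; [apply (SX (S n))|apply G1]).
  (* The strict improvement [h] lives only on [Z]. It is spliced into [s'] without changing the
     domain below [k]. Where [B] uses [s'] but [tail B] uses [h], badness survives by [le_lt], as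
     [h] lies strictly below [s']. *)
  set (W := cut k X Z).
  assert (SW : subset W X) by (apply cut_subset; auto).
  assert (SWs : subset W (dom s')) by exact (subset_trans _ _ _ SW SXs).
  assert (IW : infinite W) by (apply cut_infinite; auto).
  set (g := fun B => if excluded_middle_informative (forall i, i < k -> B i -> Z i) then fn h B else fn s' B).
  assert (GZ : forall B, subset B W -> (forall i, i < k -> B i -> Z i) -> subset B Z).
  { intros B SB Hi i Bi. destruct (le_gt_dec k i) as [Le|Gt]; auto.
    destruct (SB i Bi) as [[? _]|[_ ?]]; auto; lia. }
  assert (gc : continuous_on g W).
  { intros B HB SB. unfold g at 2.
    destruct (excluded_middle_informative (forall i, i < k -> B i -> Z i)) as [H|H].
    - destruct (continuous_bound (fn h) Z B k) as [y [By [Ly Hy]]]; auto. { apply fn_cont. }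
      exists (S y). intros B' F1 F2 F3. unfold g.
      assert (forall i, i < k -> B' i -> Z i) as H'.
      { intros i Li Bi; apply H; auto. apply F3; auto; lia. }
      destruct (excluded_middle_informative _) as [H0|H0]; [|contradiction].
      apply Hy; auto.
    - destruct (continuous_bound (fn s') (dom s') B k) as [y [By [Ly Hy]]]; auto. { apply fn_cont. }
      { eapply subset_trans; eauto. }
      exists (S y). intros B' F1 F2 F3. unfold g.
      destruct (excluded_middle_informative _) as [H0|H0].
      + exfalso; apply H. intros i Li Bi; apply H0; auto. apply F3; auto; lia.
      + apply Hy; auto. eapply subset_trans; eauto. }
  assert (LHS : forall B, infinite B -> subset B Z -> lt (fn h B) (fn s' B)).
  { intros B HB SB. eapply leq_lt; [apply LH; auto|].
    assert (subset B X) as SBX by (eapply subset_trans; eauto).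
    eapply leq_trans; [apply (FL B (S n)); auto|]. apply G1; auto.
    eapply subset_trans; eauto. }
  assert (gb : bad_on le g W).
  { intros B HB SB. unfold g.
    destruct (excluded_middle_informative (forall i, i < k -> B i -> Z i)) as [H|H].
    - destruct (excluded_middle_informative _) as [H0|H0].
      + apply (fn_bad h); auto.
      + exfalso; apply H0. intros i Li [Bi _]; auto.
    - destruct (excluded_middle_informative _) as [H0|H0].
      + intros C. apply (fn_bad s' B HB).
        { eapply subset_trans; eauto. }
        eapply le_lt; [exact C|]. apply LHS; [apply tail_infinite; auto|].
        apply GZ; auto. eapply subset_trans; [apply tail_subset|auto].
      + apply (fn_bad s'); auto. eapply subset_trans; eauto. }
  set (sg := Build_array g W IW gc gb).
  (* The spliced array is constant on the stem of [Z] with a value strictly below the settled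
     one. *)
  destruct (G3 sg (fn h Z)) as [v [Hv Nv]].
  { split; simpl; [exact SWs|].
    intros B HB SB. unfold g. destruct (excluded_middle_informative _) as [H0|H0].
    - right. apply LHS; auto.
    - left; auto. }
  { simpl. eapply agree_trans; [apply cut_agree|]. eapply agree_trans; [apply XA|].
    eapply agree_trans; [apply agree_sym; apply AG|]. exact G2. }
  { intros B HB SB A. simpl in *. unfold g.
    assert (forall i, i < k -> B i -> Z i) as Hi by (intros i Li; apply A; auto).
    destruct (excluded_middle_informative _) as [H0|H0]; [|contradiction].
    apply Hx; auto. rewrite <- En. apply agree_sym; auto. }
  apply Nv. rewrite <- (Hv Z); auto.
  - apply LHS; auto. apply subset_refl.
  - eapply subset_trans; eauto.
  - apply agree_refl.
Qed.
End MinimalBadArray.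

(** * Codes of labelled chains *)

(* [Real E St c S lam] says that [S] contains the pattern [c]: blocks placed above each other, [lam]
   being the adjacency of a vertex to all lower blocks. [Leaf l c] is one block of label [l] whose
   inside realises [c] for some labelling of its own, [Star] is a set with property [St], and in
   [Big k P] every pattern [P n] recurs cofinally ([Asc], [Desc]) or densely ([Shuf]). *)
Inductive kind : Set := Asc | Desc | Shuf.
Inductive code : Type :=
| Nil : code
| One : code
| Star : code
| Leaf : bool -> code -> code
| Sum : code -> code -> code
| Big : kind -> (nat -> code) -> code.

(* [lam v] is the adjacency of [v] to everything placed below it. *)
Definition below (E : nat -> nat -> Prop) (lam : set) (A B : set) : Prop :=
  forall a b, A a -> B b -> a <> b /\ (E a b <-> lam b).

Definition has_label (l : bool) (lam : set) (T : set) : Prop :=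
  forall v, T v -> (lam v <-> l = true).

Fixpoint Real (E : nat -> nat -> Prop) (St : set -> Prop) (c : code) (S lam : set) {struct c} : Prop :=
  match c with
  | Nil => True
  | One => exists v, S v
  | Star => St S
  | Leaf l c => exists T lam', subset T S /\ has_label l lam T /\ Real E St c T lam'
  | Sum c d => exists T1 T2, subset T1 S /\ subset T2 S /\ below E lam T1 T2 /\
      Real E St c T1 lam /\ Real E St d T2 lam
  | Big Asc P => exists T : nat -> set, (forall k, subset (T k) S) /\
      (forall j k, j < k -> below E lam (T j) (T k)) /\
      (forall n K, exists k, K <= k /\ Real E St (P n) (T k) lam)
  | Big Desc P => exists T : nat -> set, (forall k, subset (T k) S) /\
      (forall j k, j < k -> below E lam (T k) (T j)) /\
      (forall n K, exists k, K <= k /\ Real E St (P n) (T k) lam)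
  | Big Shuf P => exists JJ : set -> Prop, JJ S /\
      forall J, JJ J -> forall n, exists J1 T J2,
        subset J1 J /\ subset T J /\ subset J2 J /\
        below E lam J1 T /\ below E lam T J2 /\ below E lam J1 J2 /\
        JJ J1 /\ JJ J2 /\ Real E St (P n) T lam
  end.

Lemma below_subset E lam A A' B B' :
  subset A' A -> subset B' B -> below E lam A B -> below E lam A' B'.
Proof. intros HA HB H a b Ha Hb; apply H; auto. Qed.

Inductive child : code -> code -> Prop :=
| child_Suml c d : child c (Sum c d)
| child_Sumr c d : child d (Sum c d)
| child_Big k P n : child (P n) (Big k P).

(** A step of [child] keeps the labelling, whereas entering a leaf replaces it. Descent by children
    serves the order [les], descent by leaves the order [leg]. *)
Inductive leaf_of : code -> code -> Prop :=
| leaf_here l c : leaf_of c (Leaf l c)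
| leaf_child c d e : leaf_of c d -> child d e -> leaf_of c e.

Inductive piece : code -> code -> Prop :=
| piece_child c d : child c d -> piece c d
| piece_leaf l c : piece c (Leaf l c).

Lemma piece_wf : well_founded piece.
Proof.
  intros c; induction c; constructor; intros y Hy; inversion Hy; subst;
    try match goal with Hc : child _ _ |- _ => inversion Hc; subst end; auto.
Qed.

Definition child_plus := clos_trans code child.
Definition leaf_plus := clos_trans code leaf_of.

Lemma leaf_of_piece c d : leaf_of c d -> clos_trans code piece c d.
Proof.
  induction 1.
  - apply t_step, piece_leaf.
  - eapply t_trans; [eassumption|]. apply t_step; constructor; auto.
Qed.

Lemma wf_incl_trans (R : code -> code -> Prop) :
  (forall c d, R c d -> clos_trans code piece c d) -> well_founded (clos_trans code R).
Proof.
  intros H. apply wf_incl with (clos_trans code piece).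
  - intros c d; induction 1; auto. eapply t_trans; eauto.
  - apply wf_clos_trans, piece_wf.
Qed.

Lemma child_plus_wf : well_founded child_plus.
Proof. apply wf_incl_trans. intros; apply t_step; constructor; auto. Qed.
Lemma leaf_plus_wf : well_founded leaf_plus.
Proof. apply wf_incl_trans. apply leaf_of_piece. Qed.

Lemma leaf_child_plus c d e : leaf_of c d -> child_plus d e -> leaf_of c e.
Proof. intros H H1; revert H; induction H1; intros; eauto using leaf_child. Qed.

(** * Well-quasi-ordering of codes by realisation *)

Section Order.
Variables (E : nat -> nat -> Prop) (St : set -> Prop).
Hypothesis St_mono : forall S S', subset S S' -> St S -> St S'.

Definition RealG (c : code) (S : set) : Prop := exists lam, Real E St c S lam.
(** Two orders are needed: the blocks of a sum share one labelling and must be compared with it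
    fixed, while the inside of a leaf may be relabelled, so leaves of equal label only need [leg] of
    their insides. *)
Definition les (c d : code) : Prop := forall S lam, Real E St d S lam -> Real E St c S lam.
Definition leg (c d : code) : Prop := forall S, RealG d S -> RealG c S.

Lemma Real_mono c : forall S S' lam, subset S S' -> Real E St c S lam -> Real E St c S' lam.
Proof.
  destruct c as [| | |l c|c d|[| |] P]; simpl; intros S S' lam HS; auto.
  - intros [v Hv]; eauto.
  - apply St_mono; auto.
  - intros [T [lam' [H1 H2]]]; exists T, lam'; split; auto. eapply subset_trans; eauto.
  - intros [T1 [T2 [H1 [H2 H3]]]]; exists T1, T2; split; [|split; [|exact H3]]; eapply subset_trans; eauto.
  - intros [T [H1 H2]]; exists T; split; auto. intros k; eapply subset_trans; eauto.
  - intros [T [H1 H2]]; exists T; split; auto. intros k; eapply subset_trans; eauto.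
  - intros [JJ [H1 H2]].
    (* The family has to contain the whole set; the enlarged set joins it and borrows the splittings
       of [S]. *)
    exists (fun J => JJ J \/ J = S'). split; auto. intros J HJ n.
    assert (exists J0, subset J0 J /\ JJ J0) as [J0 [S0 K0]].
    { destruct HJ as [HJ| ->]; [exists J; split; auto; apply subset_refl|exists S; auto]. }
    destruct (H2 J0 K0 n) as [J1 [T [J2 [A1 [A2 [A3 [A4 [A5 [A6 [A7 [A8 A9]]]]]]]]]]].
    exists J1, T, J2; splits; auto; eapply subset_trans; eauto.
Qed.

Lemma les_leg c d : les c d -> leg c d.
Proof. intros H S [lam HR]; exists lam; auto. Qed.

Lemma child_les c d : child c d -> les c d.
Proof.
  intros H; destruct H as [c d|c d|k P n]; intros S lam; simpl.
  - intros [T1 [T2 [H1 [H2 [H3 [H4 H5]]]]]]. apply (Real_mono _ _ _ _ H1 H4).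
  - intros [T1 [T2 [H1 [H2 [H3 [H4 H5]]]]]]. apply (Real_mono _ _ _ _ H2 H5).
  - destruct k.
    + intros [T [H1 [H2 H3]]]. destruct (H3 n 0) as [k [_ Hk]]. apply (Real_mono _ _ _ _ (H1 k) Hk).
    + intros [T [H1 [H2 H3]]]. destruct (H3 n 0) as [k [_ Hk]]. apply (Real_mono _ _ _ _ (H1 k) Hk).
    + intros [JJ [H1 H2]].
      destruct (H2 S H1 n) as [J1 [T [J2 [A1 [A2 [A3 [A4 [A5 [A6 [A7 [A8 A9]]]]]]]]]]].
      apply (Real_mono _ _ _ _ A2 A9).
Qed.

Lemma les_child_plus y p x : les y p -> child_plus p x -> les y x.
Proof.
  intros H1 H2; revert y H1; induction H2; intros q H1; eauto.
  intros S lam HR. apply H1. eapply child_les; eauto.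
Qed.

Lemma leaf_leg c d : leaf_of c d -> leg c d.
Proof.
  induction 1 as [l c|c d e H IH Hc].
  - intros S [lam [T [lam' [H1 [H2 H3]]]]]. exists lam'. eapply Real_mono; eauto.
  - intros S HR. apply IH. apply (les_leg _ _ (child_les _ _ Hc)); auto.
Qed.

Lemma leg_leaf_plus y p x : leg y p -> leaf_plus p x -> leg y x.
Proof.
  intros H1 H2; revert y H1; induction H2; intros q H1; eauto.
  intros S HR. apply H1. eapply leaf_leg; eauto.
Qed.

Lemma les_Leaf l c d : leg c d -> les (Leaf l c) (Leaf l d).
Proof.
  intros H S lam [T [lam' [H1 [H2 H3]]]]; simpl.
  destruct (H T) as [lam'' H4]; [exists lam'; auto|]. exists T, lam''; auto.
Qed.
Lemma les_Sum c d c' d' : les c c' -> les d d' -> les (Sum c d) (Sum c' d').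
Proof.
  intros Hc Hd S lam [T1 [T2 [H1 [H2 [H3 [H4 H5]]]]]]; simpl. exists T1, T2; splits; auto.
Qed.
Lemma les_Big k P P' : (forall n, exists m, les (P n) (P' m)) -> les (Big k P) (Big k P').
Proof.
  intros H S lam. destruct k; simpl.
  - intros [T [H1 [H2 H3]]]; exists T; splits; auto. intros n K. destruct (H n) as [m Hm].
    destruct (H3 m K) as [k [Lk Hk]]. exists k; auto.
  - intros [T [H1 [H2 H3]]]; exists T; splits; auto. intros n K. destruct (H n) as [m Hm].
    destruct (H3 m K) as [k [Lk Hk]]. exists k; auto.
  - intros [JJ [H1 H2]]; exists JJ; split; auto. intros J HJ n. destruct (H n) as [m Hm].
    destruct (H2 J HJ m) as [J1 [T [J2 [A1 [A2 [A3 [A4 [A5 [A6 [A7 [A8 A9]]]]]]]]]]].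
    exists J1, T, J2; splits; auto.
Qed.

Definition bot (c : code) : code :=
  match c with Leaf _ c => c | _ => Nil end.
Definition suml (c : code) : code := match c with Sum c _ => c | _ => Nil end.
Definition sumr (c : code) : code := match c with Sum _ c => c | _ => Nil end.

Definition derived (f g : set -> code) (X : set) : Prop :=
  (forall B, infinite B -> subset B X -> forall k, (forall B', infinite B' -> subset B' X ->
     agree k B B' -> f B' = f B /\ f (tail B') = f (tail B)) ->
     forall B', infinite B' -> subset B' X -> agree k B B' -> g B' = g B).

Lemma derived_continuous f g X :
  continuous_on f X -> derived f g X -> continuous_on g X.
Proof.
  intros C D B HB SB.
  destruct (C B HB SB) as [k1 H1].
  destruct (C (tail B) (tail_infinite _ HB) (subset_trans _ _ _ (tail_subset B) SB)) as [k2 H2].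
  exists (k1 + k2). apply D; auto. intros B' F1 F2 F3. split.
  - apply H1; auto. eapply agree_le; [|exact F3]; lia.
  - apply H2; [apply tail_infinite; auto| |].
    + eapply subset_trans; [apply tail_subset|auto].
    + apply tail_agree. eapply agree_le; [|exact F3]; lia.
Qed.

Lemma open_on_value (f : set -> code) (X : set) (p : code -> code -> Prop) :
  continuous_on f X -> forall B, infinite B -> subset B X -> p (f B) (f (tail B)) ->
  exists k, forall B', infinite B' -> subset B' X -> agree k B B' -> p (f B') (f (tail B')).
Proof.
  intros C B HB SB Hp.
  destruct (C B HB SB) as [k1 H1].
  destruct (C (tail B) (tail_infinite _ HB) (subset_trans _ _ _ (tail_subset B) SB)) as [k2 H2].
  exists (k1 + k2). intros B' F1 F2 F3.
  rewrite (H1 B'), (H2 (tail B')); auto.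
  - apply tail_infinite; auto.
  - eapply subset_trans; [apply tail_subset|auto].
  - apply tail_agree. eapply agree_le; [|exact F3]; lia.
  - eapply agree_le; [|exact F3]; lia.
Qed.

Lemma continuous_sub {Q : Type} (f : set -> Q) X Y :
  subset Y X -> continuous_on f X -> continuous_on f Y.
Proof.
  intros S C B HB SB. destruct (C B HB (subset_trans _ _ _ SB S)) as [k Hk].
  exists k; intros; apply Hk; auto. eapply subset_trans; eauto.
Qed.

(* Below a child-minimal bad array all children are comparable; once the constructors are made
   constant by Ramsey, only [Leaf] can still be bad. *)
Lemma bad_les_leaf (f : set -> code) (X : set) :
  infinite X -> continuous_on f X -> bad_on les f X ->
  exists g Y, infinite Y /\ subset Y X /\ continuous_on g Y /\ bad_on leg g Y /\
    forall B, infinite B -> subset B Y -> leaf_of (g B) (f B).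
Proof.
  intros IX CX BX.
  destruct (minimal_bad_array code les child_plus child_plus_wf (t_trans _ _) les_child_plus
    (Build_array _ _ f X IX CX BX)) as [[h Y IY CY BY] [[SY LY] M]].
  simpl in *.
  assert (forall g Z, infinite Z -> subset Z Y -> continuous_on g Z -> bad_on les g Z ->
    (forall B, infinite B -> subset B Z -> child (g B) (h B)) -> False) as M'.
  { intros g Z IZ SZ CZ BZ H. apply (M (Build_array _ _ g Z IZ CZ BZ) SZ). simpl.
    intros; apply t_step; auto. }
  clear M.
  (* The possible causes of badness. A constant head constructor is not enough: a bad pair of sums
     can fail on the left or on the right, and Ramsey must fix which. *)
  set (ps := (fun a b => a = Nil) :: (fun a b => a = One /\ b = One) :: (fun a b => a = Star /\ b = Star) ::
    (fun a b => exists c d, a = Leaf true c /\ b = Leaf true d) ::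
    (fun a b => exists c d, a = Leaf false c /\ b = Leaf false d) ::
    (fun a b => exists c d c' d', a = Sum c d /\ b = Sum c' d' /\ ~ les c c') ::
    (fun a b => exists c d c' d', a = Sum c d /\ b = Sum c' d' /\ ~ les d d') ::
    (fun a b => exists P P', a = Big Asc P /\ b = Big Asc P') ::
    (fun a b => exists P P', a = Big Desc P /\ b = Big Desc P') ::
    (fun a b => exists P P', a = Big Shuf P /\ b = Big Shuf P') :: nil : list (code -> code -> Prop)).
  set (hd := fun c => match c with Nil => 0 | One => 1 | Star => 2 | Leaf true _ => 3 | Leaf false _ => 4
    | Sum _ _ => 5 | Big Asc _ => 6 | Big Desc _ => 7 | Big Shuf _ => 8 end).
  assert (exists Z n, infinite Z /\ subset Z Y /\ forall B, infinite B -> subset B Z -> hd (h B) = n)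
    as [Z0 [n0 [IZ0 [SZ0 HZ0]]]].
  { destruct (open_ramsey_list Y (map (fun n B => hd (h B) = n) (seq 0 9))) as [Z [p [IZ [SZ [Ip Hp]]]]]; auto.
    - intros p Ip B HB SB pB. apply in_map_iff in Ip. destruct Ip as [n [<- _]].
      apply (open_on_value h Y (fun a _ => hd a = n)); auto.
    - intros B HB SB. eexists; split; [apply in_map; apply in_seq; split; [apply Nat.le_0_l|]|reflexivity].
      destruct (h B) as [| | |[|] c|c d|[| |] P]; simpl; lia.
    - apply in_map_iff in Ip. destruct Ip as [n [<- _]]. exists Z, n; splits; auto. }
  assert (exists Z p, infinite Z /\ subset Z Y /\ In p ps /\
    forall B, infinite B -> subset B Z -> p (h B) (h (tail B))) as [Z [p [IZ [SZ [Ip HZ]]]]].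
  { destruct (open_ramsey_list Z0 (map (fun p B => p (h B) (h (tail B))) ps)) as [Z [p [IZ [SZ [Iq Hp]]]]]; auto.
    - intros p Iq B HB SB pB. apply in_map_iff in Iq. destruct Iq as [n [<- _]].
      apply (open_on_value h Z0); auto. eapply continuous_sub; eauto.
    - intros B HB SB.
      assert (subset (tail B) Z0) as ST by (eapply subset_trans; [apply tail_subset|auto]).
      pose proof (HZ0 B HB SB) as E1. pose proof (HZ0 (tail B) (tail_infinite _ HB) ST) as E2.
      pose proof (BY B HB (subset_trans _ _ _ SB SZ0)) as NB.
      assert (exists q, In q ps /\ q (h B) (h (tail B))) as [q [I1 I2]].
      { destruct (h B) as [| | |[|] c|c d|[| |] P] eqn:Ea; destruct (h (tail B)) as [| | |[|] c'|c' d'|[| |] P'] eqn:Eb;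
          simpl in E1, E2; try lia; unfold ps.
        - exists (fun a b => a = Nil); simpl; auto.
        - exists (fun a b => a = One /\ b = One); simpl; auto.
        - exists (fun a b => a = Star /\ b = Star); simpl; auto 6.
        - exists (fun a b => exists c d, a = Leaf true c /\ b = Leaf true d); simpl; split; [auto 6|eauto].
        - exists (fun a b => exists c d, a = Leaf false c /\ b = Leaf false d); simpl; split; [auto 8|eauto].
        - destruct (classic (les c c')) as [L|L].
          + exists (fun a b => exists c d c' d', a = Sum c d /\ b = Sum c' d' /\ ~ les d d').
            split; [simpl; auto 10|]. exists c, d, c', d'; splits; auto. intros L'; apply NB, les_Sum; auto.
          + exists (fun a b => exists c d c' d', a = Sum c d /\ b = Sum c' d' /\ ~ les c c').
            split; [simpl; auto 10|]. exists c, d, c', d'; splits; auto.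
        - exists (fun a b => exists P P', a = Big Asc P /\ b = Big Asc P'); simpl; split; [auto 10|eauto].
        - exists (fun a b => exists P P', a = Big Desc P /\ b = Big Desc P'); simpl; split; [auto 12|eauto].
        - exists (fun a b => exists P P', a = Big Shuf P /\ b = Big Shuf P'); simpl; split; [auto 12|eauto]. }
      exists (fun B => q (h B) (h (tail B))). split; auto. apply in_map_iff. eauto.
    - apply in_map_iff in Iq. destruct Iq as [q [<- Iq]].
      exists Z, q; splits; auto. eapply subset_trans; eauto. }
  clear Z0 n0 IZ0 SZ0 HZ0 hd.
  assert (CZ : continuous_on h Z) by (eapply continuous_sub; eauto).
  assert (BZ : forall B, infinite B -> subset B Z -> ~ les (h B) (h (tail B))).
  { intros B HB SB; apply BY; auto. eapply subset_trans; eauto. }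
  assert (TB : forall B, infinite B -> subset B Z -> infinite (tail B) /\ subset (tail B) Z).
  { intros B HB SB; split; [apply tail_infinite; auto|eapply subset_trans; [apply tail_subset|auto]]. }
  assert (DF : forall r : code -> code -> code, continuous_on (fun B => r (h B) (h (tail B))) Z).
  { intros r. apply derived_continuous with h; auto. intros B HB SB k H B' F1 F2 F3.
    destruct (H B' F1 F2 F3) as [-> ->]; auto. }
  assert (LF : forall l, (forall B, infinite B -> subset B Z -> exists c d, h B = Leaf l c /\ h (tail B) = Leaf l d) ->
    exists g Y, infinite Y /\ subset Y X /\ continuous_on g Y /\ bad_on leg g Y /\
      forall B, infinite B -> subset B Y -> leaf_of (g B) (f B)).
  { intros l Hl. exists (fun B => bot (h B)), Z. splits; auto.
    - eapply subset_trans; eauto.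
    - apply (DF (fun a _ => bot a)).
    - intros B HB SB L. apply (BZ B HB SB).
      destruct (Hl B HB SB) as [c [d [E1 E2]]]. rewrite E1, E2 in *. apply les_Leaf; auto.
    - intros B HB SB. destruct (Hl B HB SB) as [c [d [E1 E2]]].
      assert (leaf_of (bot (h B)) (h B)) as L1 by (rewrite E1; constructor).
      destruct (LY B HB (subset_trans _ _ _ SB SZ)) as [<-|L2]; auto.
      eapply leaf_child_plus; eauto. }
  assert (BG : forall k, (forall B, infinite B -> subset B Z -> exists P P', h B = Big k P /\ h (tail B) = Big k P') -> False).
  { intros k Hk.
    (* By [les_Big], badness yields a component of [h B] below no component of [h (tail B)]. These
       witnesses form a smaller bad array, since the witness at [tail B] is itself a component of
       [h (tail B)]. *)
    set (r := fun a b => epsilon (inhabits Nil) (fun c => child c a /\ forall d, child d b -> ~ les c d)).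
    assert (Hr : forall B, infinite B -> subset B Z -> child (r (h B) (h (tail B))) (h B) /\
      forall d, child d (h (tail B)) -> ~ les (r (h B) (h (tail B))) d).
    { intros B HB SB. unfold r. apply epsilon_spec.
      destruct (Hk B HB SB) as [P [P' [E1 E2]]]. pose proof (BZ B HB SB) as NB. rewrite E1, E2 in *.
      apply NNPP; intros N. apply NB, les_Big. intros n. apply NNPP; intros N'. apply N.
      exists (P n); split; [constructor|]. intros d Hd L; inversion Hd; subst. eauto. }
    apply (M' (fun B => r (h B) (h (tail B))) Z); auto.
    - intros B HB SB L. destruct (TB B HB SB) as [T1 T2].
      apply (proj2 (Hr B HB SB) (r (h (tail B)) (h (tail (tail B))))); auto. apply Hr; auto.
    - intros; apply Hr; auto. }
  assert (ID := IZ).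
  simpl in Ip. destruct Ip as [<-|[<-|[<-|[<-|[<-|[<-|[<-|[<-|[<-|[<-|[]]]]]]]]]]].
  - exfalso. apply (BZ Z IZ (subset_refl Z)). rewrite (HZ Z IZ (subset_refl Z)). intros S lam _; exact I.
  - exfalso. apply (BZ Z IZ (subset_refl Z)). destruct (HZ Z IZ (subset_refl Z)) as [-> ->]. intros S lam; auto.
  - exfalso. apply (BZ Z IZ (subset_refl Z)). destruct (HZ Z IZ (subset_refl Z)) as [-> ->]. intros S lam; auto.
  - apply (LF true); auto.
  - apply (LF false); auto.
  - exfalso. apply (M' (fun B => suml (h B)) Z); auto.
    + apply (DF (fun a _ => suml a)).
    + intros B HB SB L. destruct (HZ B HB SB) as [c [d [c' [d' [E1 [E2 N]]]]]]. rewrite E1, E2 in L. auto.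
    + intros B HB SB. destruct (HZ B HB SB) as [c [d [c' [d' [E1 [E2 N]]]]]]. rewrite E1. constructor.
  - exfalso. apply (M' (fun B => sumr (h B)) Z); auto.
    + apply (DF (fun a _ => sumr a)).
    + intros B HB SB L. destruct (HZ B HB SB) as [c [d [c' [d' [E1 [E2 N]]]]]]. rewrite E1, E2 in L. auto.
    + intros B HB SB. destruct (HZ B HB SB) as [c [d [c' [d' [E1 [E2 N]]]]]]. rewrite E1. constructor.
  - exfalso; apply (BG Asc); auto.
  - exfalso; apply (BG Desc); auto.
  - exfalso; apply (BG Shuf); auto.
Qed.

(** A [leg]-bad array is [les]-bad, so a minimal one would produce a [leg]-bad array of leaf
    insides, which are strictly smaller. *)
Lemma no_bad_leg (f : set -> code) (X : set) :
  infinite X -> continuous_on f X -> bad_on leg f X -> False.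
Proof.
  intros IX CX BX.
  destruct (minimal_bad_array code leg leaf_plus leaf_plus_wf (t_trans _ _) leg_leaf_plus
    (Build_array _ _ f X IX CX BX)) as [[h Y IY CY BY] [[SY LY] M]].
  simpl in *.
  destruct (bad_les_leaf h Y IY CY) as [g [Z [IZ [SZ [CZ [BZ H]]]]]].
  { intros B HB SB L. apply (BY B HB SB), les_leg; auto. }
  apply (M (Build_array _ _ g Z IZ CZ BZ) SZ). simpl. intros; apply t_step; auto.
Qed.

Lemma no_bad_les (f : set -> code) (X : set) :
  infinite X -> continuous_on f X -> bad_on les f X -> False.
Proof.
  intros IX CX BX. destruct (bad_les_leaf f X IX CX BX) as [g [Z [IZ [SZ [CZ [BZ H]]]]]].
  eapply no_bad_leg; eauto.
Qed.

(** The bridge from sequences to arrays: reading the sequence at the least element of [B] is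
    continuous, and [tail B] reads it at a later index. *)
Lemma first_elements (c : nat -> code) : exists f : set -> code,
  continuous_on f (fun _ => True) /\
  forall B, infinite B -> exists i j, i < j /\ f B = c i /\ f (tail B) = c j.
Proof.
  set (ls := fun B : set => epsilon (inhabits 0) (fun m => B m /\ forall i, B i -> m <= i)).
  assert (LS : forall B, infinite B -> B (ls B) /\ forall i, B i -> ls B <= i).
  { intros B HB. unfold ls. apply epsilon_spec. apply least_exists. destruct (HB 0) as [m [_ Hm]]; eauto. }
  exists (fun B => c (ls B)). split.
  - intros B HB _. exists (S (ls B)). intros B' HB' _ A. f_equal.
    destruct (LS B HB) as [H1 H2]. destruct (LS B' HB') as [H3 H4].
    assert (B' (ls B)) as H5 by (apply A; auto).
    specialize (H4 _ H5). assert (B (ls B')) as H6 by (apply A; auto; lia).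
    specialize (H2 _ H6). lia.
  - intros B HB. exists (ls B), (ls (tail B)); splits; auto.
    destruct (LS B HB) as [H1 H2]. destruct (LS _ (tail_infinite _ HB)) as [[H3 [m [Lm Bm]]] H4].
    specialize (H2 m Bm). lia.
Qed.

Lemma wqo_les (c : nat -> code) : exists i j, i < j /\ les (c i) (c j).
Proof.
  apply NNPP; intros N. destruct (first_elements c) as [f [CF HF]].
  apply (no_bad_les f (fun _ => True)); auto.
  - intros n; exists n; auto.
  - intros B HB _ L. destruct (HF B HB) as [i [j [Lij [E1 E2]]]]. rewrite E1, E2 in L.
    apply N; eauto.
Qed.

(** Infinitely many terms, each with no majorant beyond some point, could be spaced out into a bad
    sequence. *)
Lemma wqo_recurrent (c : nat -> code) :
  exists N, forall n, N <= n -> forall K, exists m, K <= m /\ les (c n) (c m).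
Proof.
  apply NNPP; intros H.
  assert (forall N, exists p : nat * nat, N <= fst p /\ forall m, snd p <= m -> ~ les (c (fst p)) (c m)) as F.
  { intros N. apply NNPP; intros G. apply H. exists N. intros n Ln K.
    apply NNPP; intros G'. apply G. exists (n, K); simpl; split; auto.
    intros m Lm L; apply G'; eauto. }
  set (g := fun N => proj1_sig (constructive_indefinite_description _ (F N))).
  assert (G : forall N, N <= fst (g N) /\ forall m, snd (g N) <= m -> ~ les (c (fst (g N))) (c m))
    by (intros N; unfold g; apply (proj2_sig (constructive_indefinite_description _ (F N)))).
  clearbody g.
  set (b := fix b n := match n with 0 => 0 | S n => S (b n + fst (g (b n)) + snd (g (b n))) end).
  assert (BM : forall n m, n < m -> fst (g (b n)) + snd (g (b n)) < b m).
  { intros n m L; induction L as [|m L IH]; simpl; lia. }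
  destruct (wqo_les (fun n => c (fst (g (b n))))) as [i [j [L Hij]]].
  apply (proj2 (G (b i)) (fst (g (b j)))); auto.
  specialize (BM i j L). destruct (G (b j)) as [G1 _]. lia.
Qed.

(** The descending chain condition for downward closed sets of codes. If each step of a descent lost
    a code, the lost codes would form a bad sequence, as a code lost earlier cannot lie below one
    still present. *)
Lemma minimal_codes {A : Type} (R : A -> A -> Prop) (T : A -> code -> Prop) (a0 : A) :
  (forall a, R a a) -> (forall a b c, R a b -> R b c -> R a c) ->
  (forall a b c, R a b -> T a c -> T b c) ->
  (forall a c d, les c d -> T a d -> T a c) ->
  exists a, R a a0 /\ forall b, R b a -> forall c, T a c -> T b c.
Proof.
  intros R1 R2 TM TL. apply NNPP; intros N.
  assert (F : forall p : {a | R a a0}, exists q : {a | R a a0} * code,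
    R (proj1_sig (fst q)) (proj1_sig p) /\ T (proj1_sig p) (snd q) /\ ~ T (proj1_sig (fst q)) (snd q)).
  { intros [a Ha]. apply NNPP; intros N'. apply N. exists a; split; auto.
    intros b Hb c Tc. apply NNPP; intros Nc. apply N'.
    exists (exist _ b (R2 _ _ _ Hb Ha), c); simpl; auto. }
  set (g := fun p => proj1_sig (constructive_indefinite_description _ (F p))).
  assert (G : forall p, R (proj1_sig (fst (g p))) (proj1_sig p) /\ T (proj1_sig p) (snd (g p)) /\
    ~ T (proj1_sig (fst (g p))) (snd (g p)))
    by (intros p; unfold g; apply (proj2_sig (constructive_indefinite_description _ (F p)))).
  clearbody g.
  set (b := fix b n := match n with 0 => exist _ a0 (R1 a0) | S n => fst (g (b n)) end).
  assert (BM : forall n m, n <= m -> R (proj1_sig (b m)) (proj1_sig (b n))).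
  { intros n m L; induction L as [|m L IH]; auto. eapply R2; [|exact IH]. apply G. }
  destruct (wqo_les (fun n => snd (g (b n)))) as [i [j [L Hij]]].
  destruct (G (b i)) as [G1 [G2 G3]]. destruct (G (b j)) as [G4 [G5 G6]].
  apply G3. apply (TM _ _ _ (BM (S i) j L)). eapply TL; eauto.
Qed.
End Order.

(** * Every labelled chain has a code *)

Section Assign.
Variables (Good : set -> set -> Prop) (C : nat -> nat -> set -> set -> Prop)
  (Fin : nat -> set -> Prop) (Same : nat -> nat -> Prop).
Hypothesis C_anti : forall v w A B A' B', C v w A B -> subset A' A -> subset B' B -> C v w A' B'.
Hypothesis assign_step : forall S T u, Good S T -> S u -> (forall i, S i -> u <= i) ->
  exists (fin : nat -> Prop) (ns nt : nat -> set), fin u /\ forall v, S v ->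
    subset (nt v) T /\ (fin v -> Fin v (nt v)) /\
    (~ fin v -> Good (ns v) (nt v) /\ ns v v /\ subset (ns v) S /\ ~ ns v u) /\
    forall w, S w -> C v w (nt v) (nt w) \/ (fin v /\ fin w /\ nt v = nt w /\ Same v w) \/
      (~ fin v /\ ~ fin w /\ ns v = ns w /\ nt v = nt w).

Inductive reach (fin : set -> set -> nat -> Prop) (ns nt : set -> set -> nat -> set) (v : nat) :
  set -> set -> set -> Prop :=
| reach_fin S T : fin S T v -> reach fin ns nt v S T (nt S T v)
| reach_next S T Y : ~ fin S T v -> reach fin ns nt v (ns S T v) (nt S T v) Y -> reach fin ns nt v S T Y.

(** A task is to place the vertices of [S] inside [T]. The least vertex is finished and leaves its
    group, so every vertex is finished after finitely many steps. The relation of two vertices is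
    settled at the step where they part, and [C_anti] protects it when regions shrink later. *)
Lemma recursive_assignment S0 T0 : Good S0 T0 -> exists Y : nat -> set,
  forall v, S0 v -> subset (Y v) T0 /\ Fin v (Y v) /\
    forall w, S0 w -> C v w (Y v) (Y w) \/ (Same v w /\ Y v = Y w).
Proof.
  intros G0.
  assert (F : forall p : set * set, exists q : (nat -> Prop) * (nat -> set) * (nat -> set),
    Good (fst p) (snd p) -> (exists v, fst p v) -> exists u, fst p u /\ (forall i, fst p i -> u <= i) /\
    fst (fst q) u /\ forall v, fst p v ->
    subset (snd q v) (snd p) /\ (fst (fst q) v -> Fin v (snd q v)) /\
    (~ fst (fst q) v -> Good (snd (fst q) v) (snd q v) /\ snd (fst q) v v /\
       subset (snd (fst q) v) (fst p) /\ ~ snd (fst q) v u) /\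
    forall w, fst p w -> C v w (snd q v) (snd q w) \/
      (fst (fst q) v /\ fst (fst q) w /\ snd q v = snd q w /\ Same v w) \/
      (~ fst (fst q) v /\ ~ fst (fst q) w /\ snd (fst q) v = snd (fst q) w /\ snd q v = snd q w)).
  { intros [S T]. simpl.
    destruct (classic (Good S T /\ exists v, S v)) as [[HG HE]|N].
    - destruct (least_exists S HE) as [u [Su Mu]].
      destruct (assign_step S T u HG Su Mu) as [fin [ns [nt [H1 H2]]]].
      exists (fin, ns, nt); simpl. intros _ _. exists u; auto.
    - exists (fun _ => True, fun _ => S, fun _ => S). intros; tauto. }
  set (g := fun p => proj1_sig (constructive_indefinite_description _ (F p))).
  set (fin := fun S T => fst (fst (g (S, T)))). set (ns := fun S T => snd (fst (g (S, T)))).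
  set (nt := fun S T => snd (g (S, T))).
  assert (H : forall S T, Good S T -> (exists v, S v) -> exists u, S u /\ (forall i, S i -> u <= i) /\
    fin S T u /\ forall v, S v ->
    subset (nt S T v) T /\ (fin S T v -> Fin v (nt S T v)) /\
    (~ fin S T v -> Good (ns S T v) (nt S T v) /\ ns S T v v /\ subset (ns S T v) S /\ ~ ns S T v u) /\
    forall w, S w -> C v w (nt S T v) (nt S T w) \/
      (fin S T v /\ fin S T w /\ nt S T v = nt S T w /\ Same v w) \/
      (~ fin S T v /\ ~ fin S T w /\ ns S T v = ns S T w /\ nt S T v = nt S T w)).
  { intros S T. exact (proj2_sig (constructive_indefinite_description _ (F (S, T)))). }
  clearbody fin ns nt; clear g F.
  (* The least element of the group of [v] strictly increases, so its distance to [v] bounds the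
     number of steps. *)
  assert (RE : forall v n S T, Good S T -> S v -> (forall i, S i -> v <= n + i) ->
    exists Y, reach fin ns nt v S T Y).
  { intros v n; induction n as [|n IH]; intros S T G Sv Hn.
    - destruct (H S T G (ex_intro _ v Sv)) as [u [Su [Mu [Fu Hv]]]].
      assert (u = v) as -> by (specialize (Hn u Su); specialize (Mu v Sv); lia).
      eexists; apply reach_fin; auto.
    - destruct (classic (fin S T v)) as [Fv|Fv]; [eexists; apply reach_fin; auto|].
      destruct (H S T G (ex_intro _ v Sv)) as [u [Su [Mu [Fu Hv]]]].
      destruct (Hv v Sv) as [_ [_ [Hx _]]]. destruct (Hx Fv) as [G' [V' [S' U']]].
      destruct (IH _ _ G' V') as [Y HY].
      + intros i Hi.
        assert (u <> i) by (intros ->; auto). pose proof (Mu i (S' i Hi)). specialize (Hn u Su). lia.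
      + exists Y; apply reach_next; auto. }
  assert (R1 : forall v S T Y, reach fin ns nt v S T Y -> Good S T -> S v -> subset Y T /\ Fin v Y).
  { intros v S T Y HR; induction HR as [S T Fv|S T Y Fv HR IH]; intros G Sv;
      destruct (H S T G (ex_intro _ v Sv)) as [u [Su [Mu [Fu Hv]]]];
      destruct (Hv v Sv) as [H1 [H2 [H3 _]]].
    - auto.
    - destruct (H3 Fv) as [G' [V' [S' U']]]. destruct (IH G' V') as [I1 I2]; split; auto.
      eapply subset_trans; eauto. }
  assert (R2 : forall v w S T Y, reach fin ns nt v S T Y -> Good S T -> S v -> S w ->
    forall Y', reach fin ns nt w S T Y' -> C v w Y Y' \/ (Same v w /\ Y = Y')).
  { intros v w S T Y HR; induction HR as [S T Fv|S T Y Fv HR IH]; intros G Sv Sw Y' HR';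
      destruct (H S T G (ex_intro _ v Sv)) as [u [Su [Mu [Fu Hv]]]];
      destruct (Hv v Sv) as [H1 [H2 [H3 H4]]].
    - inversion HR' as [S1 T1 Fw|S1 T1 Y1 Fw HR1]; subst.
      + destruct (H4 w Sw) as [K|[[_ [_ [K1 K2]]]|[K _]]]; [left; auto|right; auto|contradiction].
      + destruct (H4 w Sw) as [K|[[_ [K _]]|[K _]]]; [left|contradiction|contradiction].
        destruct (Hv w Sw) as [_ [_ [H5 _]]]. destruct (H5 Fw) as [G' [V' _]].
        destruct (R1 _ _ _ _ HR1 G' V') as [K1 _]. eapply C_anti; eauto. apply subset_refl.
    - destruct (H3 Fv) as [G' [V' _]]. destruct (R1 _ _ _ _ HR G' V') as [K1 _].
      inversion HR' as [S1 T1 Fw|S1 T1 Y1 Fw HR1]; subst.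
      + destruct (H4 w Sw) as [K|[[K _]|[_ [K _]]]]; [left|contradiction|contradiction].
        eapply C_anti; eauto. apply subset_refl.
      + destruct (Hv w Sw) as [_ [_ [H5 _]]]. destruct (H5 Fw) as [G'' [V'' _]].
        destruct (R1 _ _ _ _ HR1 G'' V'') as [K2 _].
        destruct (H4 w Sw) as [K|[[K _]|[_ [_ [E1 E2]]]]]; [left; eapply C_anti; eauto|contradiction|].
        apply IH; auto; rewrite ?E1, ?E2; auto. }
  exists (fun v => epsilon (inhabits S0) (fun Y => reach fin ns nt v S0 T0 Y)).
  assert (RS : forall v, S0 v -> reach fin ns nt v S0 T0
    (epsilon (inhabits S0) (fun Y => reach fin ns nt v S0 T0 Y))).
  { intros v Sv. apply epsilon_spec. apply RE with v; auto. intros; lia. }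
  intros v Sv. destruct (R1 _ _ _ _ (RS v Sv) G0 Sv) as [K1 K2]. splits; auto.
  intros w Sw. apply (R2 v w S0 T0); auto.
Qed.
End Assign.

Ltac rsplits := lazymatch goal with |- _ /\ _ => idtac | |- forall _, _ => idtac | _ => red end; splits.

Section Coding.
Variables (E : nat -> nat -> Prop) (St : set -> Prop).
Hypothesis St_mono : forall S S', subset S S' -> St S -> St S'.
Variables (D : set) (lt : nat -> nat -> Prop) (lam : set) (pc : nat -> code).
Definition le (u v : nat) : Prop := D u /\ D v /\ ~ lt v u.
Definition cls (u : nat) : set := fun v => le u v /\ le v u.
Hypothesis lt_D : forall u v, lt u v -> D u /\ D v.
Hypothesis lt_irr : forall u, ~ lt u u.
Hypothesis lt_trans : forall u v w, lt u v -> lt v w -> lt u w.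
Hypothesis lt_neg : forall u v w, lt u w -> D v -> lt u v \/ lt v w.
Hypothesis lt_adj : forall u v, lt u v -> (E u v <-> lam v).
Hypothesis pc_real : forall u, D u -> Real E St (pc u) (cls u) lam.
Hypothesis pc_cls : forall u v, le u v -> le v u -> pc u = pc v.

Lemma le_refl u : D u -> le u u.
Proof. intros; rsplits; auto. Qed.
Lemma lt_le u v : lt u v -> le u v.
Proof. intros H; destruct (lt_D _ _ H). rsplits; auto. intros K. apply (lt_irr u); eauto. Qed.
Lemma lt_le_trans u v w : lt u v -> le v w -> lt u w.
Proof. intros H [H1 [H2 H3]]. destruct (lt_neg _ w _ H H2); [auto|contradiction]. Qed.
Lemma le_lt_trans u v w : le u v -> lt v w -> lt u w.
Proof. intros [H1 [H2 H3]] H. destruct (lt_neg _ u _ H H1); [contradiction|auto]. Qed.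
Lemma le_trans u v w : le u v -> le v w -> le u w.
Proof.
  intros [H1 [H2 H3]] [H4 [H5 H6]]. rsplits; auto. intros H.
  destruct (lt_neg _ v _ H H2); auto.
Qed.
Lemma lt_or_le u v : D u -> D v -> lt u v \/ le v u.
Proof. intros; destruct (classic (lt u v)); auto. right; rsplits; auto. Qed.
Lemma lt_not_le u v : lt u v -> ~ le v u.
Proof. intros H [_ [_ N]]; auto. Qed.
Lemma le_not_lt u v : le u v -> ~ lt v u.
Proof. intros [_ [_ N]]; auto. Qed.

(** A copy of the chain in which classes are replaced by whole regions. Regions, not points, are
    assigned so that the insides of the classes can be placed afterwards. *)
Definition Tgt (S S' lam' : set) : Prop := exists Y : nat -> set,
  (forall u, S u -> subset (Y u) S' /\ Real E St (pc u) (Y u) lam') /\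
  (forall u v, S u -> S v -> lt u v -> below E lam' (Y u) (Y v)) /\
  (forall u v, S u -> S v -> le u v -> le v u -> Y u = Y v).
Definition coded (S : set) : Prop := exists c, Real E St c S lam /\
  forall S' lam', Real E St c S' lam' -> Tgt S S' lam'.
Definition before (A B : set) : Prop := forall a b, A a -> B b -> lt a b.

Lemma before_below A B : before A B -> below E lam A B.
Proof.
  intros H a b Ha Hb. pose proof (H a b Ha Hb) as L. split; [|apply lt_adj; auto].
  intros ->. exact (lt_irr _ L).
Qed.

Lemma coded_ext A B : (forall v, A v <-> B v) -> coded A -> coded B.
Proof. intros H; rewrite (set_ext A B H); auto. Qed.

Lemma coded_empty A : (forall v, ~ A v) -> coded A.
Proof.
  intros H. exists Nil; split; [exact I|]. intros S' lam' _. exists (fun _ => S').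
  rsplits; [intros u Au|intros u v Au|intros u v Au]; exfalso; exact (H u Au).
Qed.

Lemma coded_cls w : D w -> coded (cls w).
Proof.
  intros Dw. exists (pc w); split; auto. intros S' lam' HR. exists (fun _ => S'). rsplits; auto.
  - intros u [H1 H2]; split; [apply subset_refl|]. rewrite (pc_cls u w); auto.
  - intros u v [H1 H2] [H3 H4] L. exfalso. apply (le_not_lt v u); auto. eauto using le_trans.
Qed.

Lemma coded_sum A B : before A B -> coded A -> coded B -> coded (fun v => A v \/ B v).
Proof.
  intros HB [c [Rc Tc]] [d [Rd Td]]. exists (Sum c d). split.
  - simpl. exists A, B; rsplits; auto; try (intros v; auto). apply before_below; auto.
  - intros S' lam' [T1 [T2 [S1 [S2 [BB [R1 R2]]]]]].
    destruct (Tc _ _ R1) as [Y1 [H1 [H2 H3]]]. destruct (Td _ _ R2) as [Y2 [G1 [G2 G3]]].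
    exists (fun v => if excluded_middle_informative (A v) then Y1 v else Y2 v). rsplits.
    + intros u Hu. destruct (excluded_middle_informative (A u)) as [Au|Au].
      * destruct (H1 u Au); split; auto. eapply subset_trans; eauto.
      * destruct Hu as [?|Bu]; [contradiction|]. destruct (G1 u Bu); split; auto. eapply subset_trans; eauto.
    + intros u v Hu Hv L.
      destruct (excluded_middle_informative (A u)) as [Au|Au];
      destruct (excluded_middle_informative (A v)) as [Av|Av]; auto.
      * destruct Hv as [?|Bv]; [contradiction|].
        eapply below_subset; [apply (H1 u Au)|apply (G1 v Bv)|auto].
      * destruct Hu as [?|Bu]; [contradiction|]. exfalso. apply (lt_irr u); eapply lt_trans; eauto.
      * destruct Hu as [?|Bu]; [contradiction|]. destruct Hv as [?|Bv]; [contradiction|]. auto.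
    + intros u v Hu Hv L1 L2.
      destruct (excluded_middle_informative (A u)) as [Au|Au];
      destruct (excluded_middle_informative (A v)) as [Av|Av]; auto.
      * destruct Hv as [?|Bv]; [contradiction|]. exfalso. apply (le_not_lt v u); auto.
      * destruct Hu as [?|Bu]; [contradiction|]. exfalso. apply (le_not_lt u v); auto.
      * destruct Hu as [?|Bu]; [contradiction|]. destruct Hv as [?|Bv]; [contradiction|]. auto.
Qed.

Definition dir (b : bool) (R : set -> set -> Prop) (A B : set) : Prop := if b then R A B else R B A.

Lemma Real_dir (b : bool) (P : nat -> code) (S l : set) :
  Real E St (Big (if b then Asc else Desc) P) S l <->
  exists T : nat -> set, (forall k, subset (T k) S) /\
      (forall j k : nat, j < k -> dir b (below E l) (T j) (T k)) /\
      (forall n K, exists k, K <= k /\ Real E St (P n) (T k) l).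
Proof. destruct b; simpl; tauto. Qed.

Lemma increasing_choice (Q : nat -> nat -> Prop) :
  (forall n K, exists k, K <= k /\ Q n k) ->
  exists h : nat -> nat, (forall i j, i < j -> h i < h j) /\ forall n, Q n (h n).
Proof.
  intros H.
  assert (H' : forall p : nat * nat, exists k, snd p <= k /\ Q (fst p) k) by (intros [n K]; apply H).
  set (g := fun p => proj1_sig (constructive_indefinite_description _ (H' p))).
  assert (G : forall n K, K <= g (n, K) /\ Q n (g (n, K)))
    by (intros n K; exact (proj2_sig (constructive_indefinite_description _ (H' (n, K))))).
  clearbody g. set (h := fix h n := match n with 0 => g (0, 0) | S n => g (S n, S (h n)) end).
  exists h. split.
  - intros i j L; induction L as [|j L IH]; simpl.
    + apply (G (S i) (S (h i))).
    + pose proof (proj1 (G (S j) (S (h j)))). lia.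
  - intros [|n]; apply G.
Qed.

(** Recurrence makes one code serve both directions: the given blocks realise it because each [c n]
    lies below cofinally many others, and in any target the blocks find their places one after
    another, ever further out. *)
Lemma coded_recurrent (b : bool) (Sn : nat -> set) (c : nat -> code) :
  (forall i j, i < j -> dir b before (Sn i) (Sn j)) ->
  (forall n, Real E St (c n) (Sn n) lam /\ forall S' lam', Real E St (c n) S' lam' -> Tgt (Sn n) S' lam') ->
  (forall n K, exists m, K <= m /\ les E St (c n) (c m)) ->
  coded (fun v => exists n, Sn n v).
Proof.
  intros HB HC HR. exists (Big (if b then Asc else Desc) c). split.
  - apply Real_dir. exists Sn; rsplits.
    + intros k v Hv; eauto.
    + intros j k L. specialize (HB j k L). destruct b; apply before_below; auto.
    + intros n K. destruct (HR n K) as [m [Lm Hm]]. exists m; split; auto. apply Hm, HC.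
  - intros S' lam' HS. apply Real_dir in HS. destruct HS as [T [ST [BT RT]]].
    destruct (increasing_choice (fun n k => Real E St (c n) (T k) lam')) as [h [hm hR]]; auto.
    assert (F : forall n, exists Y : nat -> set,
      (forall u, Sn n u -> subset (Y u) (T (h n)) /\ Real E St (pc u) (Y u) lam') /\
      (forall u v, Sn n u -> Sn n v -> lt u v -> below E lam' (Y u) (Y v)) /\
      (forall u v, Sn n u -> Sn n v -> le u v -> le v u -> Y u = Y v)) by (intros n; apply HC; auto).
    set (g := fun n => proj1_sig (constructive_indefinite_description _ (F n))).
    assert (G : forall n, (forall u, Sn n u -> subset (g n u) (T (h n)) /\ Real E St (pc u) (g n u) lam') /\
      (forall u v, Sn n u -> Sn n v -> lt u v -> below E lam' (g n u) (g n v)) /\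
      (forall u v, Sn n u -> Sn n v -> le u v -> le v u -> g n u = g n v))
      by (intros n; exact (proj2_sig (constructive_indefinite_description _ (F n)))).
    clearbody g.
    set (ix := fun v => epsilon (inhabits 0) (fun n => Sn n v)).
    assert (IX : forall v, (exists n, Sn n v) -> Sn (ix v) v) by (intros v Hv; unfold ix; apply epsilon_spec; auto).
    clearbody ix.
    assert (DJ : forall u v i j, Sn i u -> Sn j v -> i < j -> if b then lt u v else lt v u).
    { intros u v i j Hu Hv L. specialize (HB i j L). destruct b; simpl in HB; auto. }
    exists (fun v => g (ix v) v). rsplits.
    + intros u Hu. destruct (proj1 (G (ix u)) u (IX u Hu)); split; auto. eapply subset_trans; eauto.
    + intros u v Hu Hv L. pose proof (IX u Hu) as Iu. pose proof (IX v Hv) as Iv.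
      destruct (Nat.lt_trichotomy (ix u) (ix v)) as [Lt|[Eq|Gt]].
      * pose proof (DJ u v _ _ Iu Iv Lt) as K. specialize (BT _ _ (hm _ _ Lt)).
        destruct b; simpl in BT.
        { eapply below_subset; [apply (G (ix u)); auto|apply (G (ix v)); auto|auto]. }
        { exfalso; apply (lt_irr u); eauto. }
      * rewrite <- Eq in *. apply (G (ix u)); auto.
      * pose proof (DJ v u _ _ Iv Iu Gt) as K. specialize (BT _ _ (hm _ _ Gt)).
        destruct b; simpl in BT.
        { exfalso; apply (lt_irr u); eauto. }
        { eapply below_subset; [apply (G (ix u)); auto|apply (G (ix v)); auto|auto]. }
    + intros u v Hu Hv L1 L2. pose proof (IX u Hu) as Iu. pose proof (IX v Hv) as Iv.
      destruct (Nat.lt_trichotomy (ix u) (ix v)) as [Lt|[Eq|Gt]].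
      * pose proof (DJ u v _ _ Iu Iv Lt) as K. destruct b; exfalso; eapply le_not_lt; [|exact K| |exact K]; auto.
      * rewrite <- Eq in *. apply (G (ix u)); auto.
      * pose proof (DJ v u _ _ Iv Iu Gt) as K. destruct b; exfalso; eapply le_not_lt; [|exact K| |exact K]; auto.
Qed.

(** All but finitely many of the codes recur; the first [N] blocks are attached by [Sum]. *)
Lemma coded_omega (b : bool) (Sn : nat -> set) :
  (forall i j, i < j -> dir b before (Sn i) (Sn j)) -> (forall n, coded (Sn n)) ->
  coded (fun v => exists n, Sn n v).
Proof.
  intros HB HC.
  set (c := fun n => proj1_sig (constructive_indefinite_description _ (HC n))).
  assert (Hc : forall n, Real E St (c n) (Sn n) lam /\ forall S' lam', Real E St (c n) S' lam' -> Tgt (Sn n) S' lam')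
    by (intros n; exact (proj2_sig (constructive_indefinite_description _ (HC n)))).
  clearbody c.
  destruct (wqo_recurrent E St St_mono c) as [N HN].
  assert (W : forall d m, m + d = N -> coded (fun v => exists n, m <= n /\ Sn n v)).
  { induction d as [|d IH]; intros m Em.
    - apply coded_ext with (fun v => exists n, Sn (N + n) v).
      + intros v; split; intros [n Hn].
        * exists (N + n); split; auto; lia.
        * destruct Hn as [L H]. exists (n - N). replace (N + (n - N)) with n by lia; auto.
      + apply coded_recurrent with b (fun n => c (N + n)); auto.
        * intros i j L; apply HB; lia.
        * intros n K. destruct (HN (N + n) ltac:(lia) (N + K)) as [m' [L H]].
          exists (m' - N). split; [lia|]. replace (N + (m' - N)) with m' by lia; auto.
    - apply coded_ext with (fun v => if b then Sn m v \/ (exists n, S m <= n /\ Sn n v)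
        else (exists n, S m <= n /\ Sn n v) \/ Sn m v).
      + intros v. assert ((Sn m v \/ (exists n, S m <= n /\ Sn n v)) <-> exists n, m <= n /\ Sn n v) as X.
        { split.
          - intros [H|[n [L H]]]; [exists m; auto|exists n; split; auto; lia].
          - intros [n [L H]]. destruct (Nat.eq_dec m n) as [->|Ne]; auto. right; exists n; split; auto; lia. }
        rewrite <- X. destruct b; tauto.
      + specialize (IH (S m) ltac:(lia)).
        destruct b; apply coded_sum; auto.
        * intros u v Hu [n [L Hv]]. apply (HB m n); auto.
        * intros u v [n [L Hv]] Hu. apply (HB m n); auto. }
  apply coded_ext with (fun v => exists n, 0 <= n /\ Sn n v).
  - intros v; split; intros [n Hn]; exists n; [apply Hn|split; auto; lia].
  - apply (W N 0); auto.
Qed.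

Definition convex (C : set) : Prop := subset C D /\
  forall u v w, C u -> C w -> le u v -> le v w -> C v.
Definition Ioc (p r : nat) : set := fun v => lt p v /\ le v r.
Definition Ico (p r : nat) : set := fun v => le p v /\ lt v r.

(** Scanning the naturals from [w] and moving whenever the scanned vertex lies further out gives a
    cofinal sequence [p] and a coinitial sequence [q]. This reduces [C] to an omega-sum, one class
    and a reversed omega-sum. *)
Lemma coded_exhaust (C : set) (w : nat) : convex C -> C w ->
  (forall p r, C p -> C r -> coded (Ioc p r)) -> (forall p r, C p -> C r -> coded (Ico p r)) ->
  coded C.
Proof.
  intros [SC CC] Cw Hoc Hco.
  set (p := fix p n := match n with 0 => w | S n =>
    if excluded_middle_informative (C n /\ lt (p n) n) then n else p n end).
  set (q := fix q n := match n with 0 => w | S n =>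
    if excluded_middle_informative (C n /\ lt n (q n)) then n else q n end).
  assert (Cp : forall n, C (p n)).
  { induction n; simpl; auto. destruct (excluded_middle_informative _) as [[? _]|_]; auto. }
  assert (Cq : forall n, C (q n)).
  { induction n; simpl; auto. destruct (excluded_middle_informative _) as [[? _]|_]; auto. }
  assert (Mp : forall i j, i <= j -> le (p i) (p j)).
  { intros i j L; induction L as [|j L IH]; [apply le_refl; auto|].
    eapply le_trans; [exact IH|]. simpl. destruct (excluded_middle_informative _) as [[_ K]|_].
    - apply lt_le; auto.
    - apply le_refl; auto. }
  assert (Mq : forall i j, i <= j -> le (q j) (q i)).
  { intros i j L; induction L as [|j L IH]; [apply le_refl; auto|].
    eapply le_trans; [|exact IH]. simpl. destruct (excluded_middle_informative _) as [[_ K]|_].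
    - apply lt_le; auto.
    - apply le_refl; auto. }
  assert (Bp : forall v, C v -> le v (p (S v))).
  { intros v Cv. simpl. destruct (excluded_middle_informative _) as [_|K]; [apply le_refl; auto|].
    destruct (lt_or_le (p v) v); auto. exfalso; apply K; auto. }
  assert (Bq : forall v, C v -> le (q (S v)) v).
  { intros v Cv. simpl. destruct (excluded_middle_informative _) as [_|K]; [apply le_refl; auto|].
    destruct (lt_or_le v (q v)); auto. exfalso; apply K; auto. }
  assert (U : coded (fun v => exists n, Ioc (p n) (p (S n)) v)).
  { apply (coded_omega true); auto. intros i j L u v [_ Hu] [Hv _].
    eapply le_lt_trans; [exact Hu|]. eapply le_lt_trans; [apply (Mp (S i) j L)|auto]. }
  assert (L : coded (fun v => exists n, Ico (q (S n)) (q n) v)).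
  { apply (coded_omega false); auto. intros i j L u v [_ Hu] [Hv _].
    eapply lt_le_trans; [exact Hu|]. eapply le_trans; [apply (Mq (S i) j L)|auto]. }
  eapply coded_ext; [|apply coded_sum; [|exact L|apply coded_sum; [|exact (coded_cls w (SC w Cw))|exact U]]].
  - intros v; split.
    + intros [[n [H1 H2]]|[[H1 H2]|[n [H1 H2]]]].
      * apply (CC (q (S n)) v (q n)); auto. apply lt_le; auto.
      * apply (CC w v w); auto.
      * apply (CC (p n) v (p (S n))); auto. apply lt_le; auto.
    + intros Cv. destruct (lt_or_le w v) as [Lw|Lw]; auto.
      * right; right.
        destruct (least_exists (fun n => le v (p n))) as [n [H1 H2]]; [exists (S v); auto|].
        destruct n as [|n]; [exfalso; eapply le_not_lt; eauto|].
        exists n; split; auto. destruct (lt_or_le (p n) v); auto. specialize (H2 n H). lia.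
      * destruct (lt_or_le v w) as [Lv|Lv]; auto; [left|right; left; split; auto].
        destruct (least_exists (fun n => le (q n) v)) as [n [H1 H2]]; [exists (S v); auto|].
        destruct n as [|n]; [exfalso; eapply le_not_lt; eauto|].
        exists n; split; auto. destruct (lt_or_le v (q n)); auto. specialize (H2 n H). lia.
  - intros u v [n [H1 H2]] [[H3 H4]|[m [H3 H4]]].
    + eapply lt_le_trans; [exact H2|]. eapply le_trans; [apply (Mq 0 n)|auto]; lia.
    + eapply lt_trans; [|exact H3]. eapply lt_le_trans; [exact H2|].
      eapply le_trans; [apply (Mq 0 n)|apply (Mp 0 m)]; lia.
  - intros u v [H3 H4] [m [H1 H2]]. eapply le_lt_trans; [exact H4|].
    eapply le_lt_trans; [apply (Mp 0 m)|auto]; lia.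
Qed.

(** * Condensation by hereditarily coded segments *)

Definition hc (S : set) : Prop := forall C, convex C -> subset C S -> coded C.
Definition seg (u v : nat) : set := fun w => le u w /\ le w v.
(** The condensation familiar from Hausdorff's and Laver's analysis of scattered orders. A segment
    with strictly reversed end points is empty, so requiring both orientations just makes the
    relation symmetric. *)
Definition eqv (u v : nat) : Prop := D u /\ D v /\ hc (seg u v) /\ hc (seg v u).

Lemma convex_Ioc u v : convex (Ioc u v).
Proof.
  split; [intros w [_ [? _]]; auto|].
  intros a b c [H1 H2] [H3 H4] H5 H6; split; [eauto using lt_le_trans|eauto using le_trans].
Qed.
Lemma convex_Ico u v : convex (Ico u v).
Proof.
  split; [intros w [[_ [? _]] _]; auto|].
  intros a b c [H1 H2] [H3 H4] H5 H6; split; [eauto using le_trans|eauto using le_lt_trans].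
Qed.
Lemma convex_inter A B : convex A -> convex B -> convex (fun v => A v /\ B v).
Proof.
  intros [H1 H2] [H3 H4]; split; [intros v [? ?]; auto|].
  intros u v w [? ?] [? ?] ? ?; split; eauto.
Qed.
Lemma hc_mono A B : subset A B -> hc B -> hc A.
Proof. intros S H C HC SC. apply H; auto. eapply subset_trans; eauto. Qed.

Lemma eqv_refl u : D u -> eqv u u.
Proof.
  intros Du. assert (hc (seg u u)); [|rsplits; auto].
  intros C [S1 S2] SC. destruct (classic (exists w, C w)) as [[w Cw]|N].
  - apply coded_ext with (cls u); [|apply coded_cls; auto].
    intros v; split; [|intros Cv; destruct (SC v Cv); split; auto].
    destruct (SC w Cw) as [H1 H2].
    intros [H3 H4]; apply (S2 w v w); auto; eauto using le_trans.
  - apply coded_empty. intros v Cv; eauto.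
Qed.
Lemma eqv_sym u v : eqv u v -> eqv v u.
Proof. intros [H1 [H2 [H3 H4]]]; rsplits; auto. Qed.

Lemma hc_seg_trans u v w : D v -> hc (seg u v) -> hc (seg v w) -> hc (seg u w).
Proof.
  intros Dv H1 H2 C HC SC.
  apply coded_ext with (fun x => (C x /\ le x v) \/ (C x /\ lt v x)).
  - intros x; split; [tauto|]. intros Cx. destruct (lt_or_le v x); auto. apply HC; auto.
  - apply coded_sum.
    + intros a b [_ Ha] [_ Hb]. eauto using le_lt_trans.
    + apply H1.
      * destruct HC as [H3 H4]; split; [intros x [? _]; auto|].
        intros a b c [? ?] [? ?] ? ?; split; [eauto|eauto using le_trans].
      * intros x [Cx Lx]; split; auto. apply (SC x Cx).
    + apply H2.
      * destruct HC as [H3 H4]; split; [intros x [? _]; auto|].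
        intros a b c [? ?] [? ?] ? ?; split; [eauto|eauto using lt_le_trans].
      * intros x [Cx Lx]; split; [apply lt_le; auto|]. apply (SC x Cx).
Qed.
Lemma eqv_trans u v w : eqv u v -> eqv v w -> eqv u w.
Proof.
  intros [H1 [H2 [H3 H4]]] [H5 [H6 [H7 H8]]]; rsplits; auto; [apply hc_seg_trans with v|apply hc_seg_trans with v]; auto.
Qed.
Lemma eqv_between u v w : eqv u v -> le u w -> le w v -> eqv u w.
Proof.
  intros [H1 [H2 [H3 H4]]] L1 L2. assert (D w) by apply L1.
  rsplits; auto.
  - eapply hc_mono; [|exact H3]. intros x [? ?]; split; auto. eauto using le_trans.
  - eapply hc_mono with (seg w w); [|apply eqv_refl; auto].
    intros x [? ?]; split; auto. eauto using le_trans.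
Qed.
Lemma le_le_eqv u v : le u v -> le v u -> eqv u v.
Proof. intros H1 H2. apply eqv_between with u; auto. apply eqv_refl, H1. Qed.
Lemma convex_eqv u : convex (eqv u).
Proof.
  split; [intros v [_ [? _]]; auto|]. intros a b c H1 H2 L1 L2.
  apply eqv_trans with a; auto. apply eqv_between with c; auto.
  eapply eqv_trans; [apply eqv_sym|]; eauto.
Qed.
Lemma hc_eqv u : hc (eqv u).
Proof.
  intros C HC SC. destruct (classic (exists w, C w)) as [[w Cw]|N].
  - apply coded_exhaust with w; auto; intros p r Cp Cr.
    + assert (eqv p r) as [_ [_ [K _]]].
      { eapply eqv_trans; [apply eqv_sym|]; apply SC; auto. }
      apply K; [apply convex_Ioc|]. intros x [? ?]; split; auto. apply lt_le; auto.
    + assert (eqv p r) as [_ [_ [K _]]].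
      { eapply eqv_trans; [apply eqv_sym|]; apply SC; auto. }
      apply K; [apply convex_Ico|]. intros x [? ?]; split; auto. apply lt_le; auto.
  - apply coded_empty. intros v Cv; eauto.
Qed.
Lemma lt_eqv_l a b c : lt a c -> ~ eqv a c -> eqv a b -> lt b c.
Proof.
  intros L N Q. assert (D b) by apply Q. assert (D c) by apply (lt_D _ _ L).
  destruct (lt_or_le b c); auto. exfalso; apply N. eapply eqv_between; eauto. apply lt_le; auto.
Qed.
Lemma lt_eqv_r a b c : lt a c -> ~ eqv a c -> eqv c b -> lt a b.
Proof.
  intros L N Q. assert (D b) by apply Q. assert (D a) by apply (lt_D _ _ L).
  destruct (lt_or_le a b); auto. exfalso; apply N. apply eqv_sym.
  apply (proj2 (convex_eqv c)) with b c; auto; [apply eqv_refl; apply Q|apply lt_le; auto].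
Qed.

(** The blocks of both end points are removed, so that [J a b] is a union of whole blocks without a
    first or last one. *)
Definition J (a b : nat) : set := fun w => lt a w /\ lt w b /\ ~ eqv a w /\ ~ eqv w b.

Lemma J_mono a b a' b' : le a a' -> le b' b -> subset (J a' b') (J a b).
Proof.
  intros L1 L2 w [H1 [H2 [H3 H4]]]. rsplits.
  - eauto using le_lt_trans.
  - eauto using lt_le_trans.
  - intros Q. apply H3. eapply eqv_trans; [|exact Q].
    apply eqv_sym. apply eqv_between with w; auto. apply lt_le; auto.
  - intros Q. apply H4. apply eqv_between with b; auto. apply lt_le; auto.
Qed.
(** With nothing between the two end blocks, the segment would be the sum of two hereditarily coded
    pieces, and its end points would be equivalent. *)
Lemma J_dense a b : lt a b -> ~ eqv a b -> exists w, J a b w.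
Proof.
  intros L N. apply NNPP; intros F. apply N.
  destruct (lt_D _ _ L) as [Da Db].
  assert (hc (seg a b)) as HS.
  { intros C HC SC. apply coded_ext with (fun x => (C x /\ eqv a x) \/ (C x /\ eqv b x)).
    - intros x; split; [tauto|]. intros Cx. destruct (SC x Cx) as [L1 L2].
      destruct (classic (eqv a x)) as [|Na]; auto. destruct (classic (eqv b x)) as [|Nb]; auto.
      exfalso. apply F. exists x. rsplits; auto.
      + destruct (lt_or_le a x); auto; [apply L1|]. exfalso; apply Na, le_le_eqv; auto.
      + destruct (lt_or_le x b); auto; [apply L2|]. exfalso; apply Nb, le_le_eqv; auto.
      + intros Q; apply Nb, eqv_sym; auto.
    - apply coded_sum.
      + intros u v [_ Qu] [_ Qv]. eapply lt_eqv_r; [| |exact Qv].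
        * eapply lt_eqv_l; eauto.
        * intros Q. apply N. eapply eqv_trans; eauto.
      + apply (hc_eqv a); [apply convex_inter; auto; apply convex_eqv|intros x [_ ?]; auto].
      + apply (hc_eqv b); [apply convex_inter; auto; apply convex_eqv|intros x [_ ?]; auto]. }
  rsplits; auto. eapply hc_mono with (fun _ => False).
  - intros x [L1 L2]. exfalso. eapply lt_not_le; [exact L|]. eauto using le_trans.
  - intros C HC SC; apply coded_empty. intros v Cv; apply (SC v Cv).
Qed.

(* When no subinterval realises fewer codes, every code of a block occurs densely,
   so the interval is a shuffle of its blocks. *)
Lemma coded_shuffle a b :
  (forall a' b', le a a' -> le b' b -> lt a' b' -> ~ eqv a' b' ->
     forall c, Real E St c (J a b) lam -> Real E St c (J a' b') lam) ->
  lt a b -> ~ eqv a b -> coded (J a b).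
Proof.
  intros HM L N.
  assert (F : forall Q : set, exists c, coded Q -> Real E St c Q lam /\
    forall S' lam', Real E St c S' lam' -> Tgt Q S' lam').
  { intros Q. destruct (classic (coded Q)) as [[c Hc]|Nc]; [exists c; auto|exists Nil; tauto]. }
  set (d := fun Q => proj1_sig (constructive_indefinite_description _ (F Q))).
  assert (Hd : forall Q, coded Q -> Real E St (d Q) Q lam /\
    forall S' lam', Real E St (d Q) S' lam' -> Tgt Q S' lam')
    by (intros Q; exact (proj2_sig (constructive_indefinite_description _ (F Q)))).
  clearbody d; clear F.
  assert (CE : forall v, coded (eqv v)).
  { intros v. apply (hc_eqv v); [apply convex_eqv|apply subset_refl]. }
  assert (EE : forall u v, eqv u v -> eqv u = eqv v).
  { intros u v Q; apply set_ext; intros w; split; intros Q'.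
    - eapply eqv_trans; [apply eqv_sym; eauto|auto].
    - eapply eqv_trans; eauto. }
  destruct (lt_D _ _ L) as [Da Db].
  (* Components are indexed by all naturals; indices outside the interval get [Nil], which every set
     realises. *)
  set (P := fun n => if excluded_middle_informative (J a b n) then d (eqv n) else Nil).
  exists (Big Shuf P). split.
  - simpl. exists (fun Z => exists a' b', le a a' /\ le b' b /\ lt a' b' /\ ~ eqv a' b' /\ Z = J a' b').
    split. { exists a, b; rsplits; auto; apply le_refl; auto. }
    intros Z [a' [b' [L1 [L2 [L3 [N3 ->]]]]]] n.
    destruct (J_dense a' b' L3 N3) as [w1 [A1 [A2 [A3 A4]]]].
    destruct (J_dense w1 b' A2 A4) as [w2 [B1 [B2 [B3 B4]]]].
    destruct (lt_D _ _ B1) as [Dw1 Dw2].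
    assert (le a' w1) by (apply lt_le; auto). assert (le w1 w2) by (apply lt_le; auto).
    assert (le w2 b') by (apply lt_le; auto). assert (le a' a') by (apply le_refl; apply L1).
    assert (le b' b') by (apply le_refl; apply L2).
    assert (le a' w2) by (eauto using le_trans). assert (le w1 b') by (eauto using le_trans).
    exists (J a' w1), (J w1 w2), (J w2 b'). rsplits.
    + apply J_mono; auto.
    + apply J_mono; auto.
    + apply J_mono; auto.
    + apply before_below. intros u v [_ [? _]] [? _]; eauto.
    + apply before_below. intros u v [_ [? _]] [? _]; eauto.
    + apply before_below. intros u v [_ [? _]] [? _]; eauto.
    + exists a', w1; rsplits; auto. eauto using le_trans.
    + exists w2, b'; rsplits; auto. eauto using le_trans.
    + unfold P. destruct (excluded_middle_informative _) as [[V1 [V2 [V3 V4]]]|K]; [|exact I].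
      (* The block of [n] lies in [J a b], so by minimality its code is realised in the middle piece
         too. *)
      apply HM; auto; [eauto using le_trans|eauto using le_trans|].
      apply (Real_mono E St St_mono) with (eqv n); [|apply Hd; auto].
      intros w Qw. rsplits.
      * eapply lt_eqv_r; eauto.
      * eapply lt_eqv_l; eauto.
      * intros Q; apply V3. eapply eqv_trans; [exact Q|apply eqv_sym; auto].
      * intros Q; apply V4. eapply eqv_trans; eauto.
  - intros S' lam' [JJ [HS HJ]].
    (* The block of the least vertex [u] takes the middle piece; the lower vertices continue in
       [J1], the higher ones in [J2]. *)
    destruct (recursive_assignment
      (fun S T => subset S (J a b) /\ JJ T)
      (fun v w A B => ~ eqv v w /\ (lt v w -> below E lam' A B) /\ (lt w v -> below E lam' B A))
      (fun v A => Real E St (d (eqv v)) A lam') eqv) with (S0 := J a b) (T0 := S')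
      as [Z HZ].
    + intros v w A B A' B' [H1 [H2 H3]] SA SB; rsplits; auto;
        intros H; eapply below_subset; eauto.
    + intros S T u [SS JT] Su Mu.
      destruct (HJ T JT u) as [J1 [T0 [J2 [A1 [A2 [A3 [A4 [A5 [A6 [A7 [A8 A9]]]]]]]]]]].
      assert (DS : forall v, S v -> D v) by (intros v Sv; apply (lt_D a v); apply SS; auto).
      set (nt := fun v => if excluded_middle_informative (eqv u v) then T0 else
        if excluded_middle_informative (lt v u) then J1 else J2).
      set (ns := fun v => if excluded_middle_informative (lt v u) then
        (fun w => S w /\ ~ eqv u w /\ lt w u) else (fun w => S w /\ ~ eqv u w /\ lt u w)).
      assert (OR : forall v, S v -> ~ eqv u v -> ~ lt v u -> lt u v).
      { intros v Sv Nq Nl. destruct (lt_or_le u v); auto. exfalso; apply Nq, le_le_eqv; rsplits; auto. apply H. }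
      exists (eqv u), ns, nt. split; [apply eqv_refl; auto|].
      intros v Sv. rsplits.
      * unfold nt. destruct (excluded_middle_informative _); auto. destruct (excluded_middle_informative _); auto.
      * intros Q. unfold nt. destruct (excluded_middle_informative _) as [_|K]; [|contradiction].
        unfold P in A9. destruct (excluded_middle_informative _) as [_|K] in A9; [|exfalso; apply K; auto].
        rewrite <- (EE u v); auto.
      * intros Nq. unfold nt, ns. destruct (excluded_middle_informative (eqv u v)) as [K|_]; [contradiction|].
        destruct (excluded_middle_informative (lt v u)) as [Lv|Lv]; rsplits; auto.
        { intros w [? _]; auto. }
        { intros w [? _]; auto. }
        { intros [_ [K _]]; apply K, eqv_refl; auto. }
        { intros w [? _]; auto. }
        { intros w [? _]; auto. }
        { intros [_ [K _]]; apply K, eqv_refl; auto. }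
      * intros w Sw. unfold nt, ns.
        destruct (excluded_middle_informative (eqv u v)) as [Qv|Qv];
        destruct (excluded_middle_informative (eqv u w)) as [Qw|Qw].
        { right; left; rsplits; auto. eapply eqv_trans; [apply eqv_sym; eauto|auto]. }
        { left. split; [intros Q; apply Qw; eapply eqv_trans; eauto|].
          destruct (excluded_middle_informative (lt w u)) as [Lw|Lw]; split; auto; intros K; exfalso; apply (lt_irr v).
          - apply (lt_trans v w v); auto. eapply lt_eqv_r; eauto. intros Q; apply Qw, eqv_sym; auto.
          - apply (lt_trans v w v); auto. eapply lt_eqv_l; eauto. }
        { left. split; [intros Q; apply Qv; eapply eqv_trans; [eauto|apply eqv_sym; auto]|].
          destruct (excluded_middle_informative (lt v u)) as [Lv|Lv]; split; auto; intros K; exfalso; apply (lt_irr w).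
          - apply (lt_trans w v w); auto. eapply lt_eqv_r; eauto. intros Q; apply Qv, eqv_sym; auto.
          - apply (lt_trans w v w); auto. eapply lt_eqv_l; eauto. }
        { destruct (excluded_middle_informative (lt v u)) as [Lv|Lv];
          destruct (excluded_middle_informative (lt w u)) as [Lw|Lw]; auto.
          - right; right; rsplits; auto.
          -  left. split.
            + intros Q. apply Qv, eqv_sym, (eqv_between v w u Q); apply lt_le; auto.
            + split; auto. intros K. exfalso; apply (lt_irr u). eauto.
          -  left. split.
            + intros Q. apply Qw, eqv_sym, (eqv_between w v u (eqv_sym _ _ Q)); apply lt_le; auto.
            + split; auto. intros K. exfalso; apply (lt_irr u). eauto.
          - right; right; rsplits; auto. }
    + split; auto. apply subset_refl.
    (* Whole blocks now have regions; each block is placed inside its own, by a choice depending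
       only on block and region. *)
    + assert (F : forall q : set * set, exists Y : nat -> set, coded (fst q) -> Real E St (d (fst q)) (snd q) lam' ->
        (forall u, fst q u -> subset (Y u) (snd q) /\ Real E St (pc u) (Y u) lam') /\
        (forall u v, fst q u -> fst q v -> lt u v -> below E lam' (Y u) (Y v)) /\
        (forall u v, fst q u -> fst q v -> le u v -> le v u -> Y u = Y v)).
      { intros [Q T]; simpl.
        destruct (classic (coded Q /\ Real E St (d Q) T lam')) as [[H1 H2]|K].
        - destruct (Hd Q H1) as [_ H3]. destruct (H3 _ _ H2) as [Y HY]. exists Y; auto.
        - exists (fun _ => T). tauto. }
      set (g := fun q => proj1_sig (constructive_indefinite_description _ (F q))).
      assert (G : forall Q T, coded Q -> Real E St (d Q) T lam' ->
        (forall u, Q u -> subset (g (Q, T) u) T /\ Real E St (pc u) (g (Q, T) u) lam') /\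
        (forall u v, Q u -> Q v -> lt u v -> below E lam' (g (Q, T) u) (g (Q, T) v)) /\
        (forall u v, Q u -> Q v -> le u v -> le v u -> g (Q, T) u = g (Q, T) v))
        by (intros Q T; exact (proj2_sig (constructive_indefinite_description _ (F (Q, T))))).
      clearbody g; clear F.
      assert (DJ : forall v, J a b v -> D v) by (intros v [K _]; apply (lt_D _ _ K)).
      exists (fun v => g (eqv v, Z v) v). rsplits.
      * intros u Ju. destruct (HZ u Ju) as [S1 [R1 _]].
        destruct (G (eqv u) (Z u)) as [G1 _]; auto.
        destruct (G1 u); [apply eqv_refl; auto|]. split; auto. eapply subset_trans; eauto.
      * intros u v Ju Jv Luv. destruct (HZ u Ju) as [S1 [R1 C1]]. destruct (HZ v Jv) as [S2 [R2 _]].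
        destruct (G (eqv u) (Z u)) as [G1 [G2 G3]]; auto. destruct (G (eqv v) (Z v)) as [G4 _]; auto.
        destruct (C1 v Jv) as [[_ [K _]]|[Q K]].
        { eapply below_subset; [apply G1, eqv_refl; auto|apply G4, eqv_refl; auto|auto]. }
        { rewrite <- K, <- (EE u v Q). apply G2; auto. apply eqv_refl; auto. }
      * intros u v Ju Jv L1 L2. destruct (HZ u Ju) as [S1 [R1 C1]].
        assert (Q : eqv u v) by (apply le_le_eqv; auto).
        destruct (G (eqv u) (Z u)) as [G1 [G2 G3]]; auto.
        destruct (C1 v Jv) as [[K _]|[_ K]]; [contradiction|].
        rewrite <- K, <- (EE u v Q). apply G3; auto. apply eqv_refl; auto.
Qed.

(** If two blocks existed, take inequivalent [a], [b] with as few codes realised in [J a b] as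
    possible. All intervals inside are then shuffles, so the segment from [a] to [b] is hereditarily
    coded, and its end points are equivalent after all. *)
Theorem coded_all : coded D.
Proof.
  destruct (classic (exists w, D w)) as [[w Dw]|N0]; [|apply coded_empty; intros v Dv; eauto].
  destruct (classic (forall v, D v -> eqv w v)) as [A|A].
  { apply (hc_eqv w); auto. split; [apply subset_refl|]. intros u v x _ _ [_ [? _]]; auto. }
  assert (exists p : nat * nat, lt (fst p) (snd p) /\ ~ eqv (fst p) (snd p)) as [p0 Hp0].
  { apply not_all_ex_not in A. destruct A as [v A]. apply imply_to_and in A. destruct A as [Dv Nv].
    destruct (lt_or_le w v) as [L|L]; auto; [exists (w, v); auto|].
    exists (v, w); simpl. split; [|intros Q; apply Nv, eqv_sym; auto].
    destruct (lt_or_le v w) as [L'|L']; auto. exfalso; apply Nv, le_le_eqv; auto. }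
  set (A' := {p : nat * nat | lt (fst p) (snd p) /\ ~ eqv (fst p) (snd p)}).
  destruct (minimal_codes E St St_mono
    (fun p q : A' => le (fst (proj1_sig q)) (fst (proj1_sig p)) /\ le (snd (proj1_sig p)) (snd (proj1_sig q)))
    (fun p c => Real E St c (J (fst (proj1_sig p)) (snd (proj1_sig p))) lam) (exist _ p0 Hp0))
    as [[[a b] [L N]] [_ M]]; simpl in *.
  { intros [[a b] [L N]]; simpl in *. destruct (lt_D _ _ L). split; apply le_refl; auto. }
  { intros p q r [? ?] [? ?]; split; eauto using le_trans. }
  { intros p q c [H1 H2] HR. eapply Real_mono; eauto. apply J_mono; auto. }
  { intros p c d H HR. apply H; auto. }
  assert (M' : forall a' b', le a a' -> le b' b -> lt a' b' -> ~ eqv a' b' ->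
    forall c, Real E St c (J a b) lam -> Real E St c (J a' b') lam).
  { intros a' b' L1 L2 L3 N3 c HR.
    apply (M (exist _ (a', b') (conj L3 N3))); simpl; auto. }
  clear M. exfalso. apply N.
  assert (JC : forall a' b', le a a' -> le b' b -> lt a' b' -> ~ eqv a' b' -> coded (J a' b')).
  { intros a' b' L1 L2 L3 N3. apply coded_shuffle; auto.
    intros a'' b'' K1 K2 K3 K4 c HR. apply M'; auto; try (eauto using le_trans).
    eapply Real_mono; eauto. apply J_mono; auto. }
  assert (Da : D a) by apply (lt_D _ _ L). assert (Db : D b) by apply (lt_D _ _ L).
  assert (HS : hc (seg a b)).
  { intros C HC SC. destruct (classic (exists w, C w)) as [[z Cz]|Ne];
      [|apply coded_empty; intros v Cv; eauto].
    assert (SP : forall p r, C p -> C r -> forall I : set, convex I -> subset I (seg p r) -> subset (J p r) I -> coded I).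
    { intros p r Cp Cr I HI SI JI. destruct (SC p Cp) as [P1 P2]. destruct (SC r Cr) as [R1 R2].
      assert (Dp : D p) by apply P1. assert (Dr : D r) by apply R1.
      destruct (classic (eqv p r)) as [Q|Q]; [destruct Q as [_ [_ [K _]]]; apply K; auto|].
      destruct (lt_or_le p r) as [Lp|Lp]; auto.
      - eapply coded_ext; [|apply coded_sum with (A := fun x => I x /\ eqv p x)
          (B := fun x => J p r x \/ (I x /\ eqv r x))].
        + intros x; split.
          * intros [[? _]|[?|[? _]]]; auto.
          * intros Ix. destruct (SI x Ix) as [L1 L2].
            destruct (classic (eqv p x)) as [|N1]; auto. destruct (classic (eqv r x)) as [|N2]; auto.
            right; left. rsplits; auto.
            { destruct (lt_or_le p x); auto; [apply L1|]. exfalso; apply N1, le_le_eqv; auto. }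
            { destruct (lt_or_le x r); auto; [apply L1|]. exfalso; apply N2, le_le_eqv; auto. }
            { intros K; apply N2, eqv_sym; auto. }
        + intros u v [_ Qu] [[K1 [K2 [K3 K4]]]|[_ Qv]].
          * eapply lt_eqv_l; eauto.
          * eapply lt_eqv_r; [| |exact Qv]; [eapply lt_eqv_l; eauto|].
            intros K; apply Q. eapply eqv_trans; eauto.
        + apply (hc_eqv p); [apply convex_inter; auto; apply convex_eqv|intros x [_ ?]; auto].
        + apply coded_sum.
          * intros u v [K1 [K2 [K3 K4]]] [_ Qv]. eapply lt_eqv_r; eauto.
          * apply JC; auto.
          * apply (hc_eqv r); [apply convex_inter; auto; apply convex_eqv|intros x [_ ?]; auto].
      - apply coded_ext with (fun x => I x /\ eqv p x); [|apply (hc_eqv p);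
          [apply convex_inter; auto; apply convex_eqv|intros x [_ ?]; auto]].
        intros x; split; [tauto|]. intros Ix; split; auto. destruct (SI x Ix) as [L1 L2].
        apply le_le_eqv; auto. eauto using le_trans. }
    apply coded_exhaust with z; auto; intros p r Cp Cr; apply (SP p r); auto.
    - apply convex_Ioc.
    - intros x [? ?]; split; auto. apply lt_le; auto.
    - intros x [K1 [K2 _]]; split; auto. apply lt_le; auto.
    - apply convex_Ico.
    - intros x [? ?]; split; auto. apply lt_le; auto.
    - intros x [K1 [K2 _]]; split; auto. apply lt_le; auto. }
  rsplits; auto.
  intros C HC SC; apply coded_empty. intros v Cv. destruct (SC v Cv) as [K1 K2].
  eapply lt_not_le; [exact L|]. eauto using le_trans.
Qed.
End Coding.

(** * Modules and tame sets *)

(** A strict weak order whose incomparability classes may be arbitrary graphs inside. Labels are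
    constant on classes, which is what makes the classes modules. *)
Record chain (E : nat -> nat -> Prop) (D : set) (lt : nat -> nat -> Prop) (lam : set) : Prop := {
  ch_D : forall u v, lt u v -> D u /\ D v;
  ch_irr : forall u, ~ lt u u;
  ch_trans : forall u v w, lt u v -> lt v w -> lt u w;
  ch_neg : forall u v w, lt u w -> D v -> lt u v \/ lt v w;
  ch_adj : forall u v, lt u v -> (E u v <-> lam v);
  ch_lab : forall u v, le D lt u v -> le D lt v u -> (lam u <-> lam v) }.

Fixpoint starfree (c : code) : Prop :=
  match c with
  | Nil | One => True
  | Star => False
  | Leaf _ c => starfree c
  | Sum c d => starfree c /\ starfree d
  | Big _ P => forall n, starfree (P n)
  end.

(** With [Star] unrealisable, realised codes are star-free and mean the same under every reading of
    [Star]. So tame codes can be reused when [Star] acquires a meaning. *)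
Definition NoStar : set -> Prop := fun _ => False.

Lemma NoStar_mono S S' : subset S S' -> NoStar S -> NoStar S'.
Proof. auto. Qed.

Lemma Real_starfree E c : forall S lam, Real E NoStar c S lam -> starfree c.
Proof.
  induction c as [| | |l c IH|c IHc d IHd|k P IH]; simpl; auto.
  - intros S lam [T [lam' [_ [_ H]]]]; eauto.
  - intros S lam [T1 [T2 [_ [_ [_ [H1 H2]]]]]]; eauto.
  - intros S lam H n. destruct k.
    + destruct H as [T [_ [_ H]]]. destruct (H n 0) as [k [_ Hk]]; eauto.
    + destruct H as [T [_ [_ H]]]. destruct (H n 0) as [k [_ Hk]]; eauto.
    + destruct H as [JJ [H1 H2]].
      destruct (H2 S H1 n) as [J1 [T [J2 [_ [_ [_ [_ [_ [_ [_ [_ H]]]]]]]]]]]; eauto.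
Qed.

Lemma Real_change E St St' c : starfree c -> forall S lam, Real E St c S lam -> Real E St' c S lam.
Proof.
  induction c as [| | |l c IH|c IHc d IHd|k P IH]; simpl; auto; try tauto.
  - intros H S lam [T [lam' [H1 [H2 H3]]]]; exists T, lam'; splits; auto.
  - intros [Hc Hd] S lam [T1 [T2 [H1 [H2 [H3 [H4 H5]]]]]]; exists T1, T2; splits; auto.
  - intros H S lam HR. destruct k.
    + destruct HR as [T [H1 [H2 H3]]]; exists T; splits; auto. intros n K.
      destruct (H3 n K) as [k [Lk Hk]]; eauto.
    + destruct HR as [T [H1 [H2 H3]]]; exists T; splits; auto. intros n K.
      destruct (H3 n K) as [k [Lk Hk]]; eauto.
    + destruct HR as [JJ [H1 H2]]; exists JJ; split; auto. intros J HJ n.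
      destruct (H2 J HJ n) as [J1 [T [J2 [A1 [A2 [A3 [A4 [A5 [A6 [A7 [A8 A9]]]]]]]]]]].
      exists J1, T, J2; splits; auto.
Qed.

Section Graph.
Variable E : nat -> nat -> Prop.
Hypothesis E_sym : forall u v, E u v -> E v u.
Hypothesis E_irr : forall u, ~ E u u.

Definition lemb (lamA A lamB B : set) : Prop := exists f : nat -> nat, forall u, A u ->
  B (f u) /\ (lamA u <-> lamB (f u)) /\
  forall v, A v -> (f u = f v -> u = v) /\ (E u v <-> E (f u) (f v)).
Definition emb (A B : set) : Prop := exists f : nat -> nat, forall u, A u ->
  B (f u) /\ forall v, A v -> (f u = f v -> u = v) /\ (E u v <-> E (f u) (f v)).

(* The code is strong enough to force a copy of [D] wherever it is realised. *)
Definition tame_code (c : code) (D : set) : Prop :=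
  RealG E NoStar c D /\ forall Y, RealG E NoStar c Y -> emb D Y.
Definition tame (D : set) : Prop := exists c, tame_code c D.
Definition is_module (N : set) : Prop := forall u v w, N u -> N v -> ~ N w -> (E w u <-> E w v).

Lemma E_comm u v : E u v <-> E v u.
Proof. split; auto. Qed.

Lemma emb_lemb lamA A lamB B : lemb lamA A lamB B -> emb A B.
Proof. intros [f Hf]; exists f; intros u Au; destruct (Hf u Au) as [H1 [_ H2]]; auto. Qed.

Lemma singleton_tame x : tame (fun v => v = x).
Proof.
  exists One; split.
  - exists (fun _ => True); simpl; eauto.
  - intros Y [lam [y Hy]]. exists (fun _ => y). intros u ->; split; auto.
    intros v ->; split; auto. split; intros H; exfalso; eapply E_irr; eauto.
Qed.

Lemma class_module D lt lam u : chain E D lt lam -> is_module D -> is_module (cls D lt u).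
Proof.
  intros CH MD a b w [A1 A2] [B1 B2] Nw.
  destruct (classic (D w)) as [Dw|Dw]; [|apply MD; auto; [apply A1|apply B1]].
  assert (K : lt w u \/ lt u w).
  { apply NNPP; intros N. apply Nw. split; (split; [|split]; auto; try apply A1; intros L; apply N; auto). }
   pose proof (ch_neg _ _ _ _ CH) as NG.
  assert (LL : lam a <-> lam b).
  { apply (ch_lab _ _ _ _ CH); eapply (le_trans D lt); eauto. }
  destruct K as [K|K].
  - rewrite (ch_adj _ _ _ _ CH w a), (ch_adj _ _ _ _ CH w b); auto;
      eapply (lt_le_trans D lt NG); eauto.
  - rewrite (E_comm w a), (E_comm w b).
    rewrite (ch_adj _ _ _ _ CH a w), (ch_adj _ _ _ _ CH b w); [tauto| |];
      eapply (le_lt_trans D lt NG); eauto.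
Qed.

(** Every class becomes a leaf carrying its label. [tc] acts on the class as a set, so that
    equivalent vertices receive the same code. *)
Lemma chain_code St D lt lam (tc : set -> code) :
  (forall S S', subset S S' -> St S -> St S') ->
  chain E D lt lam ->
  (forall u, D u -> RealG E St (tc (cls D lt u)) (cls D lt u)) ->
  exists c, Real E St c D lam /\ forall S' lam', Real E St c S' lam' ->
    exists Y : nat -> set, (forall u, D u -> subset (Y u) S' /\ RealG E St (tc (cls D lt u)) (Y u) /\
        forall y, Y u y -> (lam' y <-> lam u)) /\
      (forall u v, D u -> D v -> lt u v -> below E lam' (Y u) (Y v)) /\
      (forall u v, D u -> D v -> le D lt u v -> le D lt v u -> Y u = Y v).
Proof.
  intros SM [CD CI CT CN CA CL] HT.
  set (bl := fun u => if excluded_middle_informative (lam u) then true else false).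
  assert (BL : forall u, lam u <-> bl u = true).
  { intros u; unfold bl; destruct (excluded_middle_informative (lam u)); split; intros; auto; try discriminate; contradiction. }
  clearbody bl.
  assert (CE : forall u v, le D lt u v -> le D lt v u -> cls D lt u = cls D lt v).
  { intros u v L1 L2; apply set_ext; intros w; split; intros [K1 K2]; split; eapply (le_trans D lt); eauto. }
  set (pc := fun u => Leaf (bl u) (tc (cls D lt u))).
  destruct (coded_all E St SM D lt lam pc CD CI CT CN CA) as [c [Rc Tc]].
  - intros u Du. destruct (HT u Du) as [l Hl]. exists (cls D lt u), l; splits; auto.
    + apply subset_refl.
    + intros v [K1 K2]. rewrite (CL v u K2 K1). auto.
  - intros u v L1 L2. unfold pc. rewrite (CE u v L1 L2). f_equal.
    pose proof (CL u v L1 L2) as K. rewrite (BL u), (BL v) in K.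
    destruct (bl u), (bl v); auto; [symmetry|]; apply K; auto.
  - exists c; split; auto. intros S' lam' HR.
    destruct (Tc S' lam' HR) as [Y [H1 [H2 H3]]].
    (* The labelled part of a region is chosen as a function of code, label and region alone, so
       equivalent vertices get the same part. *)
    assert (F : forall p : code * bool * set, exists T, (exists l, Real E St (Leaf (snd (fst p)) (fst (fst p))) (snd p) l /\ l = lam') ->
      subset T (snd p) /\ has_label (snd (fst p)) lam' T /\ RealG E St (fst (fst p)) T).
    { intros [[d b] Z]; simpl.
      destruct (classic (exists T l, subset T Z /\ has_label b lam' T /\ Real E St d T l)) as [[T [l [K1 [K2 K3]]]]|N].
      - exists T. intros _; splits; auto. exists l; auto.
      - exists Z. intros [l [K ->]]. exfalso; apply N; auto. }
    set (g := fun p => proj1_sig (constructive_indefinite_description _ (F p))).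
    assert (G : forall d b Z, Real E St (Leaf b d) Z lam' ->
      subset (g (d, b, Z)) Z /\ has_label b lam' (g (d, b, Z)) /\ RealG E St d (g (d, b, Z))).
    { intros d b Z K. apply (proj2_sig (constructive_indefinite_description _ (F (d, b, Z)))). simpl; eauto. }
    clearbody g; clear F.
    exists (fun u => g (tc (cls D lt u), bl u, Y u)). splits.
    + intros u Du. destruct (H1 u Du) as [K1 K2]. destruct (G _ _ _ K2) as [G1 [G2 G3]]. splits; auto.
      * eapply subset_trans; eauto.
      * intros y Hy. rewrite (BL u). apply G2; auto.
    + intros u v Du Dv L. destruct (H1 u Du) as [K1 K2]. destruct (H1 v Dv) as [K3 K4].
      eapply below_subset; [exact (proj1 (G _ _ _ K2))|exact (proj1 (G _ _ _ K4))|auto].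
    + intros u v Du Dv L1 L2. rewrite (CE u v L1 L2), (H3 u v Du Dv L1 L2). f_equal. f_equal. f_equal.
      pose proof (CL u v L1 L2) as K. rewrite (BL u), (BL v) in K.
      destruct (bl u), (bl v); auto; [symmetry|]; apply K; auto.
Qed.

(** Inside a class its tame code provides the embedding; between classes adjacency is the label of
    the upper vertex, which the regions reproduce. *)
Lemma chain_tame_code D lt lam : chain E D lt lam -> (forall u, D u -> tame (cls D lt u)) ->
  exists c, Real E NoStar c D lam /\ forall S' lam', Real E NoStar c S' lam' -> lemb lam D lam' S'.
Proof.
  intros CH HT.
  assert (F : forall Q, exists c, tame Q -> tame_code c Q).
  { intros Q. destruct (classic (tame Q)) as [[c Hc]|N]; [exists c; auto|exists Nil; tauto]. }
  set (tc := fun Q => proj1_sig (constructive_indefinite_description _ (F Q))).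
  assert (TC : forall Q, tame Q -> tame_code (tc Q) Q)
    by (intros Q; exact (proj2_sig (constructive_indefinite_description _ (F Q)))).
  clearbody tc; clear F.
  destruct (chain_code NoStar D lt lam tc NoStar_mono CH) as [c [Rc Hc]].
  { intros u Du; apply TC, HT; auto. }
  exists c; split; auto. intros S' lam' HR.
  destruct (Hc S' lam' HR) as [Y [H1 [H2 H3]]].
  destruct CH as [CD CI CT CN CA CL].
  assert (CE : forall u v, le D lt u v -> le D lt v u -> cls D lt u = cls D lt v).
  { intros u v L1 L2; apply set_ext; intros w; split; intros [K1 K2]; split; eapply (le_trans D lt); eauto. }
  assert (F : forall p : set * set, exists f : nat -> nat, emb (fst p) (snd p) -> forall u, fst p u ->
    snd p (f u) /\ forall v, fst p v -> (f u = f v -> u = v) /\ (E u v <-> E (f u) (f v))).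
  { intros [A B]; simpl. destruct (classic (emb A B)) as [[f Hf]|N]; [exists f; auto|exists id; tauto]. }
  set (g := fun p => proj1_sig (constructive_indefinite_description _ (F p))).
  assert (G : forall A B, emb A B -> forall u, A u -> B (g (A, B) u) /\
    forall v, A v -> (g (A, B) u = g (A, B) v -> u = v) /\ (E u v <-> E (g (A, B) u) (g (A, B) v)))
    by (intros A B; exact (proj2_sig (constructive_indefinite_description _ (F (A, B))))).
  clearbody g; clear F.
  assert (EM : forall u, D u -> emb (cls D lt u) (Y u)).
  { intros u Du. apply TC; auto. apply H1; auto. }
  assert (SELF : forall u, D u -> cls D lt u u) by (intros u Du; split; apply le_refl; auto).
  exists (fun u => g (cls D lt u, Y u) u). intros u Du.
  destruct (H1 u Du) as [K1 [K2 K3]].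
  destruct (G _ _ (EM u Du) u (SELF u Du)) as [G1 G2]. splits; auto; [symmetry; auto|].
  intros v Dv.
  destruct (H1 v Dv) as [K4 [K5 K6]].
  destruct (G _ _ (EM v Dv) v (SELF v Dv)) as [G3 G4].
  destruct (lt_or_le D lt u v Du Dv) as [L|L].
  - destruct (H2 u v Du Dv L _ _ G1 G3) as [N1 N2]. split; [intros Q; contradiction|].
    rewrite N2, (CA u v L), (K6 _ G3). tauto.
  - destruct (lt_or_le D lt v u Dv Du) as [L'|L'].
    + destruct (H2 v u Dv Du L' _ _ G3 G1) as [N1 N2]. split; [intros Q; exfalso; apply N1; auto|].
      rewrite (E_comm u v), (CA v u L'), E_comm, N2, (K3 _ G1). tauto.
    + rewrite <- (CE u v), <- (H3 u v) by auto. apply G2. split; auto.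
Qed.

Lemma chain_tame D lt lam : chain E D lt lam -> (forall u, D u -> tame (cls D lt u)) -> tame D.
Proof.
  intros CH HT. destruct (chain_tame_code D lt lam CH HT) as [c [Rc Hc]].
  exists c; split; [exists lam; auto|]. intros Y [lam' HR]. eapply emb_lemb; eauto.
Qed.

(** * The chain of a vertex in a graph without induced P4 *)

Hypothesis no_P4 : forall a b c d, E a b -> E b c -> E c d -> ~ E a c -> ~ E b d -> ~ E a d -> False.

(* For [u], [v] with different adjacency to [x], the larger one decides the adjacency of [u] and [v]. *)
Definition sep (x u v : nat) : Prop := (E x u <-> ~ E x v) /\ (E u v <-> E x v).

Lemma sep_total x u v : (E x u <-> ~ E x v) -> sep x u v \/ sep x v u.
Proof. intros H. unfold sep. rewrite (E_comm v u). tauto. Qed.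
Lemma sep_asym x u v : sep x u v -> sep x v u -> False.
Proof. unfold sep. rewrite (E_comm v u). tauto. Qed.
(** Between neighbours and non-neighbours of [x], [sep] is a bipartite tournament. A directed
    4-cycle in it, together with [x], contains an induced P4; excluding these cycles makes the order
    [clt] transitive. *)
Lemma sep_cycle x u z u' z' : sep x u z -> sep x z u' -> sep x u' z' -> sep x z' u -> False.
Proof.
  assert (C : forall u z u' z', E x u -> sep x u z -> sep x z u' -> sep x u' z' -> sep x z' u -> False).
  { clear u z u' z'. intros u z u' z' Xu [A1 A2] [B1 B2] [C1 C2] [D1 D2].
    assert (~ E x z /\ E x u' /\ ~ E x z' /\ ~ E u z /\ E z u' /\ ~ E u' z' /\ E z' u) as
      [Xz [Xu' [Xz' [uz [zu' [u'z' z'u]]]]]] by tauto.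
    assert (~ E z x) by (intros K; auto). assert (~ E z' x) by (intros K; auto).
    assert (~ E z' u') by (intros K; auto). assert (~ E z u) by (intros K; auto).
    destruct (classic (E u u')) as [uu'|uu'].
    - destruct (classic (E z z')) as [zz'|zz'].
      + apply (no_P4 x u z' z); auto.
      + apply (no_P4 z' u u' z); auto.
    - apply (no_P4 z' u x u'); auto. }
  intros H1 H2 H3 H4. destruct (classic (E x u)) as [Xu|Xu]; [eapply C; eauto|].
  apply (C z u' z' u); auto. destruct H1; tauto.
Qed.
Lemma sep_adj x u z v : sep x u z -> sep x z v -> (E u v <-> E x v).
Proof.
  intros [A1 A2] [B1 B2]. destruct (classic (E x v)) as [Xv|Xv].
  - split; auto. intros _. apply NNPP; intros uv.
    assert (E x u /\ ~ E x z /\ E z v /\ ~ E u z) as [Xu [Xz [zv uz]]] by tauto.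
    apply (no_P4 u x v z); auto.
  - split; [intros uv; exfalso|tauto].
    assert (~ E x u /\ E x z /\ ~ E z v /\ E u z) as [Xu [Xz [zv uz]]] by tauto.
    apply (no_P4 v u z x); auto.
Qed.

(** The base [x] is put at the bottom. Vertices with equal adjacency to [x] are comparable only
    through an opposite vertex between them; those that nothing separates share a class. *)
Definition clt (D : set) (x u v : nat) : Prop := D u /\ D v /\
  ((u = x /\ v <> x) \/ (u <> x /\ v <> x /\
    (sep x u v \/ ((E x u <-> E x v) /\ exists z, D z /\ z <> x /\ sep x u z /\ sep x z v)))).

Lemma clt_chain D x : D x -> chain E D (clt D x) (E x).
Proof.
  intros Dx.
  assert (LB : forall u v, sep x u v -> (E x u <-> ~ E x v)) by (intros u v [? _]; auto).
  constructor.
  - intros u v [? [? _]]; auto.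
  - intros u [_ [_ [[? ?]|[_ [_ [H|[_ [z [_ [_ [H1 H2]]]]]]]]]]]; auto.
    + apply (sep_asym _ _ _ H H).
    + apply (sep_asym _ _ _ H1 H2).
  - intros u v w [Du [Dv Huv]] [_ [Dw Hvw]]. split; auto; split; auto.
    destruct Hvw as [[-> Hw]|[Nv [Nw Hvw]]].
    { destruct Huv as [[_ K]|[_ [K _]]]; contradiction. }
    destruct Huv as [[-> _]|[Nu [_ Huv]]]; [left; auto|right; split; auto; split; auto].
    destruct Huv as [Huv|[Luv [z [Dz [Nz [H1 H2]]]]]]; destruct Hvw as [Hvw|[Lvw [z' [Dz' [Nz' [H3 H4]]]]]].
    + right. pose proof (LB _ _ Huv). pose proof (LB _ _ Hvw). split; [tauto|exists v; auto].
    + left. destruct (sep_total x u w) as [K|K]; auto; [pose proof (LB _ _ Huv); tauto|].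
      exfalso; apply (sep_cycle x u v z' w); auto.
    + left. destruct (sep_total x u w) as [K|K]; auto; [pose proof (LB _ _ Hvw); tauto|].
      exfalso; apply (sep_cycle x u z v w); auto.
    + right. split; [tauto|]. exists z; splits; auto.
      destruct (sep_total x z w) as [K|K]; auto; [pose proof (LB _ _ H2); tauto|].
      exfalso; apply (sep_cycle x z v z' w); auto.
  - intros u v w [Du [Dw H]] Dv.
    destruct (Nat.eq_dec v x) as [->|Nv].
    { right. split; auto; split; auto. left; split; auto. destruct H as [[_ ?]|[_ [? _]]]; auto. }
    destruct H as [[-> Nw]|[Nu [Nw H]]]; [left; split; auto|].
    destruct H as [H|[L [z [Dz [Nz [H1 H2]]]]]].
    + pose proof (LB _ _ H) as K. destruct (classic (E x v <-> E x u)) as [Q|Q].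
      * destruct (sep_total x v w) as [S|S]; [tauto| |].
        { right. split; auto; split; auto; right; auto. }
        { left. split; auto; split; auto; right; split; auto; split; auto. right; split; [tauto|exists w; auto]. }
      * destruct (sep_total x u v) as [S|S]; [tauto| |].
        { left. split; auto; split; auto; right; auto. }
        { right. split; auto; split; auto; right; split; auto; split; auto. right; split; [tauto|exists u; auto]. }
    + pose proof (LB _ _ H1) as K1.
      destruct (classic (E x v <-> E x u)) as [Q|Q].
      * destruct (sep_total x v z) as [S|S]; [tauto| |].
        { right. split; auto; split; auto; right; split; auto; split; auto. right; split; [tauto|exists z; auto]. }
        { left. split; auto; split; auto; right; split; auto; split; auto. right; split; [tauto|exists z; auto]. }
      * destruct (sep_total x u v) as [S|S]; [tauto| |].
        { left. split; auto; split; auto; right; auto. }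
        destruct (sep_total x v w) as [S'|S']; [tauto| |].
        { right. split; auto; split; auto; right; auto. }
        exfalso; apply (sep_cycle x u z w v); auto.
  - intros u v [_ [_ [[-> _]|[_ [_ [H|[_ [z [_ [_ [H1 H2]]]]]]]]]]]; [tauto| |].
    + apply H.
    + eapply sep_adj; eauto.
  - intros u v [Du [Dv N1]] [_ [_ N2]].
    destruct (Nat.eq_dec u x) as [->|Nu]; destruct (Nat.eq_dec v x) as [->|Nv]; try tauto.
    + exfalso; apply N2. split; auto.
    + exfalso; apply N1. split; auto.
    + apply NNPP; intros Q. destruct (sep_total x u v) as [S|S]; [tauto| |].
      * apply N2. split; auto; split; auto; right; auto.
      * apply N1. split; auto; split; auto; right; auto.
Qed.

Lemma cls_base D x v : D x -> cls D (clt D x) x v -> v = x.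
Proof.
  intros Dx [[_ [Dv _]] [_ [_ N2]]]. destruct (Nat.eq_dec v x); auto. exfalso; apply N2. split; auto.
Qed.

(** A chain of tame classes is tame and the class of [x] is a singleton, so the failure lies in
    another class. *)
Lemma nontame_class D x : D x -> ~ tame D ->
  exists u, D u /\ u <> x /\ ~ tame (cls D (clt D x) u).
Proof.
  intros Dx NT. apply NNPP; intros N. apply NT. apply (chain_tame D (clt D x) (E x)); [apply clt_chain; auto|].
  intros u Du. destruct (Nat.eq_dec u x) as [->|Ne].
  - replace (cls D (clt D x) x) with (fun v => v = x); [apply singleton_tame|].
    apply set_ext; intros v; split; [intros ->|apply cls_base; auto].
    split; apply le_refl; auto; apply (ch_irr _ _ _ _ (clt_chain D x Dx)).
  - apply NNPP; intros K; apply N; eauto.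
Qed.
End Graph.

(** * A module that is not tame *)

Definition vert : Type := (nat + nat * nat)%type.

(** Two total functions, mutually inverse on the carriers, stand for an isomorphism and avoid
    subtypes. *)
Definition iso_on (P Q : vert -> Prop) (G H : vert -> vert -> Prop) (phi psi : vert -> vert) : Prop :=
  (forall p, P p -> Q (phi p) /\ psi (phi p) = p) /\
  (forall q, Q q -> P (psi q) /\ phi (psi q) = q) /\
  (forall p q, P p -> P q -> (G p q <-> H (phi p) (phi q))).

Lemma iso_on_sym P Q G H phi psi : iso_on P Q G H phi psi -> iso_on Q P H G psi phi.
Proof.
  intros [I1 [I2 I3]]. rsplits; auto. intros p q Pp Pq.
  destruct (I2 p Pp) as [K1 K2]. destruct (I2 q Pq) as [K3 K4]. rewrite I3, K2, K4 by auto. tauto.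
Qed.

(* [inl u] is the vertex [u] of [E] and [inr p] an added one; by the last clause [s] can be read off
   the graph [G s] once the two vertices [a s] and [b s] are marked. *)
Definition readable_family (E : nat -> nat -> Prop) : Prop :=
  exists (P : (nat -> bool) -> vert -> Prop) (G : (nat -> bool) -> vert -> vert -> Prop)
    (a b : (nat -> bool) -> vert),
  (forall s u, P s (inl u)) /\
  (forall s u v, G s (inl u) (inl v) <-> E u v) /\
  (forall s p q, G s p q -> G s q p) /\
  (forall s p, ~ G s p p) /\
  (forall s, exists g : vert -> nat, forall p q, P s p -> P s q ->
     (g p = g q -> p = q) /\ (G s p q <-> E (g p) (g q))) /\
  (forall s p, P s (inr p) -> (exists u, G s (inr p) (inl u)) /\ (exists u, ~ G s (inr p) (inl u))) /\
  (forall s, P s (a s) /\ P s (b s)) /\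
  (forall s t phi psi, iso_on (P s) (P t) (G s) (G t) phi psi ->
     phi (a s) = a t -> phi (b s) = b t -> s = t).

Section Kernel.
Variable E : nat -> nat -> Prop.
Hypothesis E_sym : forall u v, E u v -> E v u.
Hypothesis E_irr : forall u, ~ E u u.
Hypothesis no_P4 : forall a b c d, E a b -> E b c -> E c d -> ~ E a c -> ~ E b d -> ~ E a d -> False.

Definition big (N : set) : Prop := is_module E N /\ ~ tame E N.
Definition HasBig (S : set) : Prop := exists N, subset N S /\ big N.
(* [Star] is read as "contains a big module". *)
Definition minimal (M : set) : Prop := big M /\
  forall N, subset N M -> big N -> forall c, RealG E HasBig c M -> RealG E HasBig c N.

Lemma HasBig_mono S S' : subset S S' -> HasBig S -> HasBig S'.
Proof. intros H [N [H1 H2]]; exists N; split; auto. eapply subset_trans; eauto. Qed.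
Lemma RealG_mono c S S' : subset S S' -> RealG E HasBig c S -> RealG E HasBig c S'.
Proof. intros H [lam HR]; exists lam; eapply Real_mono; eauto. apply HasBig_mono. Qed.

Lemma big_nonempty N : big N -> exists v, N v.
Proof.
  intros [_ NT]. apply NNPP; intros H. apply NT. exists Nil; split.
  - exists N; exact I.
  - intros Y _. exists id. intros u Nu; exfalso; eauto.
Qed.

Lemma minimal_exists M0 : big M0 -> exists M, minimal M.
Proof.
  intros B0.
  destruct (minimal_codes E HasBig HasBig_mono
    (fun M N : {M | big M} => subset (proj1_sig M) (proj1_sig N))
    (fun M c => RealG E HasBig c (proj1_sig M)) (exist _ M0 B0)) as [[M BM] [_ H]].
  - intros; apply subset_refl.
  - intros a b c; apply subset_trans.
  - intros a b c H; apply RealG_mono; auto.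
  - intros a c d H; apply les_leg; auto.
  - exists M; split; auto. intros N SN BN c. apply (H (exist _ N BN)); auto.
Qed.

Lemma minimal_sub M N : minimal M -> subset N M -> big N -> minimal N.
Proof.
  intros [BM H] SN BN; split; auto. intros N' SN' BN' c HR.
  apply H; auto; [eapply subset_trans; eauto|]. eapply RealG_mono; eauto.
Qed.

(** Each round codes the current module from its least vertex, writing [Star] for classes that are
    not tame. By minimality [N'] realises the same code. Tame classes then embed into their regions,
    and every other class faces a region that again contains a big module, so the recursion goes
    on. *)
Lemma minimal_embeds M N : minimal M -> subset N M -> big N -> emb E M N.
Proof.
  intros [BM HM] SN BN.
  assert (F : forall Q, exists c, (tame E Q -> tame_code E c Q) /\ (~ tame E Q -> c = Star)).
  { intros Q. destruct (classic (tame E Q)) as [[c Hc]|NQ];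
      [exists c; split; auto; intros K; exfalso; apply K; exists c; auto|exists Star; split; tauto]. }
  set (tc := fun Q => proj1_sig (constructive_indefinite_description _ (F Q))).
  assert (TC : forall Q, (tame E Q -> tame_code E (tc Q) Q) /\ (~ tame E Q -> tc Q = Star))
    by (intros Q; exact (proj2_sig (constructive_indefinite_description _ (F Q)))).
  clearbody tc; clear F.
  assert (TS : forall Q, tame E Q -> starfree (tc Q)).
  { intros Q HQ. destruct (TC Q) as [T1 _]. destruct (T1 HQ) as [[lam HR] _]. eapply Real_starfree; eauto. }
  assert (TE : forall Q Y, tame E Q -> RealG E HasBig (tc Q) Y -> emb E Q Y).
  { intros Q Y HQ [lam HR]. apply (TC Q); auto. exists lam. eapply Real_change; eauto. }
  (* A task is either an embeddable pair, finished at once, or a submodule of [M] against a set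
     containing a big [N']. Keeping [N'] inside [M] lets the minimality of [M] apply in every
     round. *)
  destruct (recursive_assignment
    (fun D Y => emb E D Y \/ (is_module E D /\ subset D M /\ exists N', subset N' Y /\ subset N' M /\ big N'))
    (fun v w A B => forall a b, A a -> B b -> a <> b /\ (E v w <-> E a b))
    (fun v A => exists a, A a) eq) with (S0 := M) (T0 := N) as [Y HY].
  - intros v w A B A' B' H SA SB a b Ha Hb; auto.
  - intros S T u [[f Hf]|[MS [SM [N' [S1 [S2 BN']]]]]] Su Mu.
    + exists (fun _ => True), (fun _ => S), (fun v y => y = f v). split; auto.
      intros v Sv. destruct (Hf v Sv) as [H1 H2]. splits.
      * intros y ->; auto.
      * intros _; eauto.
      * tauto.
      * intros w Sw. destruct (Nat.eq_dec v w) as [->|Ne]; [right; left; auto|left].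
        intros a b -> ->. destruct (H2 w Sw). split; auto.
    + pose proof (clt_chain E E_sym no_P4 S u Su) as CH.
      destruct (chain_code E HasBig S (clt E S u) (E u) tc HasBig_mono CH) as [c [Rc Hc]].
      { intros v Sv. destruct (classic (tame E (cls S (clt E S u) v))) as [HT|HT].
        - destruct (TC (cls S (clt E S u) v)) as [T1 _]. destruct (T1 HT) as [[lam HR] _].
          exists lam. eapply Real_change; eauto.
        - rewrite (proj2 (TC _) HT). exists (E u). exists (cls S (clt E S u) v).
          split; [apply subset_refl|]. split; auto. eapply class_module; eauto. }
      assert (RealG E HasBig c N') as [lam' HR].
      { apply HM; auto. apply RealG_mono with S; auto. exists (E u); auto. }
      destruct (Hc N' lam' HR) as [Y [H1 [H2 H3]]].
      pose proof CH as [CD CI CT CN CA CL].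
      set (lt := clt E S u) in *.
      assert (SELF : forall v, S v -> cls S lt v v) by (intros v Sv; split; apply le_refl; auto).
      assert (CE : forall v w, le S lt v w -> le S lt w v -> cls S lt v = cls S lt w).
      { intros v w L1 L2; apply set_ext; intros z; split; intros [K1 K2]; split; eapply (le_trans S lt); eauto. }
      exists (fun v => v = u), (fun v => cls S lt v), Y. split; auto.
      intros v Sv. destruct (H1 v Sv) as [K1 [K2 K3]]. splits.
      * eapply subset_trans; eauto.
      * intros ->. destruct (TE (cls S lt u) (Y u)) as [f Hf]; auto.
        { replace (cls S lt u) with (fun v => v = u); [apply singleton_tame; auto|].
          apply set_ext; intros z; split; [intros ->; auto|apply cls_base; auto]. }
        exists (f u). apply Hf; auto.
      * intros Nv. splits; auto.
        { destruct (classic (tame E (cls S lt v))) as [HT|HT]; [left; auto|right].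
          splits.
          - eapply class_module; eauto.
          - intros z [_ [? _]]; auto.
          - rewrite (proj2 (TC _) HT) in K2. destruct K2 as [lam2 [N2 [L1 L2]]].
            exists N2; splits; auto. eapply subset_trans; [exact L1|]. eapply subset_trans; eauto. }
        { intros z [_ [? _]]; auto. }
        { intros [[_ [_ K]] _]. apply K. split; auto. }
      * intros w Sw. destruct (H1 w Sw) as [K4 [K5 K6]].
        destruct (lt_or_le S lt v w Sv Sw) as [L|L].
        { left. intros a b Ha Hb. destruct (H2 v w Sv Sw L a b Ha Hb) as [Q1 Q2]. split; auto.
          rewrite Q2, (K6 b Hb). apply CA; auto. }
        destruct (lt_or_le S lt w v Sw Sv) as [L'|L'].
        { left. intros a b Ha Hb. destruct (H2 w v Sw Sv L' b a Hb Ha) as [Q1 Q2]. split; auto.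
          rewrite (E_comm E E_sym a b), (E_comm E E_sym v w), Q2, (K3 a Ha). apply CA; auto. }
        destruct (classic (v = u)) as [->|Nv].
        { right; left. rewrite (cls_base E S u w); auto. split; auto. }
        destruct (classic (w = u)) as [->|Nw].
        { exfalso; apply Nv. apply (cls_base E S u v); auto. split; auto. }
        right; right. rsplits; auto.
  - right. splits; auto; [apply BM|apply subset_refl|]. exists N; splits; auto. apply subset_refl.
  - set (f := fun v => epsilon (inhabits 0) (fun a => Y v a)).
    assert (Hf : forall v, M v -> Y v (f v)) by (intros v Mv; unfold f; apply epsilon_spec; apply HY; auto).
    exists f. intros u Mu. destruct (HY u Mu) as [S1 [_ H1]]. split; auto.
    intros v Mv. destruct (H1 v Mv) as [K|[K _]].
    + destruct (K _ _ (Hf u Mu) (Hf v Mv)) as [K1 K2]. split; auto. intros; contradiction.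
    + subst v. split; auto. split; intros; exfalso; eapply E_irr; eauto.
Qed.

(** The components of relation [l] on [M] form a chain with the opposite constant label, so one of
    them is not tame. Inside it a path leads from a vertex outside a big module [K] into [K]; the
    last vertex before entry is related by [l] to one vertex of [K], hence to all. *)
Lemma big_joined (l : bool) M : big M -> exists N y, subset N M /\ big N /\ M y /\ ~ N y /\
  forall v, N v -> (E y v <-> l = true).
Proof.
  intros [MM NT].
  set (R := fun a b => M a /\ M b /\ a <> b /\ (E a b <-> l = true)).
  set (conn := clos_refl_trans nat R).
  assert (RS : forall a b, R a b -> R b a).
  { intros a b [H1 [H2 [H3 H4]]]; rsplits; auto. rewrite (E_comm E E_sym b a); auto. }
  assert (CS : forall a b, conn a b -> conn b a).
  { intros a b H; induction H; [apply rt_step; auto|apply rt_refl|eapply rt_trans; eauto]. }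
  set (lst := fun u => epsilon (inhabits 0) (fun m => conn u m /\ forall i, conn u i -> m <= i)).
  assert (LS : forall u, conn u (lst u) /\ forall i, conn u i -> lst u <= i).
  { intros u. unfold lst. apply epsilon_spec, least_exists. exists u; apply rt_refl. }
  assert (LC : forall u v, lst u = lst v -> conn u v).
  { intros u v H. apply rt_trans with (lst u); [apply LS|]. rewrite H. apply CS, LS. }
  clearbody lst.
  set (lt := fun u v => M u /\ M v /\ lst u < lst v).
  assert (CH : chain E M lt (fun _ => l = false)).
  { constructor; unfold lt, le.
    - tauto.
    - intros u [_ [_ H]]; lia.
    - intros u v w [? [? ?]] [? [? ?]]; rsplits; auto; lia.
    - intros u v w [? [? ?]] ?. destruct (le_lt_dec (lst v) (lst u)); [right|left]; rsplits; auto; lia.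
    - intros u v [Mu [Mv H]].
      assert (~ R u v) as NR.
      { intros K. destruct (LS u) as [L1 L2]. destruct (LS v) as [L3 L4].
        assert (lst v <= lst u); [|lia]. apply L4. apply rt_trans with u; auto. apply rt_step; auto. }
      assert (u <> v) by (intros ->; lia).
      assert (HN : ~ (E u v <-> l = true)) by (intros K; apply NR; rsplits; auto).
      destruct l; split; auto.
      + intros K; exfalso; apply HN; split; auto.
      + discriminate.
      + intros _. apply NNPP; intros K. apply HN; split; [tauto|discriminate].
    - tauto. }
  assert (exists u, M u /\ ~ tame E (cls M lt u)) as [u [Mu Nu]].
  { apply NNPP; intros N. apply NT. apply (chain_tame E E_sym) with lt (fun _ => l = false); auto.
    intros u Mu. apply NNPP; intros K; eauto. }
  set (C := cls M lt u) in *.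
  assert (MC : is_module E C) by (eapply class_module; eauto).
  assert (CM : subset C M) by (intros v [[_ [? _]] _]; auto).
  destruct (big_nonempty C (conj MC Nu)) as [x Cx].
  pose proof (clt_chain E E_sym no_P4 C x Cx) as CHx.
  destruct (nontame_class E E_sym E_irr no_P4 C x Cx Nu) as [k [Ck [Nk NTK]]].
  set (K := cls C (clt E C x) k) in *.
  assert (MK : is_module E K) by (eapply class_module; eauto).
  assert (Kx : ~ K x).
  { intros [K1 K2]. apply Nk. apply (cls_base E C x k Cx). split; auto. }
  assert (Kk : K k) by (split; apply le_refl; auto; apply (ch_irr _ _ _ _ CHx)).
  assert (XK : conn x k).
  { apply LC. assert (M x) by (apply CM; auto). destruct Cx as [[_ [_ H1]] [_ [_ H2]]]. destruct Ck as [[_ [Mk H3]] [_ [_ H4]]].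
    unfold lt in *.
    assert (~ lst x < lst u) by (intros ?; apply H1; rsplits; auto).
    assert (~ lst u < lst x) by (intros ?; apply H2; rsplits; auto).
    assert (~ lst k < lst u) by (intros ?; apply H3; rsplits; auto).
    assert (~ lst u < lst k) by (intros ?; apply H4; rsplits; auto). lia. }
  assert (exists y z, R y z /\ ~ K y /\ K z) as [y [z [[My [Mz [Ne Hyz]]] [Ny Kz]]]].
  { apply clos_rt_rt1n in XK. revert Kx Kk. clear - XK. clearbody K. induction XK as [|a b c H1 H2 IH]; intros Kx Kk; [tauto|].
    destruct (classic (K b)) as [Kb|Kb]; [exists a, b; auto|exact (IH Kb Kk)]. }
  exists K, y; rsplits; auto.
  - intros v [[_ [? _]] _]; auto.
  - split; auto.
  - intros v Kv. rewrite (MK v z y); auto.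
Qed.

(* Otherwise the classes met along a descending sequence of big modules with empty
   intersection would exhibit [M] as a chain of tame classes. *)
Lemma big_disjoint M : big M -> exists N1 N2, subset N1 M /\ subset N2 M /\ big N1 /\ big N2 /\
  forall v, N1 v -> N2 v -> False.
Proof.
  intros BM. apply NNPP; intros NO.
  assert (ST : forall N : {N | big N}, exists N' : {N | big N}, subset (proj1_sig N') (proj1_sig N) /\
    exists x, proj1_sig N x /\ (forall i, proj1_sig N i -> x <= i) /\ ~ proj1_sig N' x).
  { intros [N [MN NT]]; simpl.
    destruct (least_exists N (big_nonempty N (conj MN NT))) as [x [Nx Mx]].
    destruct (nontame_class E E_sym E_irr no_P4 N x Nx NT) as [k [Nk [Ne NTK]]].
    pose proof (clt_chain E E_sym no_P4 N x Nx) as CH.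
    assert (B : big (cls N (clt E N x) k)) by (split; auto; eapply class_module; eauto).
    exists (exist _ _ B); simpl. split; [intros v [[_ [? _]] _]; auto|].
    exists x; splits; auto. intros [K1 K2]. apply Ne. apply (cls_base E N x k Nx). split; auto. }
  set (nx := fun N => proj1_sig (constructive_indefinite_description _ (ST N))).
  assert (NX : forall N, subset (proj1_sig (nx N)) (proj1_sig N) /\
    exists x, proj1_sig N x /\ (forall i, proj1_sig N i -> x <= i) /\ ~ proj1_sig (nx N) x)
    by (intros N; exact (proj2_sig (constructive_indefinite_description _ (ST N)))).
  clearbody nx; clear ST.
  set (sq := fix sq n := match n with 0 => exist _ M BM : {N | big N} | S n => nx (sq n) end).
  set (Mn := fun n => proj1_sig (sq n)).
  assert (MB : forall n, big (Mn n)) by (intros n; exact (proj2_sig (sq n))).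
  assert (MS : forall n, subset (Mn (S n)) (Mn n)) by (intros n; apply (NX (sq n))).
  assert (MX : forall n, exists x, Mn n x /\ (forall i, Mn n i -> x <= i) /\ ~ Mn (S n) x)
    by (intros n; apply (NX (sq n))).
  assert (M0 : Mn 0 = M) by reflexivity.
  clearbody Mn; clear sq NX nx.
  assert (MD : forall n m, n <= m -> subset (Mn m) (Mn n)).
  { intros n m L; induction L; [apply subset_refl|]. eapply subset_trans; eauto. }
  assert (ML : forall n v, Mn n v -> n <= v).
  { induction n as [|n IH]; intros v Hv; [lia|].
    destruct (MX n) as [x [X1 [X2 X3]]]. specialize (IH x X1).
    pose proof (X2 v (MS n v Hv)). assert (v <> x) by (intros ->; auto). lia. }
  assert (LV : forall v, exists n, M v -> Mn n v /\ ~ Mn (S n) v).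
  { intros v. destruct (classic (M v)) as [Mv|Nv]; [|exists 0; tauto].
    destruct (least_exists (fun n => ~ Mn n v)) as [n [N1 N2]].
    { exists (S v). intros H. specialize (ML _ _ H). lia. }
    destruct n as [|n]; [rewrite M0 in N1; contradiction|].
    exists n. intros _; split; auto. apply NNPP; intros K. specialize (N2 n K). lia. }
  set (lev := fun v => proj1_sig (constructive_indefinite_description _ (LV v))).
  assert (HL : forall v, M v -> Mn (lev v) v /\ ~ Mn (S (lev v)) v)
    by (intros v; exact (proj2_sig (constructive_indefinite_description _ (LV v)))).
  clearbody lev; clear LV.
  assert (YE : forall n, exists y, Mn (S n) y) by (intros n; apply big_nonempty; auto).
  set (y := fun n => proj1_sig (constructive_indefinite_description _ (YE n))).
  assert (HY : forall n, Mn (S n) (y n)) by (intros n; exact (proj2_sig (constructive_indefinite_description _ (YE n)))).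
  clearbody y; clear YE.
  assert (CH : forall n, chain E (Mn n) (clt E (Mn n) (y n)) (E (y n))).
  { intros n. apply clt_chain; auto. apply MS, HY. }
  (* Deeper levels come first: they lie in the module [Mn (S (lev v))], which [v] sees uniformly,
     just as it sees [y (lev v)]. Within a level the chain of [y] is used, whose base lies
     deeper. *)
  set (lt := fun w v => M w /\ M v /\ (lev v < lev w \/ (lev v = lev w /\ clt E (Mn (lev v)) (y (lev v)) w v))).
  assert (CL : chain E M lt (fun v => E (y (lev v)) v)).
  { constructor; unfold lt.
    - tauto.
    - intros u [Mu [_ [K|[_ K]]]]; [lia|]. exact (ch_irr _ _ _ _ (CH _) _ K).
    - intros u v w [Mu [Mv H1]] [_ [Mw H2]]; splits; auto.
      destruct H1 as [H1|[E1 H1]]; destruct H2 as [H2|[E2 H2]]; try (left; lia).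
      right; split; [lia|]. rewrite <- E2 in H1. exact (ch_trans _ _ _ _ (CH _) _ _ _ H1 H2).
    - intros u v w [Mu [Mw H]] Mv.
      destruct H as [H|[E1 H]].
      + destruct (le_lt_dec (lev u) (lev v)); [right|left]; splits; auto; left; lia.
      + destruct (Nat.lt_trichotomy (lev v) (lev u)) as [L|[L|L]].
        * left; splits; auto.
        * destruct (ch_neg _ _ _ _ (CH (lev w)) u v w H) as [K|K].
          { rewrite E1, <- L. apply HL; auto. }
          { left; splits; auto. right; split; auto. rewrite L, <- E1; auto. }
          { right; splits; auto. right; split; auto. lia. }
        * right; splits; auto. left; lia.
    - intros w v [Mw [Mv H]]. destruct H as [H|[E1 H]]; [|exact (ch_adj _ _ _ _ (CH _) _ _ H)].
      destruct (MB (S (lev v))) as [MO _].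
      rewrite (E_comm E E_sym w v), (E_comm E E_sym (y (lev v)) v).
      apply MO; auto; [|apply HL; auto]. apply (MD _ (lev w)); [lia|]. apply HL; auto.
    - intros u v [Mu [Mv N1]] [_ [_ N2]].
      assert (lev u = lev v) as EL.
      { destruct (Nat.lt_trichotomy (lev u) (lev v)) as [L|[L|L]]; auto; exfalso; [apply N1|apply N2]; splits; auto. }
      rewrite EL. apply (ch_lab _ _ _ _ (CH (lev v))).
      + rsplits; [rewrite <- EL; apply HL; auto|apply HL; auto|]. intros K; apply N1; splits; auto.
        right; split; auto. rewrite EL; auto.
      + rsplits; [apply HL; auto|rewrite <- EL; apply HL; auto|]. intros K; apply N2; splits; auto. }
  destruct BM as [MM NT]. apply NT. apply (chain_tame E E_sym M lt (fun v => E (y (lev v)) v) CL).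
  (* A class stays within one level and so avoids the next module of the sequence. *)
  intros u Mu. apply NNPP; intros NTu. apply NO.
  exists (cls M lt u), (Mn (S (lev u))). splits; auto.
  - intros v [[_ [? _]] _]; auto.
  - rewrite <- M0. apply MD; lia.
  - split; auto. eapply class_module; eauto.
  - intros v [[_ [Mv N1]] [_ [_ N2]]] Hv.
    assert (lev u = lev v) as EL.
    { destruct (Nat.lt_trichotomy (lev u) (lev v)) as [L|[L|L]]; auto; exfalso; [apply N1|apply N2];
        unfold lt; splits; auto. }
    rewrite EL in Hv. apply (HL v Mv); auto.
Qed.

(** * The gadget attached to a self-similar module *)

Definition rel (b : bool) (u v : nat) : Prop := u <> v /\ (E u v <-> b = true).

Lemma rel_sym b u v : rel b u v -> rel b v u.
Proof. intros [H1 H2]; split; auto. rewrite (E_comm E E_sym v u); auto. Qed.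

Definition self_emb (M : set) (f : nat -> nat) : Prop := forall u, M u -> M (f u) /\
  forall v, M v -> (f u = f v -> u = v) /\ (E u v <-> E (f u) (f v)).

Lemma self_emb_rel M f b u v : self_emb M f -> M u -> M v -> rel b u v -> rel b (f u) (f v).
Proof.
  intros Hf Mu Mv [H1 H2]. destruct (Hf u Mu) as [_ K]. destruct (K v Mv) as [K1 K2].
  split; [intros Q; auto|]. rewrite <- K2; auto.
Qed.

Lemma self_emb_iter M f n : self_emb M f -> self_emb M (fun u => Nat.iter n f u).
Proof.
  intros Hf. induction n as [|n IH]; intros u Mu; simpl.
  - split; auto. intros v Mv; tauto.
  - destruct (IH u Mu) as [H1 H2]. destruct (Hf _ H1) as [H3 H4]. split; auto.
    intros v Mv. destruct (H2 v Mv) as [H5 H6]. destruct (IH v Mv) as [H7 _].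
    destruct (H4 _ H7) as [H8 H9]. split; auto. rewrite H6; auto.
Qed.

(** Two disjoint modules are joined uniformly; whichever relation [l] this is, [big_joined] supplies
    the other. [M] is itself half of a disjoint pair so that a vertex outside it exists. *)
Lemma kernel_maps M0 : big M0 -> exists (M : set) (l : bool) (al be ga : nat -> nat) (y : nat),
  is_module E M /\ M y /\ (exists w, ~ M w) /\
  self_emb M al /\ self_emb M be /\ self_emb M ga /\
  (forall u v, M u -> M v -> rel l (al u) (be v)) /\
  (forall u, M u -> rel (negb l) y (ga u)).
Proof.
  intros B0. destruct (minimal_exists M0 B0) as [M1 HM1].
  destruct (big_disjoint M1 (proj1 HM1)) as [M [N [S1 [S2 [BM [BN DJ]]]]]].
  assert (HM : minimal M) by (eapply minimal_sub; eauto).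
  destruct (big_disjoint M BM) as [N1 [N2 [S3 [S4 [B1 [B2 D2]]]]]].
  destruct (big_nonempty N1 B1) as [n1 H1]. destruct (big_nonempty N2 B2) as [n2 H2].
  destruct (big_nonempty N BN) as [w Hw].
  set (l := if excluded_middle_informative (E n1 n2) then true else false).
  assert (HL : E n1 n2 <-> l = true).
  { unfold l. destruct (excluded_middle_informative (E n1 n2)); split; auto; try discriminate; contradiction. }
  assert (JN : forall u v, N1 u -> N2 v -> rel l u v).
  { intros u v Hu Hv. split; [intros ->; eauto|].
    rewrite <- HL. destruct B1 as [MO1 _]. destruct B2 as [MO2 _].
    rewrite (E_comm E E_sym u v), (MO1 u n1 v), (E_comm E E_sym v n1), (MO2 v n2 n1); auto; try tauto; eauto. }
  destruct (big_joined (negb l) M BM) as [K [y [SK [BK [My [Ky HK]]]]]].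
  assert (EM : forall Z, subset Z M -> big Z -> exists f, self_emb M f /\ forall u, M u -> Z (f u)).
  { intros Z SZ BZ. destruct (minimal_embeds M Z HM SZ BZ) as [f Hf]. exists f; split.
    - intros u Mu; destruct (Hf u Mu); split; auto.
    - intros u Mu; apply Hf; auto. }
  destruct (EM N1 S3 B1) as [al [A1 A2]]. destruct (EM N2 S4 B2) as [be [A3 A4]].
  destruct (EM K SK BK) as [ga [A5 A6]].
  exists M, l, al, be, ga, y. splits; auto.
  - apply BM.
  - exists w. intros Mw; eapply DJ; eauto.
  - intros u Mu. split; [intros Q; apply Ky; rewrite Q; auto|]. apply HK; auto.
Qed.

(** Iterating [ga] from [y] gives an infinite clique for [negb l]; [al] followed by powers of [be]
    makes infinitely many copies of it, mutually joined by [l]. *)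
Lemma kernel_points M l al be ga y :
  M y -> self_emb M al -> self_emb M be -> self_emb M ga ->
  (forall u v, M u -> M v -> rel l (al u) (be v)) ->
  (forall u, M u -> rel (negb l) y (ga u)) ->
  exists pt : nat -> nat -> nat, forall n i, M (pt n i) /\ forall m j,
    (n = m -> i <> j -> rel (negb l) (pt n i) (pt m j)) /\ (n <> m -> rel l (pt n i) (pt m j)).
Proof.
  intros My HA HB HG JL JN.
  set (kp := fun i => Nat.iter i ga y).
  assert (KM : forall i, M (kp i)) by (intros i; apply (self_emb_iter M ga i HG); auto).
  assert (KS : forall i j, i < j -> rel (negb l) (kp i) (kp j)).
  { intros i j L. replace j with (i + S (j - i - 1)) by lia. unfold kp.
    rewrite Nat.iter_add. apply (self_emb_rel M (fun u => Nat.iter i ga u)); auto.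
    - apply self_emb_iter; auto.
    - apply (KM (S (j - i - 1))).
    - simpl. apply JN. apply KM. }
  assert (KR : forall i j, i <> j -> rel (negb l) (kp i) (kp j)).
  { intros i j N. destruct (Nat.lt_trichotomy i j) as [L|[L|L]]; auto; [contradiction|].
    apply rel_sym; auto. }
  assert (PM : forall n i, M (Nat.iter n be (al (kp i)))).
  { intros n i. apply (self_emb_iter M be n HB). apply HA; auto. }
  assert (PS : forall n m i j, n < m -> rel l (Nat.iter n be (al (kp i))) (Nat.iter m be (al (kp j)))).
  { intros n m i j L. replace m with (n + S (m - n - 1)) by lia. rewrite Nat.iter_add.
    apply (self_emb_rel M (fun u => Nat.iter n be u)).
    - apply self_emb_iter; auto.
    - apply HA; auto.
    - apply (PM (S (m - n - 1)) j).
    - simpl. apply JL; auto. }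
  exists (fun n i => Nat.iter n be (al (kp i))). intros n i; split; auto. intros m j; split.
  - intros -> N. apply (self_emb_rel M (fun u => Nat.iter m be u)).
    + apply self_emb_iter; auto.
    + apply HA; auto.
    + apply HA; auto.
    + apply (self_emb_rel M al); auto.
  - intros N. destruct (Nat.lt_trichotomy n m) as [L|[L|L]]; auto; [contradiction|].
    apply rel_sym; auto.
Qed.

Hypothesis E_cut : forall (b : bool) (A : set), (exists u, A u) -> (exists w, ~ A w) ->
  exists u w, A u /\ ~ A w /\ (E u w <-> b = true).

(* The module [M] becomes its [l]-sum with an apex [(0, 0)] joined to cliques
   [(n + 1, 0), ..., (n + 1, n + 1)], one for each [n] with [s n]
   (edges and non-edges exchanged when [l] is [true]). *)
Theorem kernel_family M0 : big M0 -> readable_family E.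
Proof.
  intros B0.
  destruct (kernel_maps M0 B0) as [M [l [al [be [ga [y [MM [My [[w0 Nw0] [HA [HB [HG [JL JN]]]]]]]]]]]]].
  destruct (kernel_points M l al be ga y My HA HB HG JL JN) as [pt HP].
  set (nl := fun p q : nat * nat => if fst p =? 0 then negb l else if fst q =? 0 then negb l else
    if fst p =? fst q then negb l else l).
  (* The gadget joins the module: vertices outside [M] see it as they see [y], those inside see it
     by [l]. *)
  set (on := fun (u : nat) => (M u /\ l = true) \/ (~ M u /\ E u y)).
  set (P := fun (s : nat -> bool) (p : vert) => match p with
    | inl _ => True
    | inr (0, i) => i = 0
    | inr (S n, i) => s n = true /\ i <= S n end).
  set (G := fun (s : nat -> bool) (p q : vert) => match p, q with
    | inl u, inl v => E u v
    | inl u, inr _ => on u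
    | inr _, inl v => on v
    | inr p, inr q => p <> q /\ nl p q = true end).
  assert (NLS : forall p q, nl p q = nl q p).
  { intros [n i] [m j]; unfold nl; simpl. rewrite (Nat.eqb_sym m n).
    destruct (n =? 0) eqn:E1; destruct (m =? 0) eqn:E2; auto. }
  set (ap := inr (0, 0) : vert).
  exists P, G, (fun _ => ap), (fun _ => inl y). splits.
  - intros s u; exact I.
  - intros s u v; simpl; tauto.
  - intros s [u|p] [v|q]; simpl; auto. intros [H1 H2]; split; auto. rewrite NLS; auto.
  - intros s [u|p]; simpl; auto. intros [H _]; auto.
  - intros s.
    (* [M] moves to the [al] side and the gadget to the [be] side, which are joined by [l]. The
       cliques pass through [ga], so that the apex, sent to [be y], sees them by [negb l]. *)
    set (g := fun p : vert => match p with
      | inl u => if excluded_middle_informative (M u) then al u else u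
      | inr (0, _) => be y
      | inr (S n, i) => be (ga (pt n i)) end).
    assert (gM : forall p, exists m, M m /\ g (inr p) = be m).
    { intros [[|n] i]; simpl; [exists y; auto|]. exists (ga (pt n i)); split; auto.
      apply HG, HP. }
    assert (ON : forall u p, g (inl u) <> g (inr p) /\ (on u <-> E (g (inl u)) (g (inr p)))).
    { intros u p. destruct (gM p) as [m [Mm ->]]. unfold g, on.
      destruct (excluded_middle_informative (M u)) as [Mu|Nu].
      - destruct (JL u m Mu Mm) as [K1 K2]. split; auto. rewrite K2. tauto.
      - assert (M (be m)) by (apply HB; auto). split; [intros ->; auto|].
        rewrite (MM (be m) y u); auto. tauto. }
    assert (NN : forall p q, P s (inr p) -> P s (inr q) -> p <> q -> rel (nl p q) (g (inr p)) (g (inr q))).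
    { assert (A0 : forall n i, rel (negb l) (be y) (be (ga (pt n i)))).
      { intros n i. apply (self_emb_rel M be); auto; [apply HG, HP|]. apply JN, HP. }
      intros [[|n] i] [[|m] j] Pp Pq N; unfold nl; simpl fst; simpl.
      - simpl in Pp, Pq; subst; contradiction.
      - apply A0.
      - apply rel_sym, A0.
      - destruct (HP n i) as [K1 K2]. destruct (K2 m j) as [K3 K4]. destruct (HP m j) as [K5 _].
        apply (self_emb_rel M be); auto; try (apply HG; auto).
        apply (self_emb_rel M ga); auto.
        destruct (Nat.eqb_spec n m) as [->|Ne]; [apply K3; auto; intros ->; auto|apply K4; auto]. }
    exists g. intros [u|p] [v|q] Pp Pq.
    + unfold g, G. destruct (excluded_middle_informative (M u)) as [Mu|Nu];
        destruct (excluded_middle_informative (M v)) as [Mv|Nv].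
      * destruct (HA u Mu) as [_ K]. destruct (K v Mv) as [K1 K2]. split; [intros Q; f_equal; auto|auto].
      * destruct (HA u Mu) as [K _]. split; [intros Q; exfalso; apply Nv; rewrite <- Q; auto|].
        rewrite (E_comm E E_sym u v), (E_comm E E_sym (al u) v). apply MM; auto.
      * destruct (HA v Mv) as [K _]. split; [intros Q; exfalso; apply Nu; rewrite Q; auto|].
        apply MM; auto.
      * split; [intros; f_equal; auto|tauto].
    + destruct (ON u q) as [K1 K2]. split; [intros; contradiction|exact K2].
    + destruct (ON v p) as [K1 K2]. split; [intros Q; exfalso; apply K1; auto|].
      simpl G. rewrite K2. apply E_comm; auto.
    + destruct (classic (p = q)) as [->|N].
      * split; auto. simpl; split; [tauto|intros K; exfalso; eapply E_irr; eauto].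
      * destruct (NN p q Pp Pq N) as [K1 K2]. split; [intros; contradiction|].
        simpl G. rewrite K2. tauto.
  - intros s p Hp.
    (* Inside [M] the relation to the gadget is [l]; for the other value [E_cut] finds a vertex
       outside. *)
    assert (LL : forall b : bool, exists u, on u <-> b = true).
    { intros b. destruct (Bool.bool_dec b l) as [->|N].
      - exists y. unfold on. tauto.
      - destruct (E_cut b M) as [u [w [Mu [Nw Hw]]]]; [eauto|eauto|].
        exists w. unfold on. rewrite <- Hw, (E_comm E E_sym u w), (MM u y w); auto. tauto. }
    split.
    + destruct (LL true) as [u Hu]. exists u. simpl. tauto.
    + destruct (LL false) as [u Hu]. exists u. simpl. rewrite Hu; discriminate.
  - intros s; split; simpl; auto.
  - set (vrel := fun (s : nat -> bool) b p q => p <> q /\ (G s p q <-> b = true)).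
    (* The clique vertices, defined from the marked ones. Old vertices are excluded: those of [M]
       see the apex by [l], and the others see the apex and [y] alike. *)
    set (U := fun s p => P s p /\ vrel s (negb l) p ap /\ vrel s l p (inl y)).
    assert (US : forall s p, U s p <-> exists n i, p = inr (S n, i) /\ s n = true /\ i <= S n).
    { intros s p; split.
      - intros [Pp [[N1 H1] [N2 H2]]]. destruct p as [u|[[|n] i]].
        + exfalso. simpl in H1, H2.
          pose proof (eq_refl true) as TT. assert (FT : false <> true) by discriminate.
          unfold on in H1, H2. destruct l; simpl in H1, H2; tauto.
        + simpl in Pp. subst i. exfalso; apply N1; reflexivity.
        + exists n, i; split; auto.
      - intros [n [i [-> [Hs Hi]]]]. unfold U, vrel, ap; simpl. splits; auto; try discriminate.
        + split; [intros [_ K]; auto|intros K; split; [discriminate|auto]].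
        + unfold on. tauto. }
    assert (UN : forall s n i m j, vrel s (negb l) (inr (S n, i)) (inr (S m, j)) -> n = m).
    { intros s n i m j [N H]. simpl in H. unfold nl in H; simpl in H.
      destruct (Nat.eqb_spec n m) as [->|Ne]; auto. exfalso.
      assert (K : (S n, i) <> (S m, j)) by congruence.
      pose proof (eq_refl true) as TT. assert (FT : false <> true) by discriminate.
      destruct l; simpl in H; tauto. }
    assert (ST : forall s t phi psi, iso_on (P s) (P t) (G s) (G t) phi psi -> phi ap = ap -> phi (inl y) = inl y ->
      forall n i m j, phi (inr (S n, i)) = inr (S m, j) -> s n = true -> i <= S n -> n <= m /\ t m = true).
    { intros s t phi psi [I1 [I2 I3]] Ha Hy n i m j Hp Hs Hi.
      assert (INJ : forall p q, P s p -> P s q -> phi p = phi q -> p = q).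
      { intros p q Pp Pq Q. destruct (I1 p Pp) as [_ <-]. destruct (I1 q Pq) as [_ <-]. congruence. }
      assert (VR : forall b p q, P s p -> P s q -> vrel s b p q -> vrel t b (phi p) (phi q)).
      { intros b p q Pp Pq [N H]. split; [intros Q; apply N; auto|]. rewrite <- I3; auto. }
      assert (UP : forall p, U s p -> U t (phi p)).
      { intros p [Pp [H1 H2]]. split; [apply I1; auto|]. split.
        - rewrite <- Ha. apply VR; auto. simpl; auto.
        - rewrite <- Hy. apply VR; auto. exact I. }
      assert (U0 : U t (inr (S m, j))) by (rewrite <- Hp; apply UP, US; eauto).
      apply US in U0. destruct U0 as [m' [j' [Q [Ht Hj]]]]. inversion Q; subst m' j'.
      split; auto.
      (* Clique [n] has [n + 2] vertices and is mapped into a single clique, so the index cannot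
         drop; the inverse map gives equality. *)
      assert (NoDup (map (fun k => phi (inr (S n, k))) (seq 0 (S (S n))))) as ND.
      { apply NoDup_map_NoDup_ForallPairs; [|apply seq_NoDup].
        intros k k' Hk Hk' Q'. apply in_seq in Hk, Hk'. apply INJ in Q'; [congruence| |]; simpl; split; auto; lia. }
      assert (incl (map (fun k => phi (inr (S n, k))) (seq 0 (S (S n))))
        (map (fun k => inr (S m, k) : vert) (seq 0 (S (S m))))) as IN.
      { intros q Hq. apply in_map_iff in Hq. destruct Hq as [k [<- Hk]]. apply in_seq in Hk.
        assert (Uk : U s (inr (S n, k))) by (apply US; exists n, k; splits; auto; lia).
        pose proof (UP _ Uk) as Uq. apply US in Uq. destruct Uq as [m' [j' [Q1 [Ht' Hj']]]].
        rewrite Q1. assert (m' = m) as ->.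
        { destruct (Nat.eq_dec k i) as [->|Ne]; [rewrite Hp in Q1; inversion Q1; auto|].
          apply (UN t m' j' m j). rewrite <- Q1, <- Hp. apply VR.
          - simpl; split; auto; lia.
          - simpl; auto.
          - split; [intros Q2; inversion Q2; auto|]. simpl. unfold nl; simpl. rewrite Nat.eqb_refl.
            split; [intros [_ K]; auto|intros K; split; [intros Q2; inversion Q2; auto|auto]]. }
        apply in_map_iff. exists j'; split; auto. apply in_seq; lia. }
      pose proof (NoDup_incl_length ND IN) as L. rewrite !length_map, !length_seq in L. lia. }
    assert (SUB : forall s t phi psi, iso_on (P s) (P t) (G s) (G t) phi psi -> phi ap = ap -> phi (inl y) = inl y ->
      forall n, s n = true -> t n = true).
    { intros s t phi psi HI Ha Hy n Hs.
      assert (Pn : P s (inr (S n, 0))) by (simpl; split; auto; lia).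
      pose proof HI as [I1 [I2 I3]].
      destruct (phi (inr (S n, 0))) as [u|[[|m] j]] eqn:Q.
      - exfalso. assert (Uq : U t (inl u)).
        { rewrite <- Q. assert (Un : U s (inr (S n, 0))) by (apply US; exists n, 0; splits; auto; lia).
          destruct Un as [_ [[N1 H1] [N2 H2]]]. split; [apply I1; auto|]. split; split.
          - rewrite <- Ha. intros K. apply N1. destruct (I1 _ Pn) as [_ <-].
            destruct (I1 ap (eq_refl)) as [_ <-]. congruence.
          - rewrite <- Ha, <- I3; auto. reflexivity.
          - rewrite <- Hy. intros K. apply N2. destruct (I1 _ Pn) as [_ <-].
            destruct (I1 (inl y) I) as [_ <-]. congruence.
          - rewrite <- Hy, <- I3; auto. exact I. }
        apply US in Uq. destruct Uq as [n' [i' [K _]]]. discriminate.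
      - exfalso. destruct (I1 _ Pn) as [K1 K2]. rewrite Q in K1, K2. simpl in K1. subst j.
        destruct (I1 ap eq_refl) as [_ K3]. rewrite Ha in K3. unfold ap in K3. congruence.
      - destruct (ST s t phi psi HI Ha Hy n 0 m j Q Hs ltac:(lia)) as [L Ht].
        destruct (I1 _ Pn) as [K1 K2]. rewrite Q in K1, K2. simpl in K1.
        destruct (ST t s psi phi (iso_on_sym _ _ _ _ _ _ HI)) with (n := m) (i := j) (m := n) (j := 0) as [L' _].
        + destruct (I1 ap eq_refl) as [_ K3]. rewrite Ha in K3; auto.
        + destruct (I1 (inl y) I) as [_ K3]. rewrite Hy in K3; auto.
        + auto.
        + auto.
        + apply K1.
        + replace n with m by lia. auto. }
    intros s t phi psi HI Ha Hy. apply functional_extensionality; intros n.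
    assert (s n = true <-> t n = true) as K.
    { split; [eapply SUB; eauto|]. apply (SUB t s psi phi (iso_on_sym _ _ _ _ _ _ HI)).
      - destruct HI as [I1 _]. destruct (I1 ap eq_refl) as [_ K3]. rewrite Ha in K3; auto.
      - destruct HI as [I1 _]. destruct (I1 (inl y) I) as [_ K3]. rewrite Hy in K3; auto. }
    destruct (s n), (t n); auto; [symmetry|]; apply K; auto.
Qed.
End Kernel.

(** * Inserting a coded run into the chain of the vertex 0 *)

Definition gsep (G : vert -> vert -> Prop) (x u v : vert) : Prop :=
  (G x u <-> ~ G x v) /\ (G u v <-> G x v).
(** The order [clt] off its base point, stated for carriers. Being defined from the edges, it is
    preserved by isomorphisms. *)
Definition glt (P : vert -> Prop) (G : vert -> vert -> Prop) (x u v : vert) : Prop :=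
  P u /\ P v /\ u <> x /\ v <> x /\
  (gsep G x u v \/ ((G x u <-> G x v) /\ exists z, P z /\ z <> x /\ gsep G x u z /\ gsep G x z v)).

Lemma glt_iso P Q G H phi psi x u v : iso_on P Q G H phi psi -> P x ->
  glt P G x u v -> glt Q H (phi x) (phi u) (phi v).
Proof.
  intros [I1 [I2 I3]] Px [Pu [Pv [Nu [Nv K]]]].
  assert (INJ : forall p q, P p -> P q -> phi p = phi q -> p = q).
  { intros p q Pp Pq Q1. destruct (I1 p Pp) as [_ <-]. destruct (I1 q Pq) as [_ <-]. congruence. }
  assert (SE : forall p q, P p -> P q -> gsep G x p q -> gsep H (phi x) (phi p) (phi q)).
  { intros p q Pp Pq [K1 K2]. unfold gsep. rewrite <- !I3; auto. }
  split; [apply I1; auto|]. split; [apply I1; auto|].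
  split; [intros Q1; apply Nu, INJ; auto|]. split; [intros Q1; apply Nv, INJ; auto|].
  { destruct K as [K|[K [z [Pz [Nz [K1 K2]]]]]]; [left; auto|right].
    split; [rewrite <- !I3; auto|]. exists (phi z). split; [apply I1; auto|].
    split; [intros Q1; apply Nz, INJ; auto|auto]. }
Qed.

(** Lets an order be designed by hand and then recovered from the graph alone. The alternation
    hypothesis is essential, because equal labels are compared only through an opposite vertex. *)
Lemma glt_intended P G x (lt : vert -> vert -> Prop) :
  (forall p q, P p -> P q -> p <> x -> q <> x -> lt p q -> (G p q <-> G x q)) ->
  (forall p q, P p -> P q -> p <> x -> q <> x -> (G x p <-> ~ G x q) -> lt p q \/ lt q p) ->
  (forall p q, P p -> P q -> p <> x -> q <> x -> lt p q -> (G x p <-> G x q) ->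
     exists z, P z /\ z <> x /\ (G x z <-> ~ G x p) /\ lt p z /\ lt z q) ->
  (forall p q r, lt p q -> lt q r -> lt p r) ->
  (forall p q, G p q -> G q p) ->
  forall p q, P p -> P q -> p <> x -> q <> x -> (glt P G x p q <-> lt p q).
Proof.
  intros H1 H2 H3 H4 GS.
  assert (SP : forall p q, P p -> P q -> p <> x -> q <> x ->
    (gsep G x p q <-> ((G x p <-> ~ G x q) /\ lt p q))).
  { intros p q Pp Pq Np Nq. unfold gsep. split.
    - intros [K1 K2]; split; auto. destruct (H2 p q) as [K|K]; auto.
      pose proof (H1 q p Pq Pp Nq Np K) as K3. assert (G p q <-> G q p) by (split; auto). tauto.
    - intros [K1 K2]; split; auto. }
  intros p q Pp Pq Np Nq. split.
  - intros [_ [_ [_ [_ [K|[K [z [Pz [Nz [K1 K2]]]]]]]]]].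
    + apply SP in K; auto. tauto.
    + apply SP in K1; auto. apply SP in K2; auto. eapply H4; [apply K1|apply K2].
  - intros K. rsplits; auto. destruct (classic (G x p <-> G x q)) as [L|L].
    + right; split; auto. destruct (H3 p q) as [z [Pz [Nz [K1 [K2 K3]]]]]; auto.
      exists z; splits; auto; apply SP; auto; split; auto; tauto.
    + left. apply SP; auto. split; auto. tauto.
Qed.

Definition flip (d : bool) (R : vert -> vert -> Prop) (p q : vert) : Prop := if d then R p q else R q p.

(* An isomorphism fixing the base point and an element of level 0 maps each later level
   into itself, since consecutive levels are consecutive classes. *)
Lemma level_iso (d : bool) P Q G H phi psi x b b' (lv lv' : nat -> vert -> Prop) :
  iso_on P Q G H phi psi -> P x -> phi x = x -> phi b = b' ->
  lv 0 b -> lv' 0 b' ->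
  (forall j p, lv j p -> P p /\ p <> x) -> (forall j p, lv' j p -> Q p /\ p <> x) ->
  (forall j, exists p, lv j p) -> (forall j, exists p, lv' j p) ->
  (forall j p q, lv j p -> lv (S j) q -> flip d (glt P G x) p q /\
     forall r, ~ (flip d (glt P G x) p r /\ flip d (glt P G x) r q)) ->
  (forall j p q, lv' j p -> lv' (S j) q -> flip d (glt Q H x) p q /\
     forall r, ~ (flip d (glt Q H x) p r /\ flip d (glt Q H x) r q)) ->
  (forall j p r, lv' (S j) p -> Q r -> r <> x -> ~ glt Q H x p r -> ~ glt Q H x r p -> lv' (S j) r) ->
  forall j p, lv (S j) p -> lv' (S j) (phi p).
Proof.
  intros HI Px Hx Hb B0 B0' PL PL' NE NE' CV CV' CL.
  pose proof (iso_on_sym _ _ _ _ _ _ HI) as HJ.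
  pose proof HI as [I1 [I2 I3]].
  assert (Qx : Q x) by (rewrite <- Hx; apply I1; auto).
  assert (psx : psi x = x) by (rewrite <- Hx at 1; apply I1; auto).
  assert (FW : forall p q, flip d (glt P G x) p q -> flip d (glt Q H x) (phi p) (phi q)).
  { intros p q K. rewrite <- Hx. destruct d; simpl in *; rewrite Hx at 1; rewrite <- Hx at 1; eapply glt_iso; eauto. }
  assert (BW : forall p q, flip d (glt Q H x) p q -> flip d (glt P G x) (psi p) (psi q)).
  { intros p q K. rewrite <- psx. destruct d; simpl in *; rewrite psx at 1; rewrite <- psx at 1; eapply glt_iso; eauto. }
  (* The image of [q] cannot fall inside the cover in the target, nor lie beyond the next level, as
     then a preimage would fall inside the cover in the source. So it belongs to the class of that
     level. *)
  assert (ST : forall j, (exists p, lv j p /\ lv' j (phi p)) -> forall q, lv (S j) q -> lv' (S j) (phi q)).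
  { intros j [p [Lp Lp']] q Lq. destruct (NE' (S j)) as [q' Lq'].
    destruct (CV j p q Lp Lq) as [K1 K2]. destruct (CV' j (phi p) q' Lp' Lq') as [K3 K4].
    destruct (PL _ _ Lq) as [Pq Nq]. destruct (PL _ _ Lp) as [Pp Np].
    assert (Qq : Q (phi q)) by (apply I1; auto).
    assert (phi q <> x).
    { intros Q1. apply Nq. destruct (I1 q Pq) as [_ <-]. rewrite Q1; auto. }
    assert (A : ~ flip d (glt Q H x) (phi q) q').
    { intros A. apply (K4 (phi q)). split; auto. }
    assert (B : ~ flip d (glt Q H x) q' (phi q)).
    { intros B. apply (K2 (psi q')). apply BW in B. apply BW in K3.
      destruct (I1 q Pq) as [_ E1]. destruct (I1 p Pp) as [_ E2]. rewrite E1 in B. rewrite E2 in K3. auto. }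
    apply (CL j q'); auto; destruct d; simpl in A, B; auto. }
  assert (EX : forall j, exists p, lv j p /\ lv' j (phi p)).
  { induction j as [|j IH].
    - exists b; rewrite Hb; auto.
    - destruct (NE (S j)) as [q Lq]. exists q; split; auto. }
  intros j p Lp. apply ST; auto.
Qed.

Section Insert.
Variable E : nat -> nat -> Prop.
Hypothesis E_sym : forall u v, E u v -> E v u.
Hypothesis E_irr : forall u, ~ E u u.
Hypothesis no_P4 : forall a b c d, E a b -> E b c -> E c d -> ~ E a c -> ~ E b d -> ~ E a d -> False.

Definition All : set := fun _ => True.
Definition lam : set := E 0.
Definition olt : nat -> nat -> Prop := clt E All 0.

Lemma olt_chain : chain E All olt lam.
Proof. apply clt_chain; auto. exact I. Qed.
Definition olt_trans := ch_trans _ _ _ _ olt_chain.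
Definition olt_irr := ch_irr _ _ _ _ olt_chain.
Definition olt_adj := ch_adj _ _ _ _ olt_chain.
Lemma olt_neg u v w : olt u w -> olt u v \/ olt v w.
Proof. intros H; apply (ch_neg _ _ _ _ olt_chain); auto. exact I. Qed.
Lemma olt_lab u v : ~ olt u v -> ~ olt v u -> (lam u <-> lam v).
Proof. intros; apply (ch_lab _ _ _ _ olt_chain); rsplits; auto; exact I. Qed.
Lemma olt_base v : v <> 0 -> olt 0 v.
Proof. intros N; split; [exact I|]; split; [exact I|left; auto]. Qed.
Lemma olt_nonzero u v : olt u v -> v <> 0.
Proof. intros [_ [_ [[_ ?]|[_ [? _]]]]]; auto. Qed.
Lemma olt_alt u v : olt u v -> u <> 0 -> (lam u <-> lam v) ->
  exists z, olt u z /\ olt z v /\ (lam z <-> ~ lam u).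
Proof.
  intros [_ [_ [[? _]|[_ [Nv [H|[_ [z [_ [Nz [H1 H2]]]]]]]]]]] Nu LL; [contradiction| |].
  - destruct H as [H _]. unfold lam in LL. tauto.
  - exists z. splits.
    + split; [exact I|]; split; [exact I|]. right; auto.
    + split; [exact I|]; split; [exact I|]. right; auto.
    + destruct H1 as [H1 _]. unfold lam. tauto.
Qed.

(* For each [n] two new classes are inserted above [low n]: the vertex [(n, 0)], and [(n, 1)] with
   its copy [(n, 2)] if [s n]; their labels are [lb n true] and [lb n false]. The new classes
   ascend with [n] if [d] and descend otherwise. *)
Variables (d : bool) (low : nat -> set) (lb : nat -> bool -> bool).
Definition nlab (p : nat * nat) : bool := lb (fst p) (snd p =? 0).
(** The copies [(n, 1)] and [(n, 2)] share a position, hence a class: the bit changes the size of a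
    class and not the order. *)
Definition key (p : nat * nat) : nat := 2 * fst p + min (snd p) 1.
Definition nlt (p q : nat * nat) : Prop := if d then key p < key q else key q < key p.
Definition carrier (s : nat -> bool) (p : vert) : Prop := match p with
  | inl _ => True | inr (n, i) => i <= 1 \/ (i = 2 /\ s n = true) end.
Definition vlab (p : vert) : Prop := match p with inl v => lam v | inr q => nlab q = true end.
Definition vlt (p q : vert) : Prop := match p, q with
  | inl u, inl v => olt u v
  | inl u, inr q => low (fst q) u
  | inr p, inl v => ~ low (fst p) v
  | inr p, inr q => nlt p q end.
(** Copies in one class are joined according to their common label, exactly as if they were in
    different classes; the embedding back will separate them. *)
Definition vedge (p q : vert) : Prop := match p, q with
  | inl u, inl v => E u v
  | inl u, inr q => (low (fst q) u /\ nlab q = true) \/ (~ low (fst q) u /\ lam u)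
  | inr q, inl u => (low (fst q) u /\ nlab q = true) \/ (~ low (fst q) u /\ lam u)
  | inr p, inr q => p <> q /\ ((nlt p q /\ nlab q = true) \/ (~ nlt p q /\ nlab p = true)) end.

Hypothesis low_base : forall n, low n 0.
Hypothesis low_down : forall n v w, low n v -> ~ olt v w -> low n w.
Hypothesis low_key : forall n m v, (if d then n <= m else m <= n) -> low n v -> low m v.

Lemma key_fst p q : key p = key q -> fst p = fst q /\ nlab p = nlab q.
Proof.
  destruct p as [n i], q as [m j]; unfold key, nlab; simpl fst; simpl snd. intros H.
  assert (n = m) by lia. subst m. split; auto.
  destruct i, j; simpl in *; auto; lia.
Qed.
Lemma nlt_asym p q : nlt p q -> ~ nlt q p.
Proof. unfold nlt; destruct d; lia. Qed.
Lemma nlt_total p q : ~ nlt p q -> ~ nlt q p -> fst p = fst q /\ nlab p = nlab q.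
Proof. unfold nlt; intros; apply key_fst; destruct d; lia. Qed.
Lemma nlt_low p q v : nlt p q -> low (fst p) v -> low (fst q) v.
Proof.
  intros H; apply low_key. unfold nlt, key in H. destruct p as [n i], q as [m j]; simpl in *.
  destruct d; lia.
Qed.

Lemma vedge_sym p q : vedge p q -> vedge q p.
Proof.
  destruct p as [u|p], q as [v|q]; simpl; auto. intros [N H]; split; auto.
  destruct H as [[H1 H2]|[H1 H2]].
  - right; split; auto. apply nlt_asym; auto.
  - destruct (classic (nlt q p)) as [K|K]; auto. right; split; auto.
    destruct (nlt_total p q H1 K); congruence.
Qed.
Lemma vedge_irr p : ~ vedge p p.
Proof. destruct p; simpl; auto. intros [N _]; auto. Qed.
Lemma vedge_base p : p <> inl 0 -> (vedge (inl 0) p <-> vlab p).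
Proof. destruct p as [v|q]; simpl; [unfold lam; tauto|]. intros _. pose proof (low_base (fst q)). tauto. Qed.

Lemma vlt_trans p q r : vlt p q -> vlt q r -> vlt p r.
Proof.
  destruct p as [u|p], q as [v|q], r as [w|r]; simpl; intros H1 H2.
  - eapply olt_trans; eauto.
  - apply low_down with v; auto. intros K. apply (olt_irr u). eapply olt_trans; eauto.
  - apply NNPP; intros K. apply H2. apply low_down with u; auto.
  - eapply nlt_low; eauto.
  - intros K. apply H1. apply low_down with w; auto. intros K'. apply (olt_irr v). eapply olt_trans; eauto.
  - apply NNPP; intros K. apply H1. destruct (classic (nlt r p)) as [K'|K'].
    + eapply nlt_low; eauto.
    + destruct (nlt_total p r K K') as [-> _]; auto.
  - intros K. apply H2. eapply nlt_low; eauto.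
  - unfold nlt in *; destruct d; lia.
Qed.
Lemma vlt_irr p : ~ vlt p p.
Proof. destruct p as [u|p]; simpl; [apply olt_irr|]. unfold nlt; destruct d; lia. Qed.
Lemma vlt_adj p q : vlt p q -> (vedge p q <-> vlab q).
Proof.
  destruct p as [u|p], q as [v|q]; simpl; intros H; try tauto.
  - apply olt_adj; auto.
  - split; [tauto|]. intros K; split; [|auto]. intros ->. apply (vlt_irr (inr q)); auto.
Qed.
Lemma vlt_opp p q : (vlab p <-> ~ vlab q) -> vlt p q \/ vlt q p.
Proof.
  destruct p as [u|p], q as [v|q]; simpl; intros H.
  - apply NNPP; intros K. assert (lam u <-> lam v) by (apply olt_lab; tauto). tauto.
  - tauto.
  - tauto.
  - apply NNPP; intros K. destruct (nlt_total p q) as [_ E1]; try tauto. rewrite E1 in H. tauto.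
Qed.

(* The levels are consecutive classes of the enlarged chain; level [cj n] carries the bit [s n]. *)
Variables (lvl : nat -> vert -> Prop) (cj : nat -> nat) (b : vert).
Hypothesis lvl_start : lvl 0 b /\ forall s, carrier s b.
Hypothesis lvl_nonempty : forall j, exists p, lvl j p /\ forall s, carrier s p.
Hypothesis lvl_base : forall j p, lvl j p -> p <> inl 0.
Hypothesis lvl_cover : forall j p q, lvl j p -> lvl (S j) q -> flip d vlt p q /\
  forall r, ~ (flip d vlt p r /\ flip d vlt r q).
Hypothesis lvl_alt : forall j p q, lvl j p -> lvl (S j) q -> (vlab p <-> ~ vlab q).
Hypothesis lvl_class : forall j p r, lvl (S j) p -> ~ vlt p r -> ~ vlt r p -> lvl (S j) r.
Hypothesis lvl_code : forall n i, lvl (cj n) (inr (n, S i)).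
Hypothesis lvl_code_inv : forall n p, lvl (cj n) p -> exists i, p = inr (n, S i).
Hypothesis cj_pos : forall n, exists j, cj n = S j.
Hypothesis lvl_new : forall q, exists j, lvl j (inr q) /\
  (j = 0 -> d = true /\ forall u, u <> 0 -> low (fst q) u -> (lam u <-> nlab q = true) ->
     exists z, low (fst q) z /\ olt u z /\ (lam z <-> ~ lam u)).

(** An adjacent class of opposite label separates [p] from everything above it with the label of
    [p]. *)
Lemma alt_up s p q z : vlt p q -> (vlab p <-> vlab q) -> carrier s z -> z <> inl 0 ->
  (vlab p <-> ~ vlab z) -> vlt p z -> (forall r, ~ (vlt p r /\ vlt r z)) ->
  exists z, carrier s z /\ z <> inl 0 /\ (vlab z <-> ~ vlab p) /\ vlt p z /\ vlt z q.
Proof.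
  intros H LL Cz Nz LA K1 K2. exists z; splits; auto; [tauto|].
  destruct (vlt_opp z q) as [K|K]; [tauto|auto|]. exfalso; apply (K2 q); auto.
Qed.
Lemma alt_down s p q z : vlt p q -> (vlab p <-> vlab q) -> carrier s z -> z <> inl 0 ->
  (vlab z <-> ~ vlab q) -> vlt z q -> (forall r, ~ (vlt z r /\ vlt r q)) ->
  exists z, carrier s z /\ z <> inl 0 /\ (vlab z <-> ~ vlab p) /\ vlt p z /\ vlt z q.
Proof.
  intros H LL Cz Nz LA K1 K2. exists z; splits; auto; [tauto|].
  destruct (vlt_opp p z) as [K|K]; [tauto|auto|]. exfalso; apply (K2 p); auto.
Qed.

Lemma cover_up j p q : d = true -> lvl j p -> lvl (S j) q ->
  vlt p q /\ forall r, ~ (vlt p r /\ vlt r q).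
Proof. intros Ed Lp Lq. pose proof (lvl_cover j p q Lp Lq) as K. unfold flip in K. rewrite Ed in K. exact K. Qed.
Lemma cover_down j p q : d = false -> lvl j p -> lvl (S j) q ->
  vlt q p /\ forall r, ~ (vlt q r /\ vlt r p).
Proof.
  intros Ed Lp Lq. pose proof (lvl_cover j p q Lp Lq) as K. unfold flip in K. rewrite Ed in K.
  destruct K as [K1 K2]; split; auto. intros r [R1 R2]; apply (K2 r); auto.
Qed.

(** Old pairs alternate already, and at a new vertex a neighbouring level supplies the separating
    vertex. Level 0 has no preceding level, whence the extra clause in [lvl_new]. *)
Lemma vlt_alt s p q : p <> inl 0 -> q <> inl 0 -> vlt p q -> (vlab p <-> vlab q) ->
  exists z, carrier s z /\ z <> inl 0 /\ (vlab z <-> ~ vlab p) /\ vlt p z /\ vlt z q.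
Proof.
  intros Np Nq H LL.
  destruct p as [u|p].
  - destruct q as [v|q].
    + assert (u <> 0) as Nu by congruence. destruct (olt_alt u v H Nu LL) as [z [K1 [K2 K3]]].
      exists (inl z); splits; auto; [exact I|]. intros Q; inversion Q; subst. apply (olt_nonzero _ _ K1); auto.
    + destruct (lvl_new q) as [j [Lq Hj]]. assert (d = true \/ d = false) as [Ed|Ed] by (case d; auto).
      * destruct j as [|j].
        { destruct (Hj eq_refl) as [_ Hz]. assert (u <> 0) as Nu by congruence.
          destruct (Hz u Nu H LL) as [z [Z1 [Z2 Z3]]].
          exists (inl z); splits; auto; [exact I|]. intros Q; inversion Q; subst. apply (olt_nonzero _ _ Z2); auto. }
        { destruct (lvl_nonempty j) as [z [Lz Cz]]. destruct (cover_up j z (inr q) Ed Lz Lq) as [K1 K2].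
          eapply alt_down with (z := z); eauto. }
      * destruct (lvl_nonempty (S j)) as [z [Lz Cz]]. destruct (cover_down j (inr q) z Ed Lq Lz) as [K1 K2].
        eapply alt_down with (z := z); eauto.
        { pose proof (lvl_alt j (inr q) z Lq Lz). tauto. }
  - destruct (lvl_new p) as [j [Lp Hj]]. assert (d = true \/ d = false) as [Ed|Ed] by (case d; auto).
    + destruct (lvl_nonempty (S j)) as [z [Lz Cz]]. destruct (cover_up j (inr p) z Ed Lp Lz) as [K1 K2].
      eapply alt_up with (z := z); eauto.
    + destruct j as [|j]; [destruct (Hj eq_refl); congruence|].
      destruct (lvl_nonempty j) as [z [Lz Cz]]. destruct (cover_down j z (inr p) Ed Lz Lp) as [K1 K2].
      eapply alt_up with (z := z); eauto.
      { pose proof (lvl_alt j z (inr p) Lz Lp). tauto. }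
Qed.

Lemma glt_vlt s p q : carrier s p -> carrier s q -> p <> inl 0 -> q <> inl 0 ->
  (glt (carrier s) vedge (inl 0) p q <-> vlt p q).
Proof.
  apply glt_intended.
  - intros p' q' _ _ _ Nq H. rewrite vedge_base; auto. apply vlt_adj; auto.
  - intros p' q' _ _ Np Nq H. rewrite !vedge_base in H; auto. apply vlt_opp; auto.
  - intros p' q' _ _ Np Nq H HL. rewrite !vedge_base in HL; auto.
    destruct (vlt_alt s p' q' Np Nq H HL) as [z [K1 [K2 [K3 [K4 K5]]]]].
    exists z; splits; auto. rewrite !vedge_base; auto.
  - apply vlt_trans.
  - apply vedge_sym.
Qed.

Lemma glt_vlt_flip s p q : carrier s p -> carrier s q -> p <> inl 0 -> q <> inl 0 ->
  (flip d (glt (carrier s) vedge (inl 0)) p q <-> flip d vlt p q).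
Proof. intros; unfold flip; case d; apply glt_vlt; auto. Qed.

(** Levels are preserved, so the class carrying bit [n] is mapped into the class carrying the same
    bit; two vertices cannot go injectively into a class of one. *)
Lemma levels_readable s t phi psi :
  iso_on (carrier s) (carrier t) vedge vedge phi psi ->
  phi (inl 0) = inl 0 -> phi b = b -> forall n, s n = true -> t n = true.
Proof.
  intros HI H0 Hb n Hs.
  assert (CV : forall s j p q, lvl j p /\ carrier s p -> lvl (S j) q /\ carrier s q ->
    flip d (glt (carrier s) vedge (inl 0)) p q /\
    forall r, ~ (flip d (glt (carrier s) vedge (inl 0)) p r /\ flip d (glt (carrier s) vedge (inl 0)) r q)).
  { intros s' j p q [Lp Cp] [Lq Cq]. destruct (lvl_cover j p q Lp Lq) as [K1 K2]. split.
    - apply glt_vlt_flip; auto; eapply lvl_base; eauto.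
    - intros r [R1 R2].
      assert (carrier s' r /\ r <> inl 0) as [Cr Nr].
      { clear R2. unfold flip in R1. revert R1. case d; intros [A1 [A2 [A3 [A4 _]]]]; auto. }
      apply glt_vlt_flip in R1; auto; [|eapply lvl_base; eauto].
      apply glt_vlt_flip in R2; auto; [|eapply lvl_base; eauto].
      apply (K2 r); auto. }
  assert (LI : forall j p, lvl (S j) p /\ carrier s p -> lvl (S j) (phi p) /\ carrier t (phi p)).
  { apply (level_iso d (carrier s) (carrier t) vedge vedge phi psi (inl 0) b b
      (fun j p => lvl j p /\ carrier s p) (fun j p => lvl j p /\ carrier t p)); auto.
    - exact I.
    - split; apply lvl_start.
    - split; apply lvl_start.
    - intros j p [K1 K2]; split; auto. eapply lvl_base; eauto.
    - intros j p [K1 K2]; split; auto. eapply lvl_base; eauto.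
    - intros j. destruct (lvl_nonempty j) as [p [K1 K2]]; exists p; auto.
    - intros j. destruct (lvl_nonempty j) as [p [K1 K2]]; exists p; auto.
    - apply CV.
    - apply CV.
    - intros j p r [K1 K2] Cr Nr N1 N2. split; auto.
      assert (p <> inl 0) by (eapply lvl_base; eauto).
      rewrite glt_vlt in N1, N2; auto. eapply lvl_class; eauto. }
  destruct (cj_pos n) as [j Ej].
  assert (C1 : carrier s (inr (n, 1))) by (simpl; auto).
  assert (C2 : carrier s (inr (n, 2))) by (simpl; auto).
  destruct (LI j (inr (n, 1))) as [L1 D1]; [rewrite <- Ej; split; auto|].
  destruct (LI j (inr (n, 2))) as [L2 D2]; [rewrite <- Ej; split; auto|].
  rewrite <- Ej in L1, L2.
  apply lvl_code_inv in L1. apply lvl_code_inv in L2.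
  destruct L1 as [i1 E1]. destruct L2 as [i2 E2].
  rewrite E1 in D1. rewrite E2 in D2. simpl in D1, D2.
  destruct (t n); auto. exfalso.
  assert (i1 = 0 /\ i2 = 0) as [-> ->] by (destruct D1 as [?|[_ ?]]; [|discriminate]; destruct D2 as [?|[_ ?]]; [lia|discriminate]).
  destruct HI as [I1 _]. destruct (I1 _ C1) as [_ K1]. destruct (I1 _ C2) as [_ K2]. congruence.
Qed.

Variables (S0 : set) (h : vert -> nat).
(** In the embedding back, the new vertices share the room of [S0] with its old ones, while all
    other old vertices stay fixed. *)
Definition moved (p : vert) : Prop := match p with inl u => S0 u | inr _ => True end.
Hypothesis S_split : forall u, ~ S0 u ->
  ((forall z, S0 z -> olt u z) /\ forall n, low n u) \/ ((forall z, S0 z -> olt z u) /\ forall n, ~ low n u).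
Hypothesis h_S : forall p, moved p -> S0 (h p).
Hypothesis h_lab : forall p, moved p -> (vlab p <-> lam (h p)).
Hypothesis h_emb : forall s p q, carrier s p -> carrier s q -> moved p -> moved q ->
  (h p = h q -> p = q) /\ (vedge p q <-> E (h p) (h q)).
Hypothesis above : forall n (c : bool), exists v, ~ low n v /\ (lam v <-> c = true).

Theorem insert_family : readable_family E.
Proof.
  exists carrier, (fun _ => vedge), (fun _ => inl 0), (fun _ => b). splits.
  - intros s u; exact I.
  - intros s u v; simpl; tauto.
  - intros s p q; apply vedge_sym.
  - intros s p; apply vedge_irr.
  - intros s. exists (fun p => if excluded_middle_informative (moved p) then h p else
      match p with inl u => u | inr _ => 0 end).
    assert (MX : forall u q, ~ S0 u -> moved q -> u <> h q /\ (vedge (inl u) q <-> E u (h q))).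
    { intros u q Nu Mq.  split; [intros ->; auto|].
      destruct (S_split u Nu) as [[K1 K2]|[K1 K2]].
      - rewrite (olt_adj u (h q)), <- h_lab; auto. apply vlt_adj.
        destruct q as [v|q]; simpl; auto.
      - rewrite (E_comm E E_sym u (h q)), (olt_adj (h q) u); auto.
        assert (vedge (inl u) q <-> vedge q (inl u)) as -> by (split; apply vedge_sym).
        rewrite vlt_adj; [simpl; tauto|]. destruct q as [v|q]; simpl; auto. }
    intros p q Cp Cq.
    destruct (excluded_middle_informative (moved p)) as [Mp|Np];
      destruct (excluded_middle_informative (moved q)) as [Mq|Nq].
    + eapply h_emb; eauto.
    + destruct q as [v|q]; [|exfalso; apply Nq; exact I].
      destruct (MX v p Nq Mp) as [K1 K2]. split; [intros Q; exfalso; apply K1; auto|].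
      rewrite (E_comm E E_sym (h p) v), <- K2. split; apply vedge_sym.
    + destruct p as [u|p]; [|exfalso; apply Np; exact I].
      destruct (MX u q Np Mq) as [K1 K2]. split; [intros Q; contradiction|auto].
    + destruct p as [u|p]; [|exfalso; apply Np; exact I]. destruct q as [v|q]; [|exfalso; apply Nq; exact I].
      split; [intros; f_equal; auto|simpl; tauto].
  - intros s p Cp. split.
    + destruct (above (fst p) true) as [v [H1 H2]]. exists v; simpl. tauto.
    + destruct (above (fst p) false) as [v [H1 H2]]. exists v; simpl.
      assert (~ lam v) by (rewrite H2; discriminate). tauto.
  - intros s; split; [exact I|apply lvl_start].
  - intros s t phi psi HI H1 H2. apply functional_extensionality; intros n.
    assert (s n = true <-> t n = true) as K.
    { split; [eapply levels_readable; eauto|].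
      pose proof (iso_on_sym _ _ _ _ _ _ HI) as HJ. destruct HI as [I1 _].
      eapply (levels_readable t s psi phi); eauto.
      - destruct (I1 (inl 0) I) as [_ K]. rewrite H1 in K; auto.
      - destruct (I1 b) as [_ K]; [apply lvl_start|]. rewrite H2 in K; auto. }
    destruct (s n), (t n); auto; [symmetry|]; apply K; auto.
Qed.
End Insert.

(** * All modules tame *)

Section TameModules.
Variable E : nat -> nat -> Prop.
Hypothesis E_sym : forall u v, E u v -> E v u.
Hypothesis E_irr : forall u, ~ E u u.
Hypothesis no_P4 : forall a b c d, E a b -> E b c -> E c d -> ~ E a c -> ~ E b d -> ~ E a d -> False.
Hypothesis E_cut : forall (b : bool) (A : set), (exists u, A u) -> (exists w, ~ A w) ->
  exists u w, A u /\ ~ A w /\ (E u w <-> b = true).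
Hypothesis all_tame : forall N, is_module E N -> tame E N.

Local Notation "u << v" := (olt E u v) (at level 70).
Let TR := olt_trans E E_sym no_P4.
Let IR := olt_irr E E_sym no_P4.
Let NG := olt_neg E E_sym no_P4.
Let LAB := olt_lab E E_sym no_P4.
Let ADJ := olt_adj E E_sym no_P4.

Lemma olt_le_l a b c : ~ a << b -> a << c -> b << c.
Proof. intros N H. destruct (NG a b c H); tauto. Qed.
Lemma olt_le_r a b c : ~ a << b -> c << b -> c << a.
Proof. intros N H. destruct (NG c a b H); tauto. Qed.
Lemma olt_asym a b : a << b -> ~ b << a.
Proof. intros H K. apply (IR a). eapply TR; eauto. Qed.

Definition near (u v : nat) : Prop := ~ u << v /\ ~ v << u.
Lemma near_refl u : near u u.
Proof. split; apply IR. Qed.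
Lemma near_lab u v : near u v -> (lam E u <-> lam E v).
Proof. intros [H1 H2]; apply LAB; auto. Qed.
Lemma near_olt u v u' v' : near u u' -> near v v' -> (u << v <-> u' << v').
Proof.
  intros [A1 A2] [B1 B2]; split; intros H.
  - apply olt_le_l with u; auto. apply olt_le_r with v; auto.
  - apply olt_le_l with u'; auto. apply olt_le_r with v'; auto.
Qed.
Lemma near_cls u v : cls All (olt E) u v <-> near u v.
Proof.
  split.
  - intros [[_ [_ H1]] [_ [_ H2]]]; split; auto.
  - intros [H1 H2]; split; (split; [exact I|split; [exact I|auto]]).
Qed.
Lemma near_set u : cls All (olt E) u = near u.
Proof. apply set_ext; apply near_cls. Qed.
Lemma near_module u : is_module E (near u).
Proof.
  rewrite <- near_set. apply (class_module E E_sym All (olt E) (lam E)).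
  - apply olt_chain; auto.
  - intros a b w _ _ H. exfalso; apply H; exact I.
Qed.

(** Everything below a largest class would see it uniformly, by its label, so the graph or its
    complement would be disconnected. *)
Lemma no_top v : exists w, v << w.
Proof.
  apply NNPP; intros N.
  assert (T : forall w, ~ v << w) by (intros w H; apply N; eauto).
  destruct (Nat.eq_dec v 0) as [->|Nv]; [apply (T 1), olt_base; auto|].
  destruct (E_cut (if excluded_middle_informative (lam E v) then false else true) (near v)) as [u [w [Au [Aw H]]]].
  - exists v; apply near_refl.
  - exists 0. intros [_ K]. apply K, olt_base; auto.
  - assert (w << v) by (apply NNPP; intros K; apply Aw; split; auto).
    assert (w << u) by (eapply near_olt; [apply near_refl| |eauto]; destruct Au; split; auto).
    rewrite (E_comm E E_sym u w), (ADJ w u), <- (near_lab v u) in H; auto.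
    destruct (excluded_middle_informative (lam E v)); [|tauto]. assert (false = true) by tauto. discriminate.
Qed.

Lemma above_labels v (c : bool) : exists w, v << w /\ (lam E w <-> c = true).
Proof.
  destruct (no_top v) as [w Hw]. destruct (no_top w) as [w' Hw'].
  destruct (classic (lam E w <-> c = true)) as [L|L]; [eauto|].
  destruct (classic (lam E w' <-> c = true)) as [L'|L']; [exists w'; split; eauto|].
  destruct (olt_alt E w w') as [z [Z1 [Z2 Z3]]]; auto; [eapply olt_nonzero; eauto|tauto|].
  exists z; split; [eauto|]. destruct (classic (c = true)); tauto.
Qed.

Definition cov (u v : nat) : Prop := u << v /\ forall w, ~ (u << w /\ w << v).
Lemma cov_alt u v : cov u v -> u <> 0 -> (lam E u <-> ~ lam E v).
Proof.
  intros [H N] Nu. destruct (classic (lam E u <-> lam E v)) as [L|L]; [|tauto].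
  destruct (olt_alt E u v H Nu L) as [z [Z1 [Z2 _]]]. exfalso; apply (N z); auto.
Qed.

(** * An infinite run of consecutive classes *)

Section Run.
Variables (d : bool) (u : nat -> nat).
Hypothesis u_pos : forall n, u n <> 0.
Hypothesis u_cov : forall n, if d then cov (u n) (u (S n)) else cov (u (S n)) (u n).
Hypothesis u_rec : forall n K, exists m, K <= m /\ (lam E (u n) <-> lam E (u m)) /\ emb E (near (u n)) (near (u m)).

Let dir (a b : nat) : Prop := if d then a << b else b << a.
Let ord (i j : nat) : Prop := if d then i < j else j < i.

Lemma dir_trans a b c : dir a b -> dir b c -> dir a c.
Proof. unfold dir; destruct d; eauto. Qed.
Lemma dir_irr a : ~ dir a a.
Proof. unfold dir; destruct d; apply IR. Qed.
Lemma dir_near a b a' b' : near a a' -> near b b' -> (dir a b <-> dir a' b').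
Proof. unfold dir; destruct d; intros; apply near_olt; auto. Qed.
Lemma dir_cases a b : near a b \/ dir a b \/ dir b a.
Proof. unfold dir, near; destruct d; tauto. Qed.
Lemma run_step n : dir (u n) (u (S n)) /\ forall w, dir (u n) w -> dir w (u (S n)) -> False.
Proof.
  pose proof (u_cov n) as H. unfold dir; destruct d; destruct H as [H1 H2]; split; auto;
  intros w A B; apply (H2 w); auto.
Qed.
Lemma run_lt i j : i < j -> dir (u i) (u j).
Proof. induction 1; [apply run_step|]. eapply dir_trans; [eauto|apply run_step]. Qed.
Lemma run_alt n : lam E (u n) <-> ~ lam E (u (S n)).
Proof.
  pose proof (u_cov n) as H. destruct d; pose proof (cov_alt _ _ H (u_pos _)); auto.
  destruct (classic (lam E (u n))), (classic (lam E (u (S n)))); tauto.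
Qed.
Lemma run_olt n m v w : near (u n) v -> near (u m) w -> (v << w <-> ord n m).
Proof.
  intros Hv Hw. rewrite <- (near_olt (u n) (u m) v w) by auto.
  destruct (lt_eq_lt_dec n m) as [[L| ->]|L].
  - pose proof (run_lt n m L) as K. unfold dir, ord in *; destruct d; [split; auto|].
    split; intros Q; exfalso; [eapply olt_asym; eauto|simpl in Q; lia].
  - split; intros Q; exfalso; [apply (IR _ Q)|]. unfold ord in Q; destruct d; lia.
  - pose proof (run_lt m n L) as K. unfold dir, ord in *; destruct d; [|split; auto].
    split; intros Q; exfalso; [eapply olt_asym; eauto|simpl in Q; lia].
Qed.

Let S0 : set := fun v => exists n, near (u n) v.
Lemma run_convex v : ~ S0 v -> dir v (u 0) \/ forall n, dir (u n) v.
Proof.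
  intros N. assert (NN : forall n, ~ near (u n) v) by (intros n K; apply N; exists n; auto).
  destruct (dir_cases (u 0) v) as [K|[K|K]]; [exfalso; eapply NN; eauto| |auto]. right.
  induction n as [|n IH]; auto.
  destruct (dir_cases (u (S n)) v) as [K'|[K'|K']]; [exfalso; eapply NN; eauto|auto|].
  exfalso; eapply (proj2 (run_step n)); eauto.
Qed.

Let low (n : nat) : set := fun v => if d then ~ u n << v else v << u n.
Let bl (n : nat) : bool := if excluded_middle_informative (lam E (u n)) then true else false.
(** Labels alternate along a run, so a single class could not be inserted between neighbours. Two
    can: first one with the label of [u (S n)], then one with that of [u n]. *)
Let lb (n : nat) (c : bool) : bool := if c then bl (S n) else bl n.
Let lvl (j : nat) (p : vert) : Prop := match p with
  | inl v => exists n, j = 3 * n /\ near (u n) v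
  | inr (n, i) => j = 3 * n + 1 + min i 1 end.

Lemma bl_lam n : bl n = true <-> lam E (u n).
Proof. unfold bl; destruct (excluded_middle_informative (lam E (u n))); split; intros; auto; try discriminate; contradiction. Qed.
Lemma low_run n m v : near (u m) v -> (low n v <-> if d then m <= n else n < m).
Proof.
  intros H. pose proof (run_olt n m (u n) v (near_refl _) H) as A.
  pose proof (run_olt m n v (u n) H (near_refl _)) as B.
  unfold low, ord in *. destruct d; rewrite ?A, ?B; lia.
Qed.

Lemma run_lab j p : lvl j p -> (vlab E lb p <->
  if j mod 3 =? 1 then lam E (u (S (j / 3))) else lam E (u (j / 3))).
Proof.
  pose proof (Nat.div_mod j 3 ltac:(lia)). pose proof (Nat.mod_upper_bound j 3 ltac:(lia)).
  destruct p as [v|[n i]]; simpl vlab; intros H'.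
  - destruct H' as [n [Q H']]. assert (j / 3 = n /\ j mod 3 = 0) as [-> ->] by lia.
    symmetry. apply near_lab; auto.
  - unfold lvl in H'. assert (j / 3 = n /\ j mod 3 = 1 + min i 1) as [-> ->] by lia.
    unfold nlab; simpl fst; simpl snd. destruct i as [|i]; simpl; apply bl_lam.
Qed.

Lemma lvl_vlt j k p q : lvl j p -> lvl k q -> (vlt E d low p q <-> ord j k).
Proof.
  destruct p as [v|[n i]], q as [w|[m k']]; simpl; intros Hp Hq.
  - destruct Hp as [n [-> Hp]], Hq as [m [-> Hq]]. rewrite (run_olt n m v w); auto.
    unfold ord; destruct d; lia.
  - destruct Hp as [n [-> Hp]]. subst k. rewrite (low_run m n v Hp). unfold ord; destruct d; lia.
  - destruct Hq as [m [-> Hq]]. subst j. rewrite (low_run n m w Hq). unfold ord; destruct d; lia.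
  - subst j k. unfold nlt, key, ord; simpl fst; simpl snd; destruct d; lia.
Qed.

Lemma lvl_between j p q r : lvl j p -> lvl (S j) q -> flip d (vlt E d low) p r -> flip d (vlt E d low) r q -> False.
Proof.
  intros Lp Lq H1 H2.
  assert (K : (exists k, lvl k r) \/ exists v, r = inl v /\ ~ S0 v).
  { destruct r as [v|[n i]]; [|left; eexists; reflexivity].
    destruct (classic (S0 v)) as [[n Hn]|N]; [left; exists (3 * n), n; auto|right; eauto]. }
  destruct K as [[k Lk]|[v [-> Nv]]].
  - unfold flip in *. pose proof (lvl_vlt j k p r Lp Lk). pose proof (lvl_vlt k j r p Lk Lp).
    pose proof (lvl_vlt k (S j) r q Lk Lq). pose proof (lvl_vlt (S j) k q r Lq Lk). unfold ord in *.
    destruct d; intuition lia.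
  - destruct (run_convex v Nv) as [K|K].
    + assert (B : forall n, dir v (u n)).
      { intros [|n]; auto. eapply dir_trans; eauto. apply run_lt; lia. }
      clear H2. destruct p as [w|[n i]]; simpl in *.
      * destruct Lp as [n [_ Hn]]. specialize (B n).
        apply (dir_near v (u n) v w (near_refl v) Hn) in B.
        apply (dir_irr v). eapply dir_trans; [exact B|]. unfold dir; destruct d; auto.
      * specialize (B n). unfold low, dir in *. destruct d; simpl in H1.
        { apply H1. apply olt_asym; auto. }
        { eapply olt_asym; eauto. }
    + clear H1. destruct q as [w|[n i]]; simpl in *.
      * destruct Lq as [n [_ Hn]]. specialize (K n).
        apply (dir_near (u n) v w v Hn (near_refl v)) in K.
        apply (dir_irr v). eapply dir_trans; [|exact K]. unfold dir; destruct d; auto.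
      * specialize (K n). unfold low, dir in *. destruct d; simpl in H2; auto.
Qed.

Theorem run_family_recurrent : readable_family E.
Proof.
  (* Four positions per class: the old class, [(n, 0)], and the two copies separately. [src] names
     the class whose label is copied, hence [S (k / 4)] for [(n, 0)]; recurrence then yields
     strictly advancing targets [m k]. *)
  set (src := fun k => if k mod 4 =? 1 then S (k / 4) else k / 4).
  destruct (increasing_choice (fun k j => (lam E (u (src k)) <-> lam E (u j)) /\
     emb E (near (u (src k))) (near (u j)))) as [m [m_inc m_ok]].
  { intros k K. apply u_rec. }
  assert (G : exists g : nat -> nat -> nat, forall k v, near (u (src k)) v -> near (u (m k)) (g k v) /\
    forall w, near (u (src k)) w -> (g k v = g k w -> v = w) /\ (E v w <-> E (g k v) (g k w))).
  { apply (choice (fun k (f : nat -> nat) => forall v, near (u (src k)) v -> near (u (m k)) (f v) /\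
    forall w, near (u (src k)) w -> (f v = f w -> v = w) /\ (E v w <-> E (f v) (f w)))).
    intros k. destruct (m_ok k) as [_ [f Hf]]. exists f; auto. }
  destruct G as [g Hg].
  assert (X : exists ix : nat -> nat, forall v, S0 v -> near (u (ix v)) v).
  { apply (choice (fun v n => S0 v -> near (u n) v)). intros v.
    destruct (classic (S0 v)) as [[n Hn]|N]; [exists n; auto|exists 0; tauto]. }
  destruct X as [ix Hix].
  set (pos := fun p : vert => match p with inl v => 4 * ix v | inr (n, i) => 4 * n + 1 + min i 2 end).
  set (h := fun p : vert => match p with inl v => g (pos p) v | inr _ => u (m (pos p)) end).
  assert (SRC : forall n, src (4 * n) = n /\ src (4 * n + 1) = S n /\ src (4 * n + 2) = n /\ src (4 * n + 3) = n).
  { intros n. unfold src.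
    assert (A : forall r, r < 4 -> (4 * n + r) / 4 = n /\ (4 * n + r) mod 4 = r).
    { intros r Hr. replace (4 * n + r) with (r + n * 4) by lia. rewrite Nat.div_add, Nat.Div0.mod_add by lia.
      rewrite Nat.div_small, Nat.mod_small by auto. auto. }
    destruct (A 0) as [A0 B0]; [lia|]. destruct (A 1) as [A1 B1]; [lia|].
    destruct (A 2) as [A2 B2]; [lia|]. destruct (A 3) as [A3 B3]; [lia|].
    rewrite Nat.add_0_r in A0, B0. rewrite A0, B0, A1, B1, A2, B2, A3, B3. auto. }
  set (lv := fun p : vert => match p with inl v => 3 * ix v | inr (n, i) => 3 * n + 1 + min i 1 end).
  assert (LV : forall p, moved S0 p -> lvl (lv p) p).
  { intros [v|[n i]] Mp; simpl; auto. exists (ix v); auto. }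
  assert (POS : forall p, moved S0 p -> near (u (m (pos p))) (h p) /\ (vlab E lb p <-> lam E (h p))).
  { intros p Mp. assert (A : near (u (m (pos p))) (h p)).
    { destruct p as [v|[n i]]; [|apply near_refl]. apply Hg. unfold pos. rewrite (proj1 (SRC _)). auto. }
    split; auto. rewrite <- (near_lab _ _ A), <- (proj1 (m_ok (pos p))).
    destruct p as [v|[n i]]; simpl vlab; unfold pos.
    - rewrite (proj1 (SRC _)). symmetry; apply near_lab; auto.
    - unfold nlab; simpl fst; simpl snd. unfold lb. destruct (SRC n) as [_ [B1 [B2 B3]]].
      destruct i as [|[|i]]; simpl Nat.eqb.
      + replace (4 * n + 1 + min 0 2) with (4 * n + 1) by lia. rewrite B1. apply bl_lam.
      + replace (4 * n + 1 + min 1 2) with (4 * n + 2) by lia. rewrite B2. apply bl_lam.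
      + replace (4 * n + 1 + min (S (S i)) 2) with (4 * n + 3) by lia. rewrite B3. apply bl_lam. }
  assert (low_b : forall n, low n 0).
  { intros n. unfold low; destruct d; [|apply olt_base; auto]. intros K; apply (olt_nonzero _ _ _ K); auto. }
  assert (low_d : forall n v w, low n v -> ~ v << w -> low n w).
  { intros n v w. unfold low; destruct d; intros H1 H2.
    - intros K. destruct (NG _ v _ K); auto.
    - eapply olt_le_l; eauto. }
  assert (low_k : forall n m v, (if d then n <= m else m <= n) -> low n v -> low m v).
  { intros n k v L. destruct (Nat.eq_dec n k) as [->|N]; auto. unfold low.
    pose proof (run_lt n k) as R1. pose proof (run_lt k n) as R2. unfold dir in *.
    destruct d; intros H; [intros K; apply H; eapply TR; [apply R1; lia|auto]|].
    eapply TR; [exact H|apply R2; lia]. }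
  apply (insert_family E E_sym E_irr no_P4 d low lb low_b low_d low_k
    lvl (fun n => 3 * n + 2) (inl (u 0))) with (S0 := S0) (h := h).
  - split; [exists 0; split; auto; apply near_refl|]. intros s; exact I.
  - intros j. pose proof (Nat.div_mod j 3 ltac:(lia)) as Q. pose proof (Nat.mod_upper_bound j 3 ltac:(lia)).
    assert (j mod 3 = 0 \/ j mod 3 = 1 \/ j mod 3 = 2) as [R|[R|R]] by lia; rewrite R in Q.
    + exists (inl (u (j / 3))). split; [exists (j / 3); split; [lia|apply near_refl]|intros; exact I].
    + exists (inr (j / 3, 0)). split; [unfold lvl; lia|intros; simpl; auto].
    + exists (inr (j / 3, 1)). split; [unfold lvl; lia|intros; simpl; auto].
  - intros j p Lp ->. destruct Lp as [n [_ [_ K]]]. apply K, olt_base; auto.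
  - intros j p q Lp Lq. split; [|intros r [R1 R2]; exact (lvl_between j p q r Lp Lq R1 R2)].
    pose proof (lvl_vlt _ _ _ _ Lp Lq) as A. pose proof (lvl_vlt _ _ _ _ Lq Lp) as B.
    unfold flip, ord in *; destruct d; [apply A|apply B]; lia.
  - intros j p q Lp Lq. rewrite (run_lab _ _ Lp), (run_lab _ _ Lq).
    pose proof (Nat.div_mod j 3 ltac:(lia)) as Q. pose proof (Nat.mod_upper_bound j 3 ltac:(lia)).
    pose proof (Nat.div_mod (S j) 3 ltac:(lia)) as Q'. pose proof (Nat.mod_upper_bound (S j) 3 ltac:(lia)).
    pose proof (run_alt (j / 3)) as AL.
    assert (j mod 3 = 0 \/ j mod 3 = 1 \/ j mod 3 = 2) as [R|[R|R]] by lia.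
    + assert (S j mod 3 = 1 /\ S j / 3 = j / 3) as [-> ->] by lia. rewrite R. exact AL.
    + assert (S j mod 3 = 2 /\ S j / 3 = j / 3) as [-> ->] by lia. rewrite R. simpl.
      destruct (classic (lam E (u (j / 3)))); tauto.
    + assert (S j mod 3 = 0 /\ S j / 3 = S (j / 3)) as [-> ->] by lia. rewrite R. exact AL.
  - intros j p r Lp N1 N2.
    assert (K : (exists k, lvl k r) \/ exists v, r = inl v /\ ~ S0 v).
    { destruct r as [v|[n i]]; [|left; eexists; reflexivity].
      destruct (classic (S0 v)) as [[n Hn]|N]; [left; exists (3 * n), n; auto|right; eauto]. }
    destruct K as [[k Lk]|[v [-> Nv]]].
    + rewrite (lvl_vlt _ _ _ _ Lp Lk) in N1. rewrite (lvl_vlt _ _ _ _ Lk Lp) in N2.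
      replace (S j) with k; auto. unfold ord in *; destruct d; lia.
    + exfalso. destruct p as [w|q]; simpl in N1, N2; [|tauto].
      apply Nv. destruct Lp as [n [_ Hn]]. exists n. destruct Hn.
      split; intros K.
      * apply N1. apply olt_le_l with (u n); auto.
      * apply N2. apply olt_le_r with (u n); auto.
  - intros n i. simpl. lia.
  - intros n [v|[k [|i]]] H; simpl in H; [destruct H as [? [? _]]; lia|lia|]. exists i.
    assert (k = n) by lia. congruence.
  - intros n. exists (3 * n + 1); lia.
  - intros [n i]. exists (3 * n + 1 + min i 1). split; [reflexivity|lia].
  - intros v Nv. assert (A : forall z, S0 z -> exists n, near (u n) z) by auto.
    destruct (run_convex v Nv) as [K|K].
    + assert (B : forall n, dir v (u n)).
      { intros [|n]; auto. eapply dir_trans; eauto. apply run_lt; lia. }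
      unfold dir in B; unfold low. destruct d.
      * left; split; [intros z [n Hn]; eapply near_olt; [apply near_refl| |apply (B n)]; destruct Hn; split; auto|].
        intros n; apply olt_asym; auto.
      * right; split; [intros z [n Hn]; eapply near_olt; [|apply near_refl|apply (B n)]; destruct Hn; split; auto|].
        intros n; apply olt_asym; auto.
    + unfold dir in K; unfold low. destruct d.
      * right; split; [intros z [n Hn]; eapply near_olt; [|apply near_refl|apply (K n)]; destruct Hn; split; auto|].
        intros n H; apply H; auto.
      * left; split; [intros z [n Hn]; eapply near_olt; [apply near_refl| |apply (K n)]; destruct Hn; split; auto|auto].
  - intros p Mp. exists (m (pos p)). apply POS; auto.
  - intros p Mp. apply POS; auto.
  - assert (LT : forall s p q, carrier s p -> carrier s q -> moved S0 p -> moved S0 q -> pos p < pos q ->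
      h p <> h q /\ (vedge E d low lb p q <-> E (h p) (h q))).
    { intros s p q Cp Cq Mp Mq L. destruct (POS p Mp) as [P1 P2]. destruct (POS q Mq) as [Q1 Q2].
      pose proof (m_inc _ _ L) as L'.
      pose proof (run_olt _ _ _ _ P1 Q1) as A. pose proof (run_olt _ _ _ _ Q1 P1) as B.
      split; [intros K; rewrite K in A; pose proof (IR (h q)); rewrite K in B; unfold ord in *; destruct d; tauto|].
      (* One level holds different positions only for the two copies, whose adjacency is their
         common label. *)
      destruct (Nat.eq_dec (lv p) (lv q)) as [Ql|Ql].
      - destruct p as [v|[n i]], q as [w|[k j]]; simpl in L, Ql; try lia.
        assert (n = k) by lia. subst k.
        assert (i <> 0 /\ j <> 0 /\ i <> j) as [Ni [Nj Nij]] by lia.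
        assert (nlab lb (n, i) = nlab lb (n, j)) as LE.
        { unfold nlab; simpl fst; simpl snd. destruct i, j; try lia; reflexivity. }
        simpl in P2, Q2. simpl vedge. rewrite LE in *.
        transitivity (nlab lb (n, j) = true).
        { split; [tauto|]. intros K; split; [congruence|]. tauto. }
        unfold ord in *; destruct d.
        + rewrite Q2. symmetry; apply ADJ, A; lia.
        + rewrite P2, (E_comm E E_sym (h (inr (n, i)))). symmetry; apply ADJ, B; lia.
      - assert (lv p < lv q).
        { destruct p as [v|[n i]], q as [w|[k j]]; simpl in *; lia. }
        pose proof (lvl_vlt _ _ _ _ (LV p Mp) (LV q Mq)) as A'. pose proof (lvl_vlt _ _ _ _ (LV q Mq) (LV p Mp)) as B'.
        assert ((vlt E d low p q /\ h p << h q) \/ (vlt E d low q p /\ h q << h p)) as [[K1 K2]|[K1 K2]]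
          by (unfold ord in *; destruct d; tauto).
        + rewrite (vlt_adj E E_sym no_P4 d low lb low_k p q K1), (ADJ _ _ K2); auto.
        + assert (vedge E d low lb p q <-> vedge E d low lb q p) as -> by (split; apply vedge_sym; auto).
          rewrite (E_comm E E_sym (h p)).
          rewrite (vlt_adj E E_sym no_P4 d low lb low_k q p K1), (ADJ _ _ K2); auto. }
    intros s p q Cp Cq Mp Mq. destruct (lt_eq_lt_dec (pos p) (pos q)) as [[L|L]|L].
    + destruct (LT s p q); auto. split; auto; tauto.
    + destruct p as [v|[n i]], q as [w|[k j]]; simpl in L; try lia.
      * assert (ix v = ix w) as Q by lia. unfold h. simpl pos. rewrite Q.
        destruct (Hg (4 * ix w) v) as [_ H]; [rewrite (proj1 (SRC _)), <- Q; auto|].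
        destruct (H w) as [H1 H2]; [rewrite (proj1 (SRC _)); auto|]. split; [intros K; f_equal; auto|auto].
      * simpl in Cp, Cq. assert (n = k /\ i = j) as [-> ->] by lia. split; auto.
        split; intros K; exfalso; [exact (vedge_irr E E_irr d low lb _ K)|exact (E_irr _ K)].
    + destruct (LT s q p) as [H1 H2]; auto. split; [intros K; exfalso; apply H1; auto|].
      rewrite (E_comm E E_sym), <- H2. split; apply vedge_sym; auto.
  - intros n c. destruct (above_labels (u n) c) as [v [H1 H2]]. exists v; split; auto.
    unfold low; destruct d; [tauto|]. apply olt_asym; auto.
Qed.
End Run.

(** Past some point the leaf codes recur, which yields equal labels and embeddings of the classes; a
    final part of a run is again a run. *)
Lemma run_family (d : bool) (u : nat -> nat) : (forall n, u n <> 0) ->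
  (forall n, if d then cov (u n) (u (S n)) else cov (u (S n)) (u n)) -> readable_family E.
Proof.
  intros u_pos u_cov.
  destruct (choice (fun n c => tame_code E c (near (u n)))) as [tc Htc].
  { intros n. apply all_tame, near_module. }
  set (bl := fun n => if excluded_middle_informative (lam E (u n)) then true else false).
  assert (BL : forall n, lam E (u n) <-> bl n = true).
  { intros n. unfold bl; destruct (excluded_middle_informative (lam E (u n))); split; intros; auto; try discriminate; contradiction. }
  destruct (wqo_recurrent E NoStar NoStar_mono (fun n => Leaf (bl n) (tc n))) as [N HN].
  apply (run_family_recurrent d (fun n => u (N + n))).
  - intros n; apply u_pos.
  - intros n. replace (N + S n) with (S (N + n)) by lia. apply u_cov.
  - intros n K. destruct (HN (N + n) ltac:(lia) (N + K)) as [m [Lm H]].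
    exists (m - N). split; [lia|]. replace (N + (m - N)) with m by lia.
    destruct (H (near (u m)) (lam E)) as [T [l [H1 [H2 H3]]]].
    { destruct (Htc m) as [[l Hl] _]. exists (near (u m)), l. splits; auto; [apply subset_refl|].
      intros v Hv. rewrite <- BL. symmetry. apply near_lab; auto. }
    destruct (proj2 (Htc (N + n)) T) as [f Hf]; [exists l; auto|]. split.
    + destruct (Hf (u (N + n)) (near_refl _)) as [K1 _]. rewrite BL, <- (H2 _ K1).
      symmetry. apply near_lab; auto.
    + exists f. intros v Hv. destruct (Hf v Hv); split; auto.
Qed.

(** * Intervals without extremal jumps *)

Definition nosucc (u : nat) : Prop := forall w, ~ cov u w.
(** The base vertex does not count, since a run has to avoid it. *)
Definition nopred (v : nat) : Prop := forall w, w <> 0 -> ~ cov w v.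

Lemma orbit_run (A : set) (step : nat -> nat -> Prop) w :
  A w -> (forall x, A x -> exists y, step x y /\ A y) ->
  exists u : nat -> nat, forall n, A (u n) /\ step (u n) (u (S n)).
Proof.
  intros Hw HS. destruct (choice (fun x y => A x -> step x y /\ A y)) as [f Hf].
  { intros x. destruct (classic (A x)) as [K|K]; [destruct (HS x K) as [y Hy]; eauto|exists 0; tauto]. }
  exists (fun n => Nat.iter n f w).
  assert (B : forall n, A (Nat.iter n f w)) by (induction n; simpl; auto; apply Hf; auto).
  intros n; split; auto. simpl. apply Hf; auto.
Qed.

Section NoRun.
Hypothesis no_family : ~ readable_family E.

(** Climbing by successors halts, as otherwise it would trace a run. Every vertex passed has a
    predecessor, so one without must lie beyond the halt. *)
Lemma up_stop w : w <> 0 -> exists w', ~ w' << w /\ nosucc w' /\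
  forall z, w << z -> ~ w' << z -> exists y, y <> 0 /\ cov y z.
Proof.
  intros Nw. apply NNPP; intros N.
  destruct (orbit_run (fun x => ~ x << w /\ forall z, w << z -> ~ x << z -> exists y, y <> 0 /\ cov y z) cov w)
    as [u Hu].
  - split; [apply IR|]. intros z; tauto.
  - intros x [H1 H2].
    assert (exists y, cov x y) as [y Hy].
    { apply NNPP; intros K. apply N; exists x; splits; auto. intros y Hy; eauto. }
    exists y; split; auto. destruct Hy as [Y1 Y2]. split.
    + intros K. apply H1. eapply TR; eauto.
    + intros z Z1 Z2. destruct (classic (x << z)) as [Z|Z]; auto.
      exists x. split; [intros ->; apply H1, olt_base; auto|]. split; auto.
      intros r [R1 R2]. apply (Y2 r); split; auto. apply olt_le_r with z; auto.
  - apply no_family. apply (run_family true u).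
    + intros n K. destruct (Hu n) as [[H _] _]. apply H. rewrite K. apply olt_base; auto.
    + intros n; apply Hu.
Qed.

Lemma down_stop w : w <> 0 -> exists w', ~ w << w' /\ w' <> 0 /\ nopred w' /\
  forall z, ~ z << w' -> z << w -> exists y, cov z y.
Proof.
  intros Nw. apply NNPP; intros N.
  destruct (orbit_run (fun x => ~ w << x /\ x <> 0 /\ forall z, ~ z << x -> z << w -> exists y, cov z y)
    (fun x y => cov y x) w) as [u Hu].
  - splits; auto. intros z Z1 Z2; contradiction.
  - intros x [H1 [H2 H3]].
    assert (exists y, y <> 0 /\ cov y x) as [y [Ny [Y1 Y2]]].
    { apply NNPP; intros K. apply N; exists x; splits; auto. intros y Ny Hy; eauto. }
    exists y; split; [split; auto|]. splits; auto.
    + intros K. apply H1. eapply TR; eauto.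
    + intros z Z1 Z2. destruct (classic (z << x)) as [Z|Z]; auto.
      exists x. split; auto. intros r [R1 R2]. apply (Y2 r); split; auto. apply olt_le_l with z; auto.
  - apply no_family. apply (run_family false u).
    + intros n; apply Hu.
    + intros n; apply Hu.
Qed.

Definition gap (u v : nat) : Prop := u <> 0 /\ u << v /\ nosucc u /\ nopred v.
Definition between (u v : nat) : set := fun w => u << w /\ w << v.

Lemma gap_exists : exists u v, gap u v.
Proof.
  destruct (up_stop 1) as [u [U1 [U2 _]]]; [lia|].
  destruct (no_top u) as [w Hw].
  destruct (down_stop w) as [v [V1 [V2 [V3 V4]]]]; [eapply olt_nonzero; eauto|].
  exists u, v. rsplits; auto.
  - intros ->. apply U1, olt_base; lia.
  - apply NNPP; intros K. destruct (V4 u K Hw) as [y Hy]. apply (U2 y Hy).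
Qed.

(** Descend from an interior vertex to a halt [w1], then climb to a halt [w2]. The descent cannot
    pass [u], which has no successor, nor the climb [v], which has no predecessor. *)
Lemma gap_split u v : gap u v -> exists w1 w2, gap u w1 /\ gap w2 v /\ ~ w2 << w1.
Proof.
  intros [N [L [NS NP]]].
  assert (exists w, u << w /\ w << v) as [w [W1 W2]].
  { apply NNPP; intros K. apply (NS v). split; auto. intros r Hr; eauto. }
  destruct (down_stop w) as [w1 [A1 [A2 [A3 A4]]]]; [eapply olt_nonzero; eauto|].
  destruct (up_stop w1 A2) as [w2 [B1 [B2 B3]]].
  exists w1, w2. splits; [rsplits; auto|rsplits; auto|auto].
  - apply NNPP; intros K. destruct (A4 u K W1) as [y Hy]. apply (NS y Hy).
  - intros ->. apply B1, olt_base; auto.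
  - apply NNPP; intros K. destruct (B3 v) as [y [Ny Hy]]; auto; [|apply (NP y Ny Hy)].
    apply olt_le_l with w; auto.
Qed.

Lemma gap_labels u v (c : bool) : gap u v -> exists w, between u v w /\ (lam E w <-> c = true).
Proof.
  intros [N [L [NS NP]]].
  assert (X : forall v, u << v -> exists w, u << w /\ w << v).
  { intros v' L'. apply NNPP; intros K. apply (NS v'). split; auto. intros r Hr; eauto. }
  destruct (X v L) as [w [W1 W2]]. destruct (X w W1) as [w' [W3 W4]].
  destruct (classic (lam E w <-> c = true)) as [Q|Q]; [exists w; split; auto; split; auto|].
  destruct (classic (lam E w' <-> c = true)) as [Q'|Q']; [exists w'; split; auto; split; eauto|].
  destruct (olt_alt E w' w W4) as [z [Z1 [Z2 Z3]]]; [eapply olt_nonzero; eauto|tauto|].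
  exists z; split; [split; eauto|]. destruct (classic (c = true)); tauto.
Qed.

Lemma between_code u v : exists c, Real E NoStar c (between u v) (lam E) /\
  forall S' lam', Real E NoStar c S' lam' -> lemb E (lam E) (between u v) lam' S'.
Proof.
  set (D := between u v). set (lt := fun x y => D x /\ D y /\ x << y).
  assert (CL : forall x y, D x -> near x y -> D y).
  { intros x y [K1 K2] [K3 K4]; split; [apply olt_le_r with x; auto|apply olt_le_l with x; auto]. }
  apply (chain_tame_code E E_sym D lt (lam E)).
  - constructor.
    + intros x y [? [? _]]; auto.
    + intros x [_ [_ K]]. apply (IR x K).
    + intros x y z [K1 [_ K2]] [_ [K3 K4]]. rsplits; eauto.
    + intros x y z [K1 [K2 K3]] Dy. destruct (NG x y z K3); [left|right]; rsplits; auto.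
    + intros x y [_ [_ K]]; auto.
    + intros x y [K1 [K2 K3]] [_ [_ K4]]. apply LAB; intros K; [apply K4|apply K3]; rsplits; auto.
  - intros x Dx. replace (cls D lt x) with (near x); [apply all_tame, near_module|].
    apply set_ext; intros y; split.
    + intros Ny. assert (D y) by eauto. destruct Ny. split; rsplits; auto; intros [_ [_ K]]; auto.
    + intros [[_ [Dy K1]] [_ [_ K2]]]. split; intros K; [apply K2|apply K1]; rsplits; auto.
Qed.

(** In a gap realising as few codes as possible both parts realise the code of the whole, and that
    code forces a label-preserving copy. *)
Lemma minimal_gap : exists u v w1 w2, gap u v /\ gap u w1 /\ gap w2 v /\ ~ w2 << w1 /\
  lemb E (lam E) (between u v) (lam E) (between u w1) /\
  lemb E (lam E) (between u v) (lam E) (between w2 v).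
Proof.
  destruct gap_exists as [u0 [v0 H0]].
  set (P := {p : nat * nat | gap (fst p) (snd p)}).
  set (J := fun p : P => between (fst (proj1_sig p)) (snd (proj1_sig p))).
  destruct (minimal_codes E NoStar NoStar_mono (fun p q => subset (J p) (J q))
    (fun p c => Real E NoStar c (J p) (lam E)) (exist _ (u0, v0) H0)) as [[[u v] Huv] [_ M]].
  - intros p; apply subset_refl.
  - intros p q r; apply subset_trans.
  - intros p q c; apply Real_mono, NoStar_mono.
  - intros p c c' L; apply L.
  - simpl in Huv. destruct (gap_split u v Huv) as [w1 [w2 [G1 [G2 L]]]].
    destruct (between_code u v) as [c [R1 R2]].
    pose proof Huv as [_ [Luv _]]. pose proof G1 as [_ [L1 _]]. pose proof G2 as [_ [L2 _]].
    exists u, v, w1, w2; splits; auto; apply R2.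
    + apply (M (exist _ (u, w1) G1)); auto. intros x [X1 X2]; split; auto. simpl in *.
      eapply TR; [exact X2|]. apply olt_le_l with w2; auto.
    + apply (M (exist _ (w2, v) G2)); auto. intros x [X1 X2]; split; auto. simpl in *.
      eapply TR; [|exact X1]. apply olt_le_r with w1; auto.
Qed.

(** The new classes ascend just below [v] with alternating labels. One half of the gap receives its
    old vertices, the other half the new ones. *)
Lemma no_family_absurd : False.
Proof.
  destruct minimal_gap as [u [v [w1 [w2 [G [G1 [G2 [LW [[a Ha] [b Hb]]]]]]]]]].
  set (S0 := between u v) in *.
  pose proof G as [Nu [Luv [NS NP]]]. pose proof G1 as [_ [L1 _]]. pose proof G2 as [_ [L2 _]].
  assert (Sa : forall x, S0 x -> S0 (a x)).
  { intros x Sx. destruct (Ha x Sx) as [[X1 X2] _]. split; auto. eapply TR; [exact X2|].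
    apply olt_le_l with w2; auto. }
  assert (Sb : forall x, S0 x -> S0 (b x)).
  { intros x Sx. destruct (Hb x Sx) as [[X1 X2] _]. split; auto. eapply TR; [|exact X1].
    apply olt_le_r with w1; auto. }
  assert (AB : forall x y, S0 x -> S0 y -> a x << b y).
  { intros x y Sx Sy. destruct (Ha x Sx) as [[_ X1] _]. destruct (Hb y Sy) as [[Y1 _] _].
    eapply TR; [exact X1|]. apply olt_le_l with w2; auto. }
  destruct (choice (fun c w => between u v w /\ (lam E w <-> c = true))) as [pt Hpt].
  { intros c; apply gap_labels; auto. }
  fold S0 in Hpt.
  set (bb := fun k x => Nat.iter k b x).
  assert (BB : forall k x, S0 x -> S0 (bb k x) /\ (lam E x <-> lam E (bb k x)) /\
    forall y, S0 y -> (bb k x = bb k y -> x = y) /\ (E x y <-> E (bb k x) (bb k y))).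
  { induction k as [|k IH]; intros x Sx; simpl.
    - splits; auto; tauto.
    - destruct (IH x Sx) as [I1 [I2 I3]]. destruct (Hb _ I1) as [_ [B2 B3]]. splits; auto.
      + rewrite I2; auto.
      + intros y Sy. destruct (I3 y Sy) as [K1 K2]. destruct (IH y Sy) as [J1 _].
        destruct (B3 _ J1) as [K3 K4]. split; auto. rewrite K2; auto. }
  set (pos := fun q : nat * nat => 3 * fst q + min (snd q) 2).
  set (lb := fun (_ : nat) (c : bool) => c).
  (* Values of [a] precede values of [b]. So applying [b] more often to points of the [a] side,
     chosen with the right label, gives vertices joined as in an ascending sequence above all of
     [a]. *)
  set (nw := fun q => bb (S (pos q)) (a (pt (nlab lb q)))).
  assert (PT : forall q, S0 (a (pt (nlab lb q))) /\ (lam E (a (pt (nlab lb q))) <-> nlab lb q = true)).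
  { intros q. destruct (Hpt (nlab lb q)) as [K1 K2]. split; auto.
    rewrite <- (proj1 (proj2 (Ha _ K1))). auto. }
  assert (NW : forall q, S0 (nw q) /\ (nlab lb q = true <-> lam E (nw q))).
  { intros q. destruct (PT q) as [K1 K2]. destruct (BB (S (pos q)) _ K1) as [B1 [B2 _]].
    split; auto. rewrite <- K2; auto. }
  assert (ANW : forall x q k, S0 x -> a x << bb (S k) (a (pt (nlab lb q)))).
  { intros x q k Sx. simpl. apply AB; auto. apply BB, PT. }
  set (low := fun (_ : nat) (w : nat) => w << v).
  assert (low_b : forall n, low n 0) by (intros n; apply olt_base; eapply olt_nonzero; eauto).
  assert (low_d : forall n x w, low n x -> ~ x << w -> low n w).
  { intros n x w H1 H2. apply olt_le_l with x; auto. }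
  assert (low_k : forall n m x, n <= m -> low n x -> low m x) by (intros; auto).
  apply no_family. apply (insert_family E E_sym E_irr no_P4 true low lb low_b low_d low_k
    (fun j p => match p with inl _ => False | inr q => j = key q end) (fun n => 2 * n + 1) (inr (0, 0)))
    with (S0 := S0) (h := fun p => match p with inl w => a w | inr q => nw q end).
  - split; [reflexivity|]. intros s; simpl; auto.
  - intros j. destruct (Nat.Even_or_Odd j) as [[n ->]|[n ->]].
    + exists (inr (n, 0)). unfold key; simpl; split; auto; lia.
    + exists (inr (n, 1)). unfold key; simpl; split; auto; lia.
  - intros j [x|q] H; [contradiction|discriminate].
  - intros j [x|p] [y|q] Hp Hq; try contradiction. split; [simpl; lia|].
    intros [z|r]; simpl; [tauto|]. lia.
  - intros j [x|[n i]] [y|[m k]] Hp Hq; try contradiction. simpl. unfold nlab, lb; simpl.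
    unfold key in *; simpl fst in *; simpl snd in *. destruct i, k; simpl; try lia; split; intros; try tauto; try congruence.
  - intros j [x|p] [y|q] Hp N1 N2; try contradiction; simpl in *; lia.
  - intros n i. unfold key; simpl; lia.
  - intros n [x|[m i]] H; [contradiction|]. unfold key in H; simpl fst in H; simpl snd in H.
    destruct i as [|i]; [lia|]. exists i. assert (m = n) by lia. congruence.
  - intros n; exists (2 * n); lia.
  (* Below the first new class the separating vertex must be old; it exists because [v] has no
     predecessor. *)
  - intros q. exists (key q). split; auto. intros _; split; auto. intros x Nx Lx _.
    assert (exists y, x << y /\ y << v) as [y [Y1 Y2]].
    { apply NNPP; intros K. apply (NP x Nx). split; auto. intros r Hr; eauto. }
    destruct (classic (lam E x <-> lam E y)) as [Q|Q]; [|exists y; splits; auto; tauto].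
    destruct (olt_alt E x y Y1 Nx Q) as [z [Z1 [Z2 Z3]]]. exists z; splits; auto. unfold low; eauto.
  - intros x Nx. destruct (classic (u << x)) as [K|K].
    + right. assert (~ x << v) by (intros K'; apply Nx; split; auto). split; auto.
      intros z [_ Z]. apply olt_le_r with v; auto.
    + left. split; [intros z [Z _]; apply olt_le_l with u; auto|]. intros n; apply olt_le_l with u; auto.
  - intros [x|q] M; [apply Sa; auto|apply NW].
  - intros [x|q] M; simpl; [apply (Ha x M)|apply NW].
  - assert (XN : forall x q, S0 x -> a x <> nw q /\ (vedge E true low lb (inl x) (inr q) <-> E (a x) (nw q))).
    { intros x q Sx. pose proof (ANW x q (pos q) Sx) as K. fold (nw q) in K. split.
      - intros Q. rewrite <- Q in K. apply (IR _ K).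
      - rewrite (ADJ _ _ K), <- (proj2 (NW q)). simpl.
        assert (low (fst q) x) by apply Sx. tauto. }
    assert (NN : forall p q, pos p < pos q -> nw p <> nw q /\
      (vedge E true low lb (inr p) (inr q) <-> E (nw p) (nw q))).
    { intros p q L.
      assert (Q : nw q = bb (S (pos p)) (bb (S (pos q - pos p - 1)) (a (pt (nlab lb q))))).
      { unfold nw, bb. rewrite <- Nat.iter_add. f_equal. lia. }
      destruct (PT p) as [P1 _]. destruct (PT q) as [Q1 _].
      destruct (BB (S (pos q - pos p - 1)) _ Q1) as [Q2 [Q3 _]].
      destruct (BB (S (pos p)) _ P1) as [_ [_ B]]. destruct (B _ Q2) as [B1 B2].
      pose proof (ANW (pt (nlab lb p)) q (pos q - pos p - 1) (proj1 (Hpt _))) as K.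
      rewrite Q. split.
      - intros K'. apply B1 in K'. rewrite K' in K at 1. apply (IR _ K).
      - unfold nw at 1. rewrite <- B2, (ADJ _ _ K), <- Q3, (proj2 (PT q)).
        destruct p as [n i], q as [m k]; unfold pos in L; simpl fst in L; simpl snd in L.
        simpl vedge. unfold nlt, key, nlab, lb; simpl fst; simpl snd.
        split.
        + intros [_ [[_ ?]|[N ?]]]; auto. destruct k as [|k]; auto. destruct i; [lia|discriminate].
        + intros Hk. split; [intros K'; inversion K'; subst; lia|].
          destruct k; [|discriminate]. left; split; auto. destruct i; simpl; lia. }
    intros s [x|p] [y|q] Cp Cq Mp Mq.
    + destruct (Ha x Mp) as [_ [_ H]]. destruct (H y Mq) as [H1 H2]. split; [intros; f_equal; auto|auto].
    + destruct (XN x q Mp) as [K1 K2]. split; auto. intros; contradiction.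
    + destruct (XN y p Mq) as [K1 K2]. split; [intros Q; exfalso; apply K1; auto|].
      rewrite (E_comm E E_sym (nw p)), <- K2. split; apply vedge_sym; auto.
    + destruct (lt_eq_lt_dec (pos p) (pos q)) as [[L|L]|L].
      * destruct (NN p q L) as [K1 K2]. split; auto. intros; contradiction.
      * destruct p as [n i], q as [m k]; simpl in Cp, Cq; unfold pos in L; simpl fst in L; simpl snd in L.
        assert (n = m /\ i = k) as [-> ->] by lia. split; auto.
        split; intros K; exfalso; [exact (vedge_irr E E_irr true low lb _ K)|exact (E_irr _ K)].
      * destruct (NN q p L) as [K1 K2]. split; [intros Q; exfalso; apply K1; auto|].
        rewrite (E_comm E E_sym (nw p)), <- K2. split; apply vedge_sym; auto.
  - intros n c. destruct (above_labels v c) as [x [H1 H2]]. exists x; split; auto. apply olt_asym; auto.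
Qed.
End NoRun.

Theorem tame_family : readable_family E.
Proof. apply NNPP; exact no_family_absurd. Qed.
End TameModules.

(** * From marked graphs to isomorphism types *)

Lemma enumerate_infinite (X : set) : infinite X -> exists e : nat -> nat,
  (forall n, X (e n)) /\ (forall n m, e n = e m -> n = m) /\ forall x, X x -> exists n, e n = x.
Proof.
  intros HX.
  destruct (choice (fun k m => (k <= m /\ X m) /\ forall i, k <= i /\ X i -> m <= i)) as [next Hn].
  { intros k. apply (least_exists (fun m => k <= m /\ X m)), HX. }
  set (e := fix e n := match n with 0 => next 0 | S n => next (S (e n)) end).
  assert (ES : forall n, e n < e (S n)) by (intros n; simpl; destruct (Hn (S (e n))) as [[? _] _]; lia).
  assert (EM : forall n m, n < m -> e n < e m).
  { intros n m L; induction L; [apply ES|]. specialize (ES m). lia. }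
  assert (EG : forall n, n <= e n) by (induction n as [|n IH]; [lia|]; specialize (ES n); lia).
  exists e; splits.
  - intros [|n]; apply Hn.
  - intros n m Q. destruct (lt_eq_lt_dec n m) as [[L|L]|L]; auto; apply EM in L; lia.
  - assert (C : forall n x, X x -> x < e n -> exists m, e m = x).
    { induction n as [|n IH]; intros x Xx L.
      - destruct (Hn 0) as [_ K]. specialize (K x ltac:(split; auto; lia)). simpl in L. lia.
      - destruct (lt_eq_lt_dec x (e n)) as [[K|K]|K]; eauto.
        destruct (Hn (S (e n))) as [_ K']. specialize (K' x ltac:(split; auto)). simpl in L. lia. }
    intros x Xx. apply (C (S x)); auto.
Qed.

Lemma carrier_enum (P : vert -> Prop) : (forall u, P (inl u)) ->
  exists ab : (nat -> vert) * (vert -> nat), (forall n, P (fst ab n) /\ snd ab (fst ab n) = n) /\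
    forall p, P p -> fst ab (snd ab p) = p.
Proof.
  intros HP.
  set (cd := fun p : vert => match p with inl u => 2 * u | inr q => 2 * Cantor.to_nat q + 1 end).
  assert (CI : forall p q, cd p = cd q -> p = q).
  { intros [u|p] [v|q]; simpl; intros Q; try lia; f_equal; [lia|]. apply Cantor.to_nat_inj; lia. }
  destruct (enumerate_infinite (fun x => exists p, P p /\ cd p = x)) as [e [E1 [E2 E3]]].
  { intros n. exists (2 * n). split; [lia|]. exists (inl n); auto. }
  destruct (choice (fun n p => P p /\ cd p = e n)) as [al Hal]; [apply E1|].
  destruct (choice (fun p n => P p -> e n = cd p)) as [be Hbe].
  { intros p. destruct (classic (P p)) as [K|K]; [|exists 0; tauto].
    destruct (E3 (cd p)) as [n Hn]; eauto. }
  exists (al, be); simpl. split.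
  - intros n. destruct (Hal n) as [K1 K2]. split; auto. apply E2. rewrite (Hbe _ K1); auto.
  - intros p Pp. apply CI. rewrite (proj2 (Hal _)), Hbe; auto.
Qed.

Lemma clos_map {V W : Type} (R : V -> V -> Prop) (Q : W -> W -> Prop) (f : V -> W) :
  (forall x y, R x y -> Q (f x) (f y)) ->
  forall x y, clos_refl_trans V R x y -> clos_refl_trans W Q (f x) (f y).
Proof.
  intros H x y K; induction K; [apply rt_step; auto|apply rt_refl|eapply rt_trans; eauto].
Qed.

Lemma clos_cut {V : Type} (R : V -> V -> Prop) (A : V -> Prop) x y : clos_refl_trans V R x y ->
  A x -> ~ A y -> exists u w, A u /\ ~ A w /\ R u w.
Proof.
  intros K; induction K as [x y K|x|x y z K1 I1 K2 I2]; intros Ax Ay; [eauto|contradiction|].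
  destruct (classic (A y)); auto.
Qed.

Lemma connected_extend {V W : Type} (R : V -> V -> Prop) (Q : W -> W -> Prop) (f : V -> W) :
  connected R -> (forall x y, Q x y -> Q y x) -> (forall x y, R x y -> Q (f x) (f y)) ->
  (forall x, exists u, x = f u \/ Q x (f u)) -> connected Q.
Proof.
  intros [[v _] C] QS RQ OLD. split; [exists (f v); auto|].
  assert (B : forall x, exists u, clos_refl_trans W Q x (f u) /\ clos_refl_trans W Q (f u) x).
  { intros x. destruct (OLD x) as [u [->|H]]; exists u; split; try apply rt_refl; apply rt_step; auto. }
  intros x y. destruct (B x) as [u [U1 _]]. destruct (B y) as [w [_ W1]].
  eapply rt_trans; [exact U1|]. eapply rt_trans; [|exact W1]. eapply clos_map; eauto.
Qed.

Lemma complement_sym {V : Type} (E : V -> V -> Prop) : (forall x y, E x y -> E y x) ->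
  forall x y, complement E x y -> complement E y x.
Proof. intros H x y [K1 K2]; split; auto. Qed.

Lemma isomorphic_sym {V W : Type} (E : V -> V -> Prop) (F : W -> W -> Prop) : isomorphic E F -> isomorphic F E.
Proof. intros [f [g [H1 [H2 H3]]]]. exists g, f; splits; auto. intros x y. rewrite H3, !H2; tauto. Qed.
Lemma isomorphic_trans {U V W : Type} (D : U -> U -> Prop) (E : V -> V -> Prop) (F : W -> W -> Prop) :
  isomorphic D E -> isomorphic E F -> isomorphic D F.
Proof.
  intros [f [g [H1 [H2 H3]]]] [f' [g' [H1' [H2' H3']]]].
  exists (fun x => f' (f x)), (fun y => g (g' y)); splits; intros.
  - rewrite H1'; auto.
  - rewrite H2; auto.
  - rewrite H3; auto.
Qed.

(* The pointed structures are distinct, so each isomorphism class contains at most countably many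
   members; by Koenig's diagonal argument one of countably many transversals has full size. *)
Lemma nonisomorphic_subfamily (F : (nat -> bool) -> nat -> nat -> Prop) (a b : (nat -> bool) -> nat) :
  (forall s t f g, (forall x, g (f x) = x) -> (forall y, f (g y) = y) ->
     (forall x y, F s x y <-> F t (f x) (f y)) -> f (a s) = a t -> f (b s) = b t -> s = t) ->
  exists sg : (nat -> bool) -> nat -> bool, forall s t, s <> t -> ~ isomorphic (F (sg s)) (F (sg t)).
Proof.
  intros HP.
  set (rep := fun s => epsilon (inhabits (fun _ => false)) (fun t => isomorphic (F s) (F t))).
  assert (R1 : forall s, isomorphic (F s) (F (rep s))).
  { intros s. apply (epsilon_spec (inhabits (fun _ => false)) (fun t => isomorphic (F s) (F t))).
    exists s, (fun x => x), (fun x => x); splits; auto; tauto. }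
  assert (R2 : forall s t, isomorphic (F s) (F t) -> rep s = rep t).
  { intros s t H. unfold rep. f_equal. apply functional_extensionality; intros r.
    apply propositional_extensionality; split; intros K.
    - exact (isomorphic_trans _ _ _ (isomorphic_sym _ _ H) K).
    - exact (isomorphic_trans _ _ _ H K). }
  clearbody rep.
  destruct (choice (fun s (fg : (nat -> nat) * (nat -> nat)) =>
    (forall x, snd fg (fst fg x) = x) /\ (forall y, fst fg (snd fg y) = y) /\
    (forall x y, F s x y <-> F (rep s) (fst fg x) (fst fg y)))) as [ps Hps].
  { intros s. destruct (R1 s) as [f [g H]]. exists (f, g); auto. }
  (* Carried to the representative of its isomorphism class, a member is determined by the images of
     its two marked vertices, so [n] is injective on each class. *)
  set (n := fun s => Cantor.to_nat (fst (ps s) (a s), fst (ps s) (b s))).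
  assert (INJ : forall s t, isomorphic (F s) (F t) -> n s = n t -> s = t).
  { intros s t H Q. apply R2 in H. apply Cantor.to_nat_inj in Q. inversion Q as [[Q1 Q2]].
    destruct (Hps s) as [S1 [S2 S3]]. destruct (Hps t) as [T1 [T2 T3]]. rewrite H in S3.
    apply (HP s t (fun x => snd (ps t) (fst (ps s) x)) (fun y => snd (ps s) (fst (ps t) y))).
    - intros x. rewrite T2; auto.
    - intros y. rewrite S2; auto.
    - intros x y. rewrite S3, T3, !T2. tauto.
    - rewrite Q1; auto.
    - rewrite Q2; auto. }
  set (comp := fun k (s : nat -> bool) i => s (Cantor.to_nat (k, i))).
  (* Otherwise choose for every [k] a column that the fibre over [k] misses; the [s] assembled from
     these columns lies in no fibre. *)
  assert (exists k, forall y, exists s, n s = k /\ comp k s = y) as [k Hk].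
  { apply NNPP; intros N.
    destruct (choice (fun k y => forall s, n s = k -> comp k s <> y)) as [y Hy].
    { intros k. apply NNPP; intros K. apply N; exists k. intros y. apply NNPP; intros K'.
      apply K; exists y. intros s S1 S2. apply K'; eauto. }
    set (s := fun j => y (fst (Cantor.of_nat j)) (snd (Cantor.of_nat j))).
    apply (Hy (n s) s eq_refl). apply functional_extensionality; intros i.
    unfold comp, s at 1. rewrite Cantor.cancel_of_to. reflexivity. }
  destruct (choice (fun y s => n s = k /\ comp k s = y)) as [sg Hsg]; auto.
  exists sg. intros s t N H. apply N.
  destruct (Hsg s) as [S1 <-]. destruct (Hsg t) as [T1 <-]. f_equal. apply INJ; auto. congruence.
Qed.

Lemma readable_family_nat (E : nat -> nat -> Prop) :
  connected E -> connected (complement E) -> readable_family E ->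
  exists F : (nat -> bool) -> (nat -> nat -> Prop),
    (forall s, is_graph (F s) /\ equimorphic (F s) E /\
               connected (F s) /\ connected (complement (F s))) /\
    (forall s t, s <> t -> ~ isomorphic (F s) (F t)).
Proof.
  intros C1 C2 [P [G [a [b [H1 [H2 [H3 [H4 [H5 [H6 [H7 H8]]]]]]]]]]].
  destruct (choice (fun s (ab : (nat -> vert) * (vert -> nat)) =>
    (forall n, P s (fst ab n) /\ snd ab (fst ab n) = n) /\ forall p, P s p -> fst ab (snd ab p) = p)) as [ab Hab].
  { intros s; apply carrier_enum; auto. }
  set (F := fun s x y => G s (fst (ab s) x) (fst (ab s) y)).
  destruct (nonisomorphic_subfamily F (fun s => snd (ab s) (a s)) (fun s => snd (ab s) (b s))) as [sg Hsg].
  { intros s t f g K1 K2 K3 K4 K5. destruct (Hab s) as [S1 S2]. destruct (Hab t) as [T1 T2].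
    destruct (H7 s) as [As Bs]. destruct (H7 t) as [At Bt].
    apply (H8 s t (fun p => fst (ab t) (f (snd (ab s) p))) (fun q => fst (ab s) (g (snd (ab t) q)))).
    - rsplits.
      + intros p Pp. split; [apply T1|]. rewrite (proj2 (T1 _)), K1; auto.
      + intros q Pq. split; [apply S1|]. rewrite (proj2 (S1 _)), K2; auto.
      + intros p q Pp Pq. specialize (K3 (snd (ab s) p) (snd (ab s) q)). unfold F in K3.
        rewrite !S2 in K3; auto.
    - rewrite K4; auto.
    - rewrite K5; auto. }
  exists (fun s => F (sg s)); split; auto. intros s0. generalize (sg s0); clear s0; intros s.
  destruct (Hab s) as [S1 S2].
  set (old := fun u => snd (ab s) (inl u)).
  assert (OLD : forall u, fst (ab s) (old u) = inl u) by (intros; apply S2; auto).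
  assert (FO : forall u v, F s (old u) (old v) <-> E u v) by (intros; unfold F; rewrite !OLD; auto).
  assert (OI : forall u v, old u = old v -> u = v) by (intros u v Q; pose proof (OLD u) as K; rewrite Q, OLD in K; congruence).
  assert (FS : forall x y, F s x y -> F s y x) by (intros; apply H3; auto).
  assert (CASES : forall x, (exists u, x = old u) \/ exists p, fst (ab s) x = inr p).
  { intros x. destruct (fst (ab s) x) as [u|p] eqn:Q; [left; exists u|right; eauto].
    unfold old. rewrite <- Q. symmetry; apply S1. }
  splits.
  - split; auto. intros x; apply H4.
  - split.
    + destruct (H5 s) as [g Hg]. exists (fun x => g (fst (ab s) x)). split.
      * intros x y Q. apply Hg in Q; try apply S1. rewrite <- (proj2 (S1 x)), Q. apply S1.
      * intros x y. apply Hg; apply S1.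
    + exists old. split; auto. intros x y; symmetry; auto.
  - apply (connected_extend E (F s) old); auto; [intros; apply FO; auto|].
    intros x. destruct (CASES x) as [[u ->]|[p Q]]; [exists u; auto|].
    destruct (H6 s p) as [[u Hu] _]; [rewrite <- Q; apply S1|]. exists u; right.
    unfold F. rewrite Q, OLD; auto.
  - apply (connected_extend (complement E) (complement (F s)) old); auto.
    + apply complement_sym; auto.
    + intros x y [K1 K2]. split; [intros Q; apply K1, OI; auto|]. rewrite FO; auto.
    + intros x. destruct (CASES x) as [[u ->]|[p Q]]; [exists u; auto|].
      destruct (H6 s p) as [_ [u Hu]]; [rewrite <- Q; apply S1|]. exists u; right. split.
      * intros ->. rewrite OLD in Q. discriminate.
      * unfold F. rewrite Q, OLD; auto.
Qed.

(** The Boolean unites the graph and its complement, so that arguments symmetric under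
    complementation are made once. *)
Lemma connected_cut (E : nat -> nat -> Prop) : connected E -> connected (complement E) ->
  forall (b : bool) (A : set), (exists u, A u) -> (exists w, ~ A w) ->
  exists u w, A u /\ ~ A w /\ (E u w <-> b = true).
Proof.
  intros [_ C1] [_ C2] b A [u Hu] [w Hw]. destruct b.
  - destruct (clos_cut E A u w (C1 u w) Hu Hw) as [x [y [H1 [H2 H3]]]]. exists x, y; splits; auto; tauto.
  - destruct (clos_cut _ A u w (C2 u w) Hu Hw) as [x [y [H1 [H2 [_ H3]]]]]. exists x, y; splits; auto.
    split; [contradiction|discriminate].
Qed.

Lemma cograph_no_P4 {V : Type} (E : V -> V -> Prop) : is_graph E -> cograph E ->
  forall a b c d, E a b -> E b c -> E c d -> ~ E a c -> ~ E b d -> ~ E a d -> False.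
Proof.
  intros [ES EI] HC a b c d ab bc cd ac bd ad. apply HC.
  exists (fun x => match x with p0 => a | p1 => b | p2 => c | p3 => d end).
  assert (a <> b) by (intros ->; eapply EI; eauto). assert (b <> c) by (intros ->; eapply EI; eauto).
  assert (c <> d) by (intros ->; eapply EI; eauto). assert (a <> c) by (intros ->; auto).
  assert (b <> d) by (intros ->; auto). assert (a <> d) by (intros ->; auto).
  split; intros [] []; simpl; intros; auto; try congruence; split; intros; auto;
    try (exfalso; eapply EI; eassumption); try contradiction; exfalso; auto.
Qed.

Theorem readable_family_exists (E : nat -> nat -> Prop) : is_graph E -> cograph E ->
  connected E -> connected (complement E) -> readable_family E.
Proof.
  intros HG HC C1 C2. pose proof HG as [ES EI].
  pose proof (cograph_no_P4 E HG HC) as NP. pose proof (connected_cut E C1 C2) as CUT.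
  destruct (classic (exists M, big E M)) as [[M HM]|N].
  - exact (kernel_family E ES EI NP CUT M HM).
  - apply (tame_family E ES EI NP CUT). intros M HM. apply NNPP; intros K. apply N. exists M; split; auto.
Qed.

Theorem theorem2p5 (V : Type) (E : V -> V -> Prop) :
  is_graph E -> countably_infinite V -> cograph E ->
  connected E -> connected (complement E) ->
  exists F : (nat -> bool) -> (nat -> nat -> Prop),
    (forall s, is_graph (F s) /\ equimorphic (F s) E /\
               connected (F s) /\ connected (complement (F s))) /\
    (forall s t, s <> t -> ~ isomorphic (F s) (F t)).
Proof.
  intros [ES EI] [f [g [GF FG]]] HC C1 C2.
  set (E' := fun x y => E (f x) (f y)).
  assert (FI : forall x y, f x = f y -> x = y) by (intros x y Q; rewrite <- (GF x), Q; auto).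
  assert (EG : forall x y, E x y <-> E' (g x) (g y)) by (intros; unfold E'; rewrite !FG; tauto).
  assert (G' : is_graph E') by (split; [intros x y; apply ES|intros x; apply EI]).
  assert (C1' : connected E').
  { apply (connected_extend E E' g); auto; [intros; apply ES; auto|apply EG|eauto]. }
  assert (C2' : connected (complement E')).
  { apply (connected_extend (complement E) _ g); auto; [apply complement_sym, G'| |eauto].
    intros x y [K1 K2]; split; [intros Q; apply K1; rewrite <- (FG x), Q; auto|]. rewrite <- EG; auto. }
  assert (HC' : cograph E').
  { intros [h [K1 K2]]. apply HC. exists (fun x => f (h x)). split; auto. }
  destruct (readable_family_nat E' C1' C2') as [F [F1 F2]]; [apply readable_family_exists; auto|].
  exists F; split; auto. intros s. destruct (F1 s) as [A1 [[[p [P1 P2]] [q [Q1 Q2]]] [A3 A4]]].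
  splits; auto. split.
  - exists (fun x => f (p x)); split; auto.
  - exists (fun x => q (g x)); split.
    + intros x y K. apply Q1 in K. rewrite <- (FG x), K; auto.
    + intros x y. rewrite EG; auto.
Qed.
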